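(* Let $[a,b]$ be a compact interval such that the function $(c,\vec x)\mapsto\det(\mathcal H_{\Phi_c(\vec x)})$ from $[a,b]\times\mathcal S$ to $\mathbb R$ does not vanish, and let $\vec\varphi_{c,1},\dots,\vec\varphi_{c,s}$ denote the solutions $\vec\varphi$ of $\nabla_{\Phi_c(\vec\varphi)}=0$ that correspond to local minimums of $\Phi_c$. Then, for all $c=\frac mn$ in $[a,b]$, the asymptotics of the number of simple $(n,m)$-$(R,\vec r)$-graphs is $$SG_{R,\vec r}(n,m)\sim\frac{n^{2m}}{2^m m!}\sum_{\vec\varphi\in\{\vec\varphi_{c,1},\dots,\vec\varphi_{c,s}\}}\left(\frac{\vec r^{\;\vec\varphi}}{\vec\varphi^{\;\vec\varphi}}\right)^n(\vec\varphi^TR\vec\varphi)^m\,\frac{\exp\!\Big(-\frac{c}{\vec\varphi^TR\vec\varphi}\mathrm{Tr}(\mathrm{diag}(\vec\varphi)R)-\big(\frac{c}{\vec\varphi^TR\vec\varphi}\big)^2\mathrm{Tr}\big((\mathrm{diag}(\vec\varphi)R)^2\big)\Big)}{\sqrt{\det(\mathcal H_{\Phi_c(\vec\varphi)})\prod_{i=1}^q\varphi_i}} .$$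
   Context: Fix a positive integer $q$, an irreducible symmetric $q\times q$ matrix $R$ and a vector $\vec r=(r_1,\dots,r_q)^T$, both with non-negative coefficients. Vectors are column vectors; $\vec u^{\,\vec v}=\prod_i u_i^{v_i}$; $\log$ acts coordinate-wise; $\mathrm{diag}(\vec x)$ is the diagonal matrix with diagonal $\vec x$; $\mathrm{Tr}$ is the trace. Asymptotics are for $n\to\infty$ with $R,\vec r$ fixed. A simple $(R,\vec r)$-graph is a labelled graph on vertex set $\{1,\dots,n\}$ with neither loops nor multiple edges, in which each vertex $v$ is given a type $t(v)\in\{1,\dots,q\}$; its weight is $\omega(G)=\prod_{u}r_{t(u)}\prod_{\overline{vw}}R_{t(v),t(w)}$ (products over the vertices and the edges). The ''number'' of such graphs in a family is the sum of their weights; $SG_{R,\vec r}(n,m)$ is the number of simple $(n,m)$-$(R,\vec r)$-graphs, i.e. those with $n$ vertices and $m$ edges. Let $\mathcal S=\{\vec x\in\mathbb R_{\ge0}^q : x_1+\dots+x_q=1\}$ and, on $\mathcal S$ (with the convention $0\log 0=0$), $\Phi_c(\vec x)=\sum_i x_i(\log x_i-\log r_i)-c\log(\vec x^TR\vec x)$. Let $E$ denote a $q\times(q-1)$ matrix with left-kernel of dimension $1$ containing the all-ones row vector (for example, the matrix whose first $q-1$ rows form the identity matrix and whose last row is $(-1,\dots,-1)$). The gradient and Hessian (the coefficients in the Taylor expansion of $\vec\epsilon\mapsto\Phi_c(\vec x+E\vec\epsilon)$ near any point $\vec x$ of the interior of $\mathcal S$) are $$\nabla_{\Phi_c(\vec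 x)}=\Big(\log(\vec x)^T-\log(\vec r)^T-\tfrac{2c}{\vec x^TR\vec x}\vec x^TR\Big)E,$$ $$\mathcal H_{\Phi_c(\vec x)}=E^T\Big(\mathrm{diag}(\vec x)^{-1}+\tfrac{2c}{\vec x^TR\vec x}\big(\tfrac{2}{\vec x^TR\vec x}R\vec x\,\vec x^TR-R\big)\Big)E .$$
   Formalization: The r_i are assumed positive, since log r_i is undefined and the formula fails when some r_i=0; E is normalized by det(E^T E)=q, as for the example matrix, since rescaling E changes det(H) and makes the formula false. *)

(* Defs.v *)
(* MathComp + MathComp-Analysis; the real numbers are an arbitrary realType. *)
From HB Require Import structures.
From mathcomp Require Import all_boot all_order all_algebra.
From mathcomp Require Import all_classical all_reals all_analysis.
Set Implicit Arguments.
Unset Strict Implicit.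
Unset Printing Implicit Defensive.
Import Order.TTheory GRing.Theory Num.Theory.
Import numFieldNormedType.Exports.
Local Open Scope classical_set_scope.
Local Open Scope ring_scope.

(* No simultaneous permutation of the rows and columns makes R block
   triangular: the indices cannot be split into two nonempty classes A and
   ~: A with all entries of R from A to ~: A equal to zero. *)
Definition irreducible_matrix (K : realType) (q : nat) (R : 'M[K]_q) : Prop :=
  forall A : {set 'I_q}, A != finset.set0 -> A != [set: 'I_q]%SET ->
    exists i j, [/\ i \in A, j \notin A & R i j != 0].

(* A vertex typing together with an edge set; an edge {v, w} of a simple
   graph is stored once, as the pair (v, w) with v < w. *)
Definition typed_graph (q n : nat) : finType :=
  ({ffun 'I_n -> 'I_q} * {set 'I_n * 'I_n})%type.

Definition simple_graphs (q n m : nat) : {set typed_graph q n} :=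
  [set G : typed_graph q n |
     [forall e in G.2, (e.1 < e.2)%N] & #|G.2| == m]%SET.

(* Meant for symmetric R, so that the orientation of e is irrelevant. *)
Definition graph_weight (K : realType) (q n : nat) (R : 'M[K]_q) (r : 'cV[K]_q)
    (G : typed_graph q n) : K :=
  (\prod_(u < n) r (G.1 u) 0) * \prod_(e in G.2) R (G.1 e.1) (G.1 e.2).

Definition SG (K : realType) (q : nat) (R : 'M[K]_q) (r : 'cV[K]_q)
    (n m : nat) : K :=
  \sum_(G in simple_graphs q n m) graph_weight R r G.

Definition simplex (K : realType) (q : nat) : set 'cV[K]_q :=
  [set x | (forall i, 0 <= x i 0) /\ \sum_i x i 0 = 1].

(* Interior relative to the hyperplane x_1 + ... + x_q = 1. *)
Definition simplex_interior (K : realType) (q : nat) : set 'cV[K]_q :=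
  [set x | (forall i, 0 < x i 0) /\ \sum_i x i 0 = 1].

Definition qform (K : realType) (q : nat) (R : 'M[K]_q) (x : 'cV[K]_q) : K :=
  (x^T *m R *m x) 0 0.

(* As ln 0 = 0, the convention 0 log 0 = 0 holds. *)
Definition Phi (K : realType) (q : nat) (R : 'M[K]_q) (r : 'cV[K]_q) (c : K)
    (x : 'cV[K]_q) : K :=
  \sum_i x i 0 * (ln (x i 0) - ln (r i 0)) - c * ln (qform R x).

(* The determinant of the Hessian of Phi along E is multiplied by (det P)^2
   when E is replaced by E *m P, so the asymptotic formula determines E up to
   det P = 1 or -1. The last condition is this normalization: it is the value
   of \det (E^T *m E) for the matrix E whose first q - 1 rows form the identity
   matrix and whose last row is (-1, ..., -1). *)
Definition simplex_directions (K : realType) (q : nat) (E : 'M[K]_(q, q.-1)) :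
    Prop :=
  [/\ \rank (kermx E) = 1%N, (const_mx 1 : 'rV[K]_q) *m E = 0
    & \det (E^T *m E) = q%:R].

Definition grad_Phi (K : realType) (q : nat) (R : 'M[K]_q) (r : 'cV[K]_q)
    (E : 'M[K]_(q, q.-1)) (c : K) (x : 'cV[K]_q) : 'rV[K]_(q.-1) :=
  ((map_mx (@ln K) x)^T - (map_mx (@ln K) r)^T
   - (2 * c / qform R x) *: (x^T *m R)) *m E.

Definition hess_Phi (K : realType) (q : nat) (R : 'M[K]_q)
    (E : 'M[K]_(q, q.-1)) (c : K) (x : 'cV[K]_q) : 'M[K]_(q.-1) :=
  E^T *m
  (diag_mx (map_mx GRing.inv x^T)
   + (2 * c / qform R x) *:
       ((2 / qform R x) *: (R *m x *m x^T *m R) - R))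
  *m E.

Definition local_minimum_Phi (K : realType) (q : nat) (R : 'M[K]_q)
    (r : 'cV[K]_q) (c : K) (x : 'cV[K]_q) : Prop :=
  \forall y \near x, simplex y -> Phi R r c x <= Phi R r c y.

Definition critical_minima (K : realType) (q : nat) (R : 'M[K]_q)
    (r : 'cV[K]_q) (E : 'M[K]_(q, q.-1)) (c : K) : set 'cV[K]_q :=
  [set phi | [/\ simplex_interior phi, grad_Phi R r E c phi = 0
               & local_minimum_Phi R r c phi]].

Definition vpow (K : realType) (q : nat) (u v : 'cV[K]_q) : K :=
  \prod_i (u i 0 `^ v i 0).

Definition minimum_term (K : realType) (q : nat) (R : 'M[K]_q) (r : 'cV[K]_q)
    (E : 'M[K]_(q, q.-1)) (n m : nat) (c : K) (phi : 'cV[K]_q) : K :=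
  let k := c / qform R phi in
  let D := diag_mx phi^T in
  (vpow r phi / vpow phi phi) ^+ n * qform R phi ^+ m *
  (expR (- k * \tr (D *m R) - k ^+ 2 * \tr ((D *m R) *m (D *m R)))
   / Num.sqrt (\det (hess_Phi R E c phi) * \prod_i phi i 0)).

(* The sum is over a classical set and is 0 by convention when infinitely many
   of its terms are nonzero, so that an asymptotic equivalence with a positive
   quantity asserts in particular that the set of minima is finite. *)
Definition SG_estimate (K : realType) (q : nat) (R : 'M[K]_q) (r : 'cV[K]_q)
    (E : 'M[K]_(q, q.-1)) (n m : nat) : K :=
  let c := m%:R / n%:R in
  n%:R ^+ (2 * m) / (2 ^+ m * (m`!)%:R) *
  \sum_(phi \in critical_minima R r E c) minimum_term R r E n m c phi.

(* Main.v *)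
Require Import Defs.
From mathcomp Require Import all_boot all_order all_algebra.
From mathcomp Require Import all_classical all_reals all_analysis.
From mathcomp Require Import ring lra.
Set Implicit Arguments.
Unset Strict Implicit.
Unset Printing Implicit Defensive.
Import Order.TTheory GRing.Theory Num.Theory.
Import numFieldNormedType.Exports.
Local Open Scope classical_set_scope.
Local Open Scope ring_scope.

(** Grouping the graphs by the types of their vertices, the number of graphs is
    the sum over the typings t of r^t e_m, where e_m is the m-th elementary
    symmetric function of the weights R_(t v, t w) of the pairs v < w
    (SG_elem_sym). This sum is evaluated by Laplace's method; each step holds up
    to a factor between exp (- d) and exp d for an arbitrarily small d, which
    log_close expresses.

    Edges. With p_k the k-th power sum of the edge weights, m! e_m / p_1^m is
    the probability that m independent edges are distinct. The truncations of
    Newton's identities bound it from both sides by recursions whose solution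
    is about exp (- m^2 p_2 / (2 p_1^2)) (distinct_ratio_le, distinct_ratio_ge).
    The p_k depend only on the vector x of the proportions of the types
    (power_sum_edge_weights). So m! e_m is (n^2 / 2 x^T R x)^m times a constant,
    in which the exclusion of loops accounts for Tr (D R) and the exclusion of
    multiple edges for Tr ((D R)^2) (edge_factor).

    Vertices. The typings with proportions x are counted by a multinomial
    coefficient. By Stirling's formula the total contribution of these typings
    is exp (- n Phi_c (x)) up to a slowly varying factor (count_term).

    Laplace's method. Around a nondegenerate minimum of Phi_c the sum over x is
    a Gaussian sum over a lattice of mesh 1 / sqrt n, evaluated by completing
    squares one coordinate at a time (gauss_lattice_upper, gauss_lattice_lower);
    this gives the determinant of the Hessian (local_sum). On the compact
    simplex exp (- Phi_c) is upper semicontinuous, and its maxima are interior,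
    since the entropy has infinite slope at the boundary; they are therefore
    critical minima of Phi_c. Outside of boxes around the critical minima,
    exp (- Phi_c) is smaller than its maximum by a constant factor
    (growth_gap), which is raised to the power n and beats the polynomial
    number of possible x (far_sum).

    Uniformity. As the Hessian is nondegenerate, the critical minima for c near
    c0 correspond one to one to those for c0 (crit_unique, crit_exists,
    crit_near_crit), and all estimates hold simultaneously for c near c0. A
    compactness argument then covers the interval (SG_asymptotics_uniform).

    The constants. So far the formula carries a factor kappa^(q-1), where kappa
    is sqrt 2 times the mass of exp (- x^2) divided by the constant in
    Stirling's formula. As kappa does not depend on R and r, the case q = 2,
    R = 1, r = 1, m = 0, in which there are 2^n graphs, shows that kappa = 1
    (kappa1). *)

(** * Elementary symmetric functions *)

(** Taking coefficients of the generating polynomial makes the recursion over the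
    weights immediate. *)
Definition elem_sym (K : realType) (s : seq K) (k : nat) : K :=
  (\prod_(w <- s) (1 + w *: 'X))`_k.

Definition power_sum (K : realType) (s : seq K) (k : nat) : K :=
  \sum_(w <- s) w ^+ k.

Lemma elem_sym_nil (K : realType) k : elem_sym ([::] : seq K) k = (k == 0%N)%:R.
Proof. by rewrite /elem_sym big_nil coef1. Qed.

Lemma elem_sym_cons0 (K : realType) (w : K) s : elem_sym (w :: s) 0 = elem_sym s 0.
Proof.
by rewrite /elem_sym big_cons mulrDl mul1r coefD -scalerAl coefZ coefXM mulr0 addr0.
Qed.

Lemma elem_sym_consS (K : realType) (w : K) s k :
  elem_sym (w :: s) k.+1 = elem_sym s k.+1 + w * elem_sym s k.
Proof. by rewrite /elem_sym big_cons mulrDl mul1r coefD -scalerAl coefZ coefXM. Qed.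

Lemma elem_sym0 (K : realType) (s : seq K) : elem_sym s 0 = 1.
Proof. by elim: s => [|w s IH]; rewrite ?elem_sym_nil ?elem_sym_cons0. Qed.

Lemma power_sum_cons (K : realType) (w : K) s k :
  power_sum (w :: s) k = w ^+ k + power_sum s k.
Proof. by rewrite /power_sum big_cons. Qed.

Lemma elem_sym1 (K : realType) (s : seq K) : elem_sym s 1 = power_sum s 1.
Proof.
elim: s => [|w s IH]; first by rewrite elem_sym_nil /power_sum big_nil.
by rewrite elem_sym_consS IH elem_sym0 power_sum_cons expr1 mulr1 addrC.
Qed.

Lemma elem_sym2 (K : realType) (s : seq K) :
  2 * elem_sym s 2 = power_sum s 1 * elem_sym s 1 - power_sum s 2.
Proof.
elim: s => [|w s IH]; first by rewrite !elem_sym_nil /power_sum !big_nil /=; ring.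
rewrite !elem_sym_consS mulrDr IH elem_sym0 !elem_sym1 !power_sum_cons; ring.
Qed.

Lemma elem_sym_ge0 (K : realType) (s : seq K) k :
  (forall w, w \in s -> 0 <= w) -> 0 <= elem_sym s k.
Proof.
elim: s k => [|w s IH] k s0; first by rewrite elem_sym_nil.
have s0' v : v \in s -> 0 <= v by move=> vs; apply: s0; rewrite inE vs orbT.
case: k => [|k]; first by rewrite elem_sym0.
by rewrite elem_sym_consS addr_ge0 ?mulr_ge0 ?IH // s0 // mem_head.
Qed.

Lemma power_sum_ge0 (K : realType) (s : seq K) k :
  (forall w, w \in s -> 0 <= w) -> 0 <= power_sum s k.
Proof.
by move=> s0; rewrite /power_sum big_seq sumr_ge0 // => w /s0 w0; rewrite exprn_ge0.
Qed.

(** The truncations of Newton's identity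
    (k+1) e_(k+1) = p_1 e_k - p_2 e_(k-1) + p_3 e_(k-2) - ...
    are alternately upper and lower bounds when all weights are nonnegative:
    when a weight w is added, the two sides differ by a term w^j e_(k+1-j). *)
Lemma newton_upper1 (K : realType) (s : seq K) k :
  (forall w, w \in s -> 0 <= w) ->
  k.+1%:R * elem_sym s k.+1 <= power_sum s 1 * elem_sym s k.
Proof.
elim: s k => [|w s IH] k s0.
  by rewrite !elem_sym_nil /power_sum big_nil mulr0 mul0r.
have s0' v : v \in s -> 0 <= v by move=> vs; apply: s0; rewrite inE vs orbT.
have w0 : 0 <= w by apply: s0; rewrite mem_head.
have P0 := power_sum_ge0 1 s0'.
case: k => [|k]; first by rewrite elem_sym1 elem_sym0 mulr1 mul1r.
rewrite !elem_sym_consS power_sum_cons expr1.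
have := IH k.+1 s0'; have := ler_wpM2l w0 (IH k s0').
have e0 := elem_sym_ge0 k s0'; have := mulr_ge0 (mulr_ge0 w0 w0) e0.
rewrite -[in k.+2%:R]natr1; set x := k.+1%:R; lra.
Qed.

Lemma newton_lower2 (K : realType) (s : seq K) k :
  (forall w, w \in s -> 0 <= w) ->
  power_sum s 1 * elem_sym s k.+1 - power_sum s 2 * elem_sym s k <=
  k.+2%:R * elem_sym s k.+2.
Proof.
elim: s k => [|w s IH] k s0.
  by rewrite !elem_sym_nil /power_sum !big_nil mulr0 !mul0r subr0.
have s0' v : v \in s -> 0 <= v by move=> vs; apply: s0; rewrite inE vs orbT.
have w0 : 0 <= w by apply: s0; rewrite mem_head.
case: k => [|k]; first by rewrite elem_sym2 elem_sym0; lra.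
rewrite !elem_sym_consS !power_sum_cons expr1.
have := IH k.+1 s0'; have := ler_wpM2l w0 (IH k s0').
have e0 := elem_sym_ge0 k s0'; have := mulr_ge0 (exprn_ge0 3 w0) e0.
rewrite -[in k.+3%:R]natr1; set x := k.+2%:R; lra.
Qed.

Lemma newton_upper3 (K : realType) (s : seq K) k :
  (forall w, w \in s -> 0 <= w) ->
  k.+3%:R * elem_sym s k.+3 <=
  power_sum s 1 * elem_sym s k.+2 - power_sum s 2 * elem_sym s k.+1
  + power_sum s 3 * elem_sym s k.
Proof.
elim: s k => [|w s IH] k s0.
  by rewrite !elem_sym_nil /power_sum !big_nil mulr0 !mul0r subr0 addr0.
have s0' v : v \in s -> 0 <= v by move=> vs; apply: s0; rewrite inE vs orbT.
have w0 : 0 <= w by apply: s0; rewrite mem_head.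
have P0 := power_sum_ge0 3 s0'.
case: k => [|k].
  have := IH 0%N s0'; rewrite !elem_sym_consS !power_sum_cons expr1 !elem_sym0.
  have := elem_sym2 s; rewrite elem_sym1 => {}IH; set x := (3%:R : K).
  have -> : x = 2 + 1 by rewrite /x; ring.
  set e3 := elem_sym s 3; set e2 := elem_sym s 2 in IH *.
  have -> : (2 + 1) * (e3 + w * e2) = (2 + 1) * e3 + w * (2 * e2) + w * e2.
    by ring.
  rewrite IH; lra.
rewrite !elem_sym_consS !power_sum_cons expr1.
have := IH k.+1 s0'; have := ler_wpM2l w0 (IH k s0').
have e0 := elem_sym_ge0 k s0'; have := mulr_ge0 (exprn_ge0 4 w0) e0.
have := mulr_ge0 w0 (mulr_ge0 P0 e0).
rewrite -[in k.+4%:R]natr1; set x := k.+3%:R; lra.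
Qed.

Lemma expR_lower_quadratic (K : realType) (y : K) :
  0 <= y -> y <= 1 / 2 -> expR (- (y + 2 * y ^+ 2)) <= 1 - y.
Proof.
move=> y0 y1; rewrite expRN -[1 - y]invrK lef_pV2 ?posrE ?expR_gt0 //; last first.
  by rewrite invr_gt0; lra.
apply: le_trans (expR_ge1Dx _).
rewrite -[_^-1]mul1r ler_pdivrMr; last by lra.
have := mulr_ge0 (sqr_ge0 y) (_ : 0 <= 1 - 2 * y); rewrite expr2; nra.
Qed.

(** The probability that m independent edges, drawn with probability
    proportional to their weights, are distinct. *)
Definition distinct_ratio (K : realType) (s : seq K) (m : nat) : K :=
  m`!%:R * elem_sym s m / power_sum s 1 ^+ m.

Section DistinctRatio.
Context (K : realType) (s : seq K).
Hypothesis s0 : forall w, w \in s -> 0 <= w.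
Hypothesis p1_gt0 : 0 < power_sum s 1.

Let b := distinct_ratio s.
Let al := power_sum s 2 / power_sum s 1 ^+ 2.
Let be := power_sum s 3 / power_sum s 1 ^+ 3.

Let al_ge0 : 0 <= al.
Proof. by rewrite divr_ge0 ?exprn_ge0 ?power_sum_ge0. Qed.

Let be_ge0 : 0 <= be.
Proof. by rewrite divr_ge0 ?exprn_ge0 ?power_sum_ge0. Qed.

Let b_ge0 k : 0 <= b k.
Proof. by rewrite divr_ge0 ?exprn_ge0 ?mulr_ge0 ?elem_sym_ge0 // ltW. Qed.

Lemma distinct_ratio0 : b 0 = 1.
Proof. by rewrite /b /distinct_ratio elem_sym0 fact0 expr0 invr1 !mulr1. Qed.

Lemma distinct_ratio1 : b 1 = 1.
Proof.
by rewrite /b /distinct_ratio elem_sym1 expr1 mul1r divff ?gt_eqF.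
Qed.

Let bE k : k`!%:R * elem_sym s k = b k * power_sum s 1 ^+ k.
Proof. by rewrite /b /distinct_ratio divfK // expf_neq0 // gt_eqF. Qed.

Lemma distinct_ratio_nonincr k : b k.+1 <= b k.
Proof.
have := newton_upper1 k s0 => H.
rewrite /b /distinct_ratio exprS invfM mulrA ler_pdivrMr ?exprn_gt0 //.
rewrite divfK ?expf_neq0 ?gt_eqF // ler_pdivrMr // factS natrM.
rewrite [_%:R * _%:R]mulrC -mulrA -[X in _ <= X]mulrA ler_wpM2l // mulrC.
by rewrite [X in _ <= X]mulrC mulrC.
Qed.

Lemma distinct_ratio_lower k : b k.+1 - k.+1%:R * al * b k <= b k.+2.
Proof.
have H := newton_lower2 k s0; set P := power_sum s 1 in H *.
have P0 : P != 0 by rewrite gt_eqF.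
rewrite -(ler_pM2r (exprn_gt0 k.+2 p1_gt0)) -bE.
rewrite -/P mulrBl.
have -> : b k.+1 * P ^+ k.+2 = k.+1`!%:R * (P * elem_sym s k.+1).
  by rewrite exprSr mulrA -bE; ring.
have -> : k.+1%:R * al * b k * P ^+ k.+2 = k.+1`!%:R * (power_sum s 2 * elem_sym s k).
  rewrite factS natrM; transitivity (k.+1%:R * (al * P ^+ 2) * (b k * P ^+ k)).
    by rewrite !exprS expr0; ring.
  by rewrite -bE /al -/P divfK ?expf_neq0 //; ring.
by rewrite -mulrBr [k.+2`!]factS natrM -mulrA mulrCA ler_wpM2l.
Qed.

Lemma distinct_ratio_upper k :
  b k.+3 <= b k.+2 - k.+2%:R * al * b k.+1 + k.+2%:R * k.+1%:R * be * b k.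
Proof.
have H := newton_upper3 k s0; set P := power_sum s 1 in H *.
have P0 : P != 0 by rewrite gt_eqF.
rewrite -(ler_pM2r (exprn_gt0 k.+3 p1_gt0)) -bE -/P mulrDl mulrBl.
have -> : b k.+2 * P ^+ k.+3 = k.+2`!%:R * (P * elem_sym s k.+2).
  by rewrite exprSr mulrA -bE; ring.
have -> : k.+2%:R * al * b k.+1 * P ^+ k.+3 =
    k.+2`!%:R * (power_sum s 2 * elem_sym s k.+1).
  rewrite [k.+2`!]factS natrM.
  transitivity (k.+2%:R * (al * P ^+ 2) * (b k.+1 * P ^+ k.+1)).
    by rewrite !exprS expr0; ring.
  by rewrite -bE /al -/P divfK ?expf_neq0 //; ring.
have -> : k.+2%:R * k.+1%:R * be * b k * P ^+ k.+3 =
    k.+2`!%:R * (power_sum s 3 * elem_sym s k).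
  rewrite !factS !natrM.
  transitivity (k.+2%:R * k.+1%:R * (be * P ^+ 3) * (b k * P ^+ k)).
    by rewrite !exprS expr0; ring.
  by rewrite -bE /be -/P divfK ?expf_neq0 //; ring.
by rewrite -mulrBr -mulrDr [k.+3`!]factS natrM -mulrA mulrCA ler_wpM2l.
Qed.

(** Newton's lower bound contains the value two steps earlier. As one step
    decreases b at most by a factor 1 + 4 al m, that value can be traded for
    the previous one; the second conclusion serves the upper bound in the same
    way. *)
Lemma distinct_ratio_step_lower m k : al * m%:R <= 1 / 4 -> (k < m)%N ->
  (1 - k%:R * al * (1 + 4 * (al * m%:R))) * b k <= b k.+1 /\ b k <= 2 * b k.+1.
Proof.
move=> am; set y := al * m%:R in am *.
have y0 : 0 <= y by rewrite mulr_ge0.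
elim: k => [|k IH] km.
  by rewrite !mul0r subr0 mul1r distinct_ratio0 distinct_ratio1 mulr1; lra.
have [IH1 IH2] := IH (ltnW km).
have kmy : k.+1%:R * al <= y by rewrite mulrC ler_wpM2l // ler_nat ltnW.
have ky : k%:R * al <= y.
  by apply: le_trans kmy; rewrite ler_wpM2r // ler_nat.
have L := distinct_ratio_lower k.
have b1 := b_ge0 k.+1.
have Hb : b k <= (1 + 4 * y) * b k.+1.
  have : (1 - 2 * y) * b k <= b k.+1.
    apply: le_trans IH1; rewrite ler_wpM2r //.
    have : k%:R * al * (1 + 4 * y) <= y * (1 + 4 * y).
      by rewrite ler_wpM2r //; lra.
    have : y * (4 * y) <= y * 1 by rewrite ler_wpM2l //; lra.
    lra.
  move=> H; have := ler_wpM2l (_ : 0 <= 1 + 4 * y) H.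
  have : b k <= (1 + 4 * y) * ((1 - 2 * y) * b k).
    have : 0 <= 2 * y * (1 - 4 * y) * b k.
      by rewrite mulr_ge0 // mulr_ge0 //; lra.
    lra.
  move=> H1 H2; apply: le_trans H1 _; apply: H2; lra.
have k0 : 0 <= k.+1%:R * al by rewrite mulr_ge0.
have E1 : (1 - k.+1%:R * al * (1 + 4 * y)) * b k.+1 <= b k.+2.
  apply: le_trans L; have := ler_wpM2l k0 Hb; lra.
split=> //.
have : (1 / 2) * b k.+1 <= (1 - k.+1%:R * al * (1 + 4 * y)) * b k.+1.
  rewrite ler_wpM2r //.
  have : k.+1%:R * al * (1 + 4 * y) <= (1 / 4) * 2.
    by apply: ler_pM => //; lra.
  lra.
lra.
Qed.

Lemma distinct_ratio_step_upper m k : al * m%:R <= 1 / 4 -> (k < m)%N ->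
  b k.+1 <= (1 - k%:R * al + 4 * k%:R ^+ 2 * be) * b k.
Proof.
move=> am; case: k => [|[|k]] km.
- by rewrite distinct_ratio0 distinct_ratio1 expr2 !(mul0r, mulr0); lra.
- rewrite distinct_ratio1 mulr1 expr1n mulr1 mul1r.
  rewrite /b /distinct_ratio (_ : 2`! = 2)//= elem_sym2 elem_sym1 -expr2 mulrBl divff.
    by rewrite -/al lerDl mulr_ge0.
  by rewrite expf_neq0 // gt_eqF.
have [_ H1] := distinct_ratio_step_lower am (ltnW (ltnW km)).
have [_ H2] := distinct_ratio_step_lower am (ltnW km).
have U := distinct_ratio_upper k.
have D := distinct_ratio_nonincr k.+1.
apply: le_trans U _.
have : k.+2%:R * al * b k.+2 <= k.+2%:R * al * b k.+1.
  by rewrite ler_wpM2l // mulr_ge0.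
have : k.+2%:R * k.+1%:R * be * b k <= k.+2%:R * k.+2%:R * be * (4 * b k.+2).
  apply: ler_pM => //; first by rewrite (mulr_ge0 _ be_ge0) // mulr_ge0.
    by rewrite (ler_wpM2r be_ge0) // ler_wpM2l // ler_nat.
  lra.
rewrite expr2; lra.
Qed.

(** Each factor b_(k+1) / b_k is 1 - k al up to second-order terms, so the
    product telescopes into a Gaussian in m. *)
Lemma distinct_ratio_le m : al * m%:R <= 1 / 4 ->
  b m <= expR (- (al * m%:R ^+ 2 / 2) + al * m%:R / 2 + 4 * be * m%:R ^+ 3).
Proof.
move=> am; suff H k : (k <= m)%N ->
    b k <= expR (- (al * k%:R * (k%:R - 1) / 2) + 4 * be * m%:R ^+ 2 * k%:R).
  by apply: le_trans (H m (leqnn m)) _; rewrite ler_expR; lra.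
elim: k => [|k IH] km.
  by rewrite distinct_ratio0 !(mulr0, mul0r) oppr0 addr0 expR0.
have := distinct_ratio_step_upper am km => H; apply: le_trans H _.
have k0 : 0 <= k%:R :> K by [].
have kM : k%:R <= m%:R :> K by rewrite ler_nat ltnW.
have Hk : k%:R ^+ 2 <= m%:R ^+ 2 :> K by rewrite lerXn2r ?nnegrE.
set x := (k%:R : K) in k0 kM Hk IH *; set M := (m%:R : K) in kM Hk am IH *.
rewrite -[k.+1%:R]natr1 -/x.
have -> : - (al * (x + 1) * (x + 1 - 1) / 2) + 4 * be * M ^+ 2 * (x + 1) =
   (- x * al + 4 * M ^+ 2 * be) + (- (al * x * (x - 1) / 2) + 4 * be * M ^+ 2 * x).
  by field.
rewrite expRD; apply: le_trans (_ : expR (- x * al + 4 * M ^+ 2 * be) * b k <= _).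
  rewrite ler_wpM2r //; apply: le_trans (expR_ge1Dx _).
  have := ler_wpM2r be_ge0 Hk; lra.
by rewrite ler_wpM2l ?expR_ge0 // IH // ltnW.
Qed.

Lemma distinct_ratio_ge m : al * m%:R <= 1 / 4 ->
  expR (- (al * m%:R ^+ 2 / 2) - 12 * al ^+ 2 * m%:R ^+ 3) <= b m.
Proof.
move=> am; suff H k : (k <= m)%N ->
    expR (- (al * k%:R * (k%:R - 1) / 2) - 12 * al ^+ 2 * m%:R ^+ 2 * k%:R) <= b k.
  apply: le_trans (H m (leqnn m)); rewrite ler_expR.
  have : 0 <= al * m%:R by rewrite (mulr_ge0 al_ge0).
  lra.
elim: k => [|k IH] km.
  by rewrite distinct_ratio0 !(mulr0, mul0r) subr0 oppr0 expR0.
have [H _] := distinct_ratio_step_lower am km; apply: le_trans H.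
have k0 : 0 <= k%:R :> K by [].
have kM : k%:R <= m%:R :> K by rewrite ler_nat ltnW.
set x := (k%:R : K) in k0 kM IH *; set M := (m%:R : K) in kM am IH *.
rewrite -[k.+1%:R]natr1 -/x.
have -> : - (al * (x + 1) * (x + 1 - 1) / 2) - 12 * al ^+ 2 * M ^+ 2 * (x + 1) =
   (- (x * al + 12 * (al * M) ^+ 2)) +
   (- (al * x * (x - 1) / 2) - 12 * al ^+ 2 * M ^+ 2 * x).
  by field.
rewrite expRD; set y := al * M in am *.
have y0 : 0 <= y by rewrite mulr_ge0.
have xy : x * al <= y by rewrite mulrC ler_wpM2l.
have xa : 0 <= x * al by rewrite mulr_ge0.
apply: ler_pM; rewrite ?expR_ge0 ?IH 1?ltnW //.
set z := x * al in xy xa *.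
have zy : z * y <= y * y by rewrite ler_wpM2r.
have z2 : z * (1 + 4 * y) <= 2 * z by rewrite mulrC ler_wpM2r //; lra.
have z20 : 0 <= z * (1 + 4 * y) by rewrite mulr_ge0 //; lra.
apply: le_trans (expR_lower_quadratic z20 _); last by lra.
rewrite ler_expR lerN2 expr2 mulrDr mulr1.
have : z * (1 + 4 * y) * (z * (1 + 4 * y)) <= 2 * z * (2 * z) by apply: ler_pM.
have : z * z <= y * y by apply: ler_pM.
rewrite expr2; lra.
Qed.

End DistinctRatio.

(** * Simple graphs as elementary symmetric functions *)

Lemma sum_fsets_elem_sym (K : realType) (I : finType) (P : {pred I}) (w : I -> K) (m : nat) :
  \sum_(S : {set I} | (S \subset P) && (#|S| == m)) \prod_(i in S) w i =
  elem_sym [seq w i | i <- enum P] m.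
Proof.
rewrite /elem_sym big_map big_enum /= [in RHS]big_mkcond /=.
under [in RHS]eq_bigr => i _.
  rewrite (_ : (if _ then _ else _) = (if i \in P then w i else 0) *: 'X + 1).
    over.
  by case: ifP => _; rewrite ?scale0r ?add0r // addrC.
rewrite bigA_distr coef_sum /=.
under [in RHS]eq_bigr => J _.
  rewrite -big_mkcond /= scaler_prod prodr_const coefZ coefXn; over.
rewrite [LHS]big_mkcond /=; apply: eq_big => J; first by rewrite inE.
move=> _; rewrite [m == _]eq_sym; case: (#|J| == m); rewrite ?andbF ?mulr0 //.
rewrite andbT /= mulr1; case: ifP => [JP|/negbT/fintype.subsetPn [i iJ iP]].
  by apply: eq_bigr => i iJ; rewrite (fintype.subsetP JP).
by rewrite (bigD1 i iJ) /= (negbTE iP) mul0r.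
Qed.

Definition edge_weights (K : realType) (q n : nat) (R : 'M[K]_q)
    (t : {ffun 'I_n -> 'I_q}) : seq K :=
  [seq R (t e.1) (t e.2) | e <- enum [pred e : 'I_n * 'I_n | (e.1 < e.2)%N]].

Definition type_weight (K : realType) (q n : nat) (r : 'cV[K]_q)
    (t : {ffun 'I_n -> 'I_q}) : K := \prod_u r (t u) 0.

(** For a fixed typing, summing over the edge sets of size m is summing over the
    m-subsets of the pairs v < w. *)
Lemma SG_elem_sym (K : realType) (q n m : nat) (R : 'M[K]_q) (r : 'cV[K]_q) :
  SG R r n m =
  \sum_(t : {ffun 'I_n -> 'I_q}) type_weight r t * elem_sym (edge_weights R t) m.
Proof.
rewrite /SG.
transitivity (\sum_(t : {ffun 'I_n -> 'I_q})
   \sum_(S : {set 'I_n * 'I_n} |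
      (S \subset [pred e : 'I_n * 'I_n | (e.1 < e.2)%N]) && (#|S| == m))
     graph_weight R r (t, S)).
  rewrite pair_big_dep /=; apply: eq_big => [[t S]|[t S] _] //=.
  rewrite inE /=; congr (_ && _); apply/forall_inP/fintype.subsetP => H e eS.
    by have := H e eS; rewrite inE.
  by have := H e eS; rewrite inE.
apply: eq_bigr => t _; rewrite /edge_weights -sum_fsets_elem_sym big_distrr /=.
by apply: eq_bigr.
Qed.

Definition density (K : realType) (q n : nat) (t : {ffun 'I_n -> 'I_q}) :
    'cV[K]_q :=
  \col_i (#|[pred u | t u == i]|%:R / n%:R).

Lemma sum_by_type (K : realType) (q n : nat) (t : {ffun 'I_n -> 'I_q})
    (f : 'I_q -> K) : (0 < n)%N ->
  \sum_u f (t u) = n%:R * \sum_i density K t i 0 * f i.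
Proof.
move=> n0; rewrite (partition_big t predT) //= mulr_sumr; apply: eq_bigr => i _.
rewrite !mxE mulrA [n%:R * _]mulrC divfK ?pnatr_eq0 -?lt0n // mulr_natl.
rewrite -sumr_const; apply: eq_big => [u|u /eqP -> //].
by rewrite inE.
Qed.

Lemma qformE (K : realType) (q : nat) (R : 'M[K]_q) (x : 'cV[K]_q) :
  qform R x = \sum_i x i 0 * \sum_j x j 0 * R i j.
Proof.
rewrite /qform -mulmxA mxE; apply: eq_bigr => i _; rewrite !mxE.
by congr (_ * _); apply: eq_bigr => j _; rewrite mulrC.
Qed.

Definition diag_sum (K : realType) (q : nat) (R : 'M[K]_q) (x : 'cV[K]_q) : K :=
  \sum_i x i 0 * R i i.

Definition entry_pow (K : realType) (q : nat) (R : 'M[K]_q) (k : nat) : 'M[K]_q :=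
  map_mx (fun a => a ^+ k) R.

(** Unordered pairs are half of the ordered ones without the diagonal, and the
    latter can be counted by types. Hence the power sums depend on the typing
    through the proportions of the types alone. *)
Lemma power_sum_edge_weights (K : realType) (q n k : nat) (R : 'M[K]_q)
    (t : {ffun 'I_n -> 'I_q}) (x := density K t) : R^T = R -> (0 < n)%N ->
  power_sum (edge_weights R t) k =
  n%:R ^+ 2 / 2 * qform (entry_pow R k) x - n%:R / 2 * diag_sum (entry_pow R k) x.
Proof.
move=> RT n0.
have Rsym i j : R i j = R j i by rewrite -[in LHS]RT mxE.
set f := fun u v : 'I_n => R (t u) (t v) ^+ k.
have E1 : \sum_u \sum_v f u v = n%:R ^+ 2 * qform (entry_pow R k) x.
  rewrite qformE.
  rewrite (eq_bigr (fun u => n%:R * \sum_j x j 0 * R (t u) j ^+ k)); last first.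
    by move=> u _; rewrite (sum_by_type t (fun j => R (t u) j ^+ k)).
  rewrite -mulr_sumr (sum_by_type t (fun i => \sum_j x j 0 * R i j ^+ k)) //.
  rewrite mulrA -expr2; congr (_ * _); apply: eq_bigr => i _; congr (_ * _).
  by apply: eq_bigr => j _; rewrite [entry_pow _ _ _ _]mxE.
have E2 : \sum_u f u u = n%:R * diag_sum (entry_pow R k) x.
  rewrite /f (sum_by_type t (fun i => R i i ^+ k)) //; congr (_ * _).
  by apply: eq_bigr => i _; rewrite [entry_pow _ _ _ _]mxE.
have E3 : power_sum (edge_weights R t) k = \sum_(u : 'I_n) \sum_(v : 'I_n | (u < v)%N) f u v.
  by rewrite /power_sum big_map big_enum /= pair_big_dep.
have E4 : \sum_(u : 'I_n) \sum_(v : 'I_n | (v < u)%N) f u v =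
    \sum_(u : 'I_n) \sum_(v : 'I_n | (u < v)%N) f u v.
  rewrite (exchange_big_dep predT) //=; apply: eq_bigr => u _.
  by apply: eq_bigr => v _; rewrite /f Rsym.
have : \sum_u \sum_v f u v = \sum_(u : 'I_n) \sum_(v : 'I_n | (u < v)%N) f u v +
    \sum_(u : 'I_n) \sum_(v : 'I_n | (v < u)%N) f u v + \sum_u f u u.
  rewrite -!big_split /=; apply: eq_bigr => u _.
  rewrite (bigID (fun v : 'I_n => (u < v)%N)) /= -addrA; congr (_ + _).
  rewrite (bigD1 u) ?ltnn //= addrC; congr (_ + _); apply: eq_bigl => v.
  by rewrite -leqNgt -val_eqE /= ltn_neqAle andbC.
rewrite E1 E2 E4 -E3; lra.
Qed.

Lemma edge_weights_ge0 (K : realType) (q n : nat) (R : 'M[K]_q)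
    (t : {ffun 'I_n -> 'I_q}) : (forall i j, 0 <= R i j) ->
  forall w, w \in edge_weights R t -> 0 <= w.
Proof. by move=> R0 w /mapP [e _ ->]. Qed.

Lemma density_simplex (K : realType) (q n : nat) (t : {ffun 'I_n -> 'I_q}) :
  (0 < n)%N -> simplex (density K t).
Proof.
move=> n0; split=> [i|]; first by rewrite mxE divr_ge0.
have := sum_by_type t (fun _ => 1 : K) n0.
under [in X in _ = X -> _]eq_bigr do rewrite mulr1.
rewrite sumr_const card_ord => /(congr1 (fun x => x / n%:R)).
by rewrite divff ?pnatr_eq0 -?lt0n // mulrC mulKf ?pnatr_eq0 -?lt0n // => <-.
Qed.

Lemma type_weightE (K : realType) (q n : nat) (r : 'cV[K]_q)
    (t : {ffun 'I_n -> 'I_q}) : type_weight r t = \prod_i r i 0 ^+ #|[pred u | t u == i]|.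
Proof.
rewrite /type_weight (partition_big t predT) //=; apply: eq_bigr => i _.
rewrite -prodr_const; apply: eq_big => [u|u /eqP -> //].
by rewrite inE.
Qed.

(** * Approximation up to a factor close to 1 *)

(** Logarithmic error bounds add up under products and survive sums of
    nonnegative terms. *)
Definition log_close (K : realType) (d X Y : K) : Prop :=
  expR (- d) * Y <= X /\ X <= expR d * Y.

Lemma log_close_refl (K : realType) (d X : K) :
  0 <= d -> 0 <= X -> log_close d X X.
Proof.
move=> d0 X0; split.
  by rewrite ler_piMl // -expR0 ler_expR oppr_le0.
by rewrite ler_peMl // -expR0 ler_expR.
Qed.

Lemma log_close_ge0 (K : realType) (d X Y : K) : log_close d X Y -> 0 <= Y -> 0 <= X.
Proof. by move=> [H _] Y0; apply: le_trans H; rewrite mulr_ge0 ?expR_ge0. Qed.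

Lemma log_close_gt0 (K : realType) (d X Y : K) : log_close d X Y -> 0 < Y -> 0 < X.
Proof. by move=> [H _] Y0; apply: lt_le_trans H; rewrite mulr_gt0 ?expR_gt0. Qed.

Lemma log_close_sym (K : realType) (d X Y : K) : log_close d X Y -> log_close d Y X.
Proof.
move=> [H1 H2]; split.
  by rewrite expRN mulrC ler_pdivrMr ?expR_gt0 // mulrC.
by move: H1; rewrite expRN mulrC ler_pdivrMr ?expR_gt0 // mulrC.
Qed.

Lemma log_close_trans (K : realType) (d e X Y Z : K) :
  log_close d X Y -> log_close e Y Z -> log_close (d + e) X Z.
Proof.
move=> [H1 H2] [H3 H4]; split.
  rewrite opprD expRD -mulrA; apply: le_trans H1.
  by rewrite ler_wpM2l ?expR_ge0.
rewrite expRD -mulrA; apply: le_trans H2 _.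
by rewrite ler_wpM2l ?expR_ge0.
Qed.

Lemma log_closeM (K : realType) (d e X Y X' Y' : K) : 0 <= Y -> 0 <= Y' ->
  log_close d X Y -> log_close e X' Y' -> log_close (d + e) (X * X') (Y * Y').
Proof.
move=> Y0 Y'0 H H'; have X0 := log_close_ge0 H Y0; have X'0 := log_close_ge0 H' Y'0.
case: H H' => [H1 H2] [H3 H4]; split.
  by rewrite opprD expRD mulrACA ler_pM ?mulr_ge0 ?expR_ge0.
by rewrite expRD mulrACA ler_pM.
Qed.

Lemma log_closeV (K : realType) (d X Y : K) : 0 < Y ->
  log_close d X Y -> log_close d X^-1 Y^-1.
Proof.
move=> Y0 H; have X0 := log_close_gt0 H Y0; case: H => [H1 H2]; split.
  by rewrite expRN -invfM lef_pV2 ?posrE ?mulr_gt0 ?expR_gt0.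
rewrite -[expR d]invrK -expRN -invfM lef_pV2 ?posrE ?mulr_gt0 ?expR_gt0 //.
Qed.

Lemma log_close_prod (K : realType) (I : finType) (d : K) (F G : I -> K) :
  (forall i, 0 <= G i) -> (forall i, log_close d (F i) (G i)) ->
  log_close (#|I|%:R * d) (\prod_i F i) (\prod_i G i).
Proof.
move=> G0 H.
have E : #|I|%:R * d = \sum_(i : I) d by rewrite sumr_const mulr_natl.
rewrite E; suff [] : log_close (\sum_(i : I) d) (\prod_i F i) (\prod_i G i) /\
  0 <= \prod_i G i by [].
elim: (index_enum I) => [|i s [IH1 IH2]].
  by rewrite !big_nil; split=> //; exact: log_close_refl.
by rewrite !big_cons; split; [exact: log_closeM|exact: mulr_ge0].
Qed.

Lemma log_close_sum (K : realType) (I : finType) (P : pred I) (d : K) (F G : I -> K) :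
  (forall i, P i -> log_close d (F i) (G i)) ->
  log_close d (\sum_(i | P i) F i) (\sum_(i | P i) G i).
Proof.
move=> H; split; rewrite mulr_sumr; apply: ler_sum => i Pi; by case: (H i Pi).
Qed.

(** * Stirling's formula *)

Lemma nondecreasing_ge0_deriv (K : realType) (f f' : K -> K) (x : K) :
  (forall y : K, 0 <= y -> is_derive y (1 : K) f (f' y)) ->
  (forall y, 0 <= y -> 0 <= f' y) -> 0 <= x -> f 0 <= f x.
Proof.
move=> df f'0 x0.
have [||c cI E] := @MVT_segment K f f' 0 x x0.
- by move=> z; rewrite in_itv /= => /andP [/ltW z0 _]; exact: df.
- apply: derivable_within_continuous => z; rewrite in_itv /= => /andP [z0 _].
  exact: (@ex_derive _ _ _ _ _ _ _ (df z z0)).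
move: cI; rewrite in_itv /= => /andP [c0 _].
by rewrite -subr_ge0 E subr0 mulr_ge0 // f'0.
Qed.

Lemma is_derive_ln1D (K : realType) (y : K) : 0 <= y ->
  is_derive y (1 : K) (fun z => ln (1 + z)) (1 + y)^-1.
Proof.
move=> y0; have y1 : 0 < 1 + y by lra.
have h1 : is_derive y (1 : K) (fun z : K => 1 + z) (0 + 1) by exact: is_deriveD.
have := is_derive1_comp (is_derive1_ln y1) h1.
by rewrite add0r mulr1.
Qed.

(** This and the next bound on ln (1 + x) are sharp enough to show that
    (k + 1/2) ln (1 + 1/k) - 1 lies between 0 and a multiple of 1/k^2. *)
Lemma ln1D_lower (K : realType) (x : K) : 0 <= x -> 2 * x <= (2 + x) * ln (1 + x).
Proof.
move=> x0.
pose f (y : K) := (2 + y) * ln (1 + y) - 2 * y.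
pose f' (y : K) := ln (1 + y) + (2 + y) / (1 + y) - 2.
have f'0 (y : K) : 0 <= y -> 0 <= f' y.
  move=> y0; have y1 : 0 < (1 + y)^-1 by rewrite invr_gt0; lra.
  have : ln (1 + ((1 + y)^-1 - 1)) <= (1 + y)^-1 - 1 by apply: le_ln1Dx; lra.
  rewrite addrC subrK lnV ?posrE; last by lra.
  rewrite /f'; have -> : (2 + y) / (1 + y) = 1 + (1 + y)^-1 by field; lra.
  lra.
have df (y : K) : 0 <= y -> is_derive y (1 : K) f (f' y).
  move=> y0; have h := is_derive_ln1D y0; rewrite /f /f'.
  apply: is_derive_eq; rewrite /GRing.scale /=; lra.
have := nondecreasing_ge0_deriv df f'0 x0.
by rewrite /f !addr0 ln1 !mulr0 subr0 subr_ge0.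
Qed.

Lemma ln1D_upper (K : realType) (x : K) :
  0 <= x -> ln (1 + x) <= x - x ^+ 2 / 2 + x ^+ 3 / 3.
Proof.
move=> x0.
pose f (y : K) := y - y ^+ 2 / 2 + y ^+ 3 / 3 - ln (1 + y).
pose f' (y : K) := 1 - y + y ^+ 2 - (1 + y)^-1.
have f'0 (y : K) : 0 <= y -> 0 <= f' y.
  move=> y0; have y1 : 0 < 1 + y by lra.
  have -> : f' y = y ^+ 3 / (1 + y) by rewrite /f'; field; lra.
  by rewrite divr_ge0 ?exprn_ge0 // ltW.
have df (y : K) : 0 <= y -> is_derive y (1 : K) f (f' y).
  move=> y0; have h := is_derive_ln1D y0; rewrite /f /f'.
  apply: is_derive_eq; rewrite /GRing.scale /=; lra.
have := nondecreasing_ge0_deriv df f'0 x0.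
rewrite /f addr0 ln1 !expr0n !mul0r subr0 subrr add0r; lra.
Qed.

Definition log_stirling (K : realType) (k : nat) : K :=
  ln k`!%:R - (k%:R + 1 / 2) * ln k%:R + k%:R.

Lemma log_stirlingB (K : realType) (k : nat) : (0 < k)%N ->
  log_stirling K k - log_stirling K k.+1 =
  (k%:R + 1 / 2) * ln (1 + (k%:R)^-1) - 1.
Proof.
move=> k0; have k1 : 0 < k%:R :> K by rewrite ltr0n.
have k2 : 0 < k.+1%:R :> K by rewrite ltr0n.
have -> : 1 + k%:R^-1 = k.+1%:R / k%:R :> K.
  by rewrite -natr1 mulrDl divff ?gt_eqF // mul1r.
rewrite ln_div ?posrE // /log_stirling factS natrM lnM ?posrE ?ltr0n ?fact_gt0 //.
have -> : k.+1%:R = k%:R + 1 :> K by rewrite natr1.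
ring.
Qed.

(** The increments are dominated by those of 1/(2 k), hence summable. *)
Lemma log_stirling_step (K : realType) (k : nat) : (0 < k)%N ->
  0 <= log_stirling K k - log_stirling K k.+1 <= (k%:R^-1 - k.+1%:R^-1) / 2.
Proof.
move=> k0; rewrite log_stirlingB //.
have k1 : 1 <= k%:R :> K by rewrite ler1n.
set y := k%:R in k1 *; set x := y^-1; have xy : x * y = 1 by rewrite mulVf //; lra.
have x0 : 0 < x by rewrite invr_gt0; lra.
have x1 : x <= 1 by rewrite invf_le1; lra.
have L := ln1D_lower (ltW x0); have U := ln1D_upper (ltW x0).
set l := ln (1 + x) in L U *; have xE : x = y^-1 by [].
clearbody l x; apply/andP; split.
  have := ler_wpM2r (_ : 0 <= y / 2) L.
  rewrite -mulrA [x * _]mulrA xy => H.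
  have {}H := H (_ : _); have : (2 + x) * l * (y / 2) = (y + 1 / 2) * l.
    transitivity ((y + (x * y) / 2) * l); first by field.
    by rewrite xy.
  lra.
apply: le_trans (_ : x ^+ 2 / 4 <= _).
  have := ler_wpM2l (_ : 0 <= y + 1 / 2) U => /(_ _)/wrap[]; first by lra.
  have -> : (y + 1 / 2) * (x - x ^+ 2 / 2 + x ^+ 3 / 3) =
    (x * y) - (x * y) * x / 2 + (x * y) * x ^+ 2 / 3 + x / 2 - x ^+ 2 / 4 + x ^+ 3 / 6.
    by field.
  rewrite xy; have : x ^+ 3 <= x ^+ 2 by rewrite exprSr ler_piMr // sqr_ge0.
  lra.
have -> : (k.+1%:R : K) = y + 1 by rewrite -natr1.
have -> : (x - (y + 1)^-1) / 2 = x / (2 * (y + 1)).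
  by rewrite xE; field; apply/andP; split; lra.
rewrite expr2 -mulrA ler_wpM2l ?(ltW x0) // xE -invfM lef_pV2 ?posrE; lra.
Qed.

Lemma log_stirling_cvg (K : realType) :
  cvgn (fun k => log_stirling K k.+1).
Proof.
apply: nonincreasing_is_cvgn.
  apply/nonincreasing_seqP => k.
  by have /andP [] := log_stirling_step K (ltn0Sn k); rewrite subr_ge0.
exists (1 / 2) => _ [k _ <-].
suff : (1 + k.+1%:R^-1) / 2 <= log_stirling K k.+1.
  apply: le_trans; have : 0 <= k.+1%:R^-1 :> K by rewrite invr_ge0.
  by set x := _^-1; lra.
elim: k => [|k IH].
  rewrite /log_stirling (_ : 1`! = 1%N) // ln1 invr1; lra.
have /andP [_] := log_stirling_step K (ltn0Sn k); move: IH.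
by set x := _^-1; set y := k.+2%:R^-1; lra.
Qed.

(** Together with the mass of the Gaussian, this constant enters the asymptotic
    formula through a quotient, which is read off from a family of graphs that
    can be counted exactly. *)
Definition stirling_const (K : realType) : K :=
  expR (lim ((fun k => log_stirling K k.+1) @ \oo)).

Lemma stirling_const_gt0 (K : realType) : 0 < stirling_const K.
Proof. exact: expR_gt0. Qed.

Lemma stirling (K : realType) (d : K) : 0 < d -> exists k0, forall k, (k0 < k)%N ->
  log_close d k`!%:R (stirling_const K * (k%:R ^+ k * expR (- k%:R) * Num.sqrt k%:R)).
Proof.
move=> d0.
have /cvgrPdist_le /(_ d d0) [k0 _ H] := @log_stirling_cvg K.
exists k0.+1 => k kk0; have k_gt0 : (0 < k)%N by exact: leq_trans kk0.
have := H k.-1 _; rewrite /= prednK // => /(_ _)/wrap[].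
  by rewrite -ltnS prednK // ltnW.
set l := lim _ => Hl.
have k1 : 0 < k%:R :> K by rewrite ltr0n.
have E : k`!%:R = expR (log_stirling K k) * (k%:R ^+ k * expR (- k%:R) * Num.sqrt k%:R).
  have -> : Num.sqrt k%:R = expR ((1 / 2) * ln k%:R) :> K.
    apply/eqP; rewrite -(@eqrXn2 _ 2) ?sqrtr_ge0 ?expR_ge0 // sqr_sqrtr ?ltW //.
    by rewrite -expRM_natl mulrA mul1r divff // mul1r lnK.
  have -> : k%:R ^+ k = expR (k%:R * ln k%:R) :> K by rewrite expRM_natl lnK.
  rewrite -!expRD /log_stirling.
  rewrite (_ : _ + _ = ln k`!%:R); last by ring.
  by rewrite lnK // posrE ltr0n fact_gt0.
rewrite E; set Q := _ * Num.sqrt _.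
have Q0 : 0 <= Q by rewrite !mulr_ge0 ?expR_ge0 ?sqrtr_ge0 ?exprn_ge0.
rewrite /stirling_const -/l; move: Hl; rewrite ler_norml => /andP [H1 H2].
by split; rewrite mulrA -expRD ler_wpM2r // ler_expR; lra.
Qed.

(** * Counting typings *)

Definition type_count (q n : nat) (t : {ffun 'I_n -> 'I_q}) (i : 'I_q) : nat :=
  #|[pred u | t u == i]|.

Definition typings_with_counts (q n : nat) (f : 'I_q -> nat) :
    pred {ffun 'I_n -> 'I_q} :=
  fun t => [forall i, type_count t i == f i].

Lemma type_countE (q n : nat) (t : {ffun 'I_n -> 'I_q}) i :
  type_count t i = (\sum_u (t u == i))%N.
Proof.
by rewrite /type_count -sum1_card big_mkcond; apply: eq_bigr => u _; rewrite inE; case: eqP.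
Qed.

Definition ffun_cons (q n : nat) (i : 'I_q) (t : {ffun 'I_n -> 'I_q}) :
    {ffun 'I_n.+1 -> 'I_q} :=
  [ffun u => if unlift ord0 u is Some v then t v else i].

Lemma type_count_cons (q n : nat) (i : 'I_q) (t : {ffun 'I_n -> 'I_q}) j :
  type_count (ffun_cons i t) j = ((i == j) + type_count t j)%N.
Proof.
rewrite !type_countE big_ord_recl ffunE unlift_none; congr (_ + _)%N.
by apply: eq_bigr => u _; rewrite ffunE liftK.
Qed.

Lemma sum_ffun_cons (q n : nat) (F : {ffun 'I_n.+1 -> 'I_q} -> nat) :
  (\sum_t F t = \sum_(i < q) \sum_(t : {ffun 'I_n -> 'I_q}) F (ffun_cons i t))%N.
Proof.
rewrite pair_big /=.
rewrite (reindex (fun p : 'I_q * {ffun 'I_n -> 'I_q} => ffun_cons p.1 p.2)) //=.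
apply: onW_bij; exists (fun t : {ffun 'I_n.+1 -> 'I_q} =>
  (t ord0, [ffun v : 'I_n => t (lift ord0 v)])).
  move=> [i t] /=; rewrite ffunE unlift_none; congr (_, _); apply/ffunP => u.
  by rewrite !ffunE liftK.
move=> t; apply/ffunP => u; rewrite ffunE /=.
by case: unliftP => [v|] ->; rewrite ?ffunE.
Qed.

(** The multinomial coefficient, by induction on n: the first vertex takes some
    type i, and the others have one vertex of type i less to supply. *)
Lemma card_typings_with_counts (q n : nat) (f : 'I_q -> nat) :
  (\sum_i f i)%N = n ->
  (#|@typings_with_counts q n f| * \prod_i (f i)`!)%N = n`!.
Proof.
elim: n f => [|n IH] f sf.
  have f0 i : f i = 0%N.
    by apply/eqP; rewrite -leqn0 -sf (bigD1 i) //= leq_addr.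
  rewrite big1 ?muln1 => [|i _]; last by rewrite f0.
  rewrite (eq_card (B := predT)) ?card_ffun ?card_ord ?expn0 // => t.
  by rewrite !inE unfold_in; apply/forallP => i; rewrite f0 type_countE big_ord0.
have card_sum m g : #|@typings_with_counts q m g| =
    (\sum_(t : {ffun 'I_m -> 'I_q}) (typings_with_counts g t))%N.
  rewrite -sum1_card big_mkcond; apply: eq_bigr => t _.
  by rewrite -[t \in _]/(typings_with_counts g t); case: typings_with_counts.
rewrite card_sum sum_ffun_cons big_distrl /=.
rewrite factS -[in RHS]sf big_distrl /=; apply: eq_bigr => i _.
have [fi0|fi_gt0] := posnP (f i).
  rewrite fi0 mul0n big1 ?mul0n // => t _; apply/eqP; rewrite eqb0.
  by apply/forallP => /(_ i); rewrite type_count_cons eqxx fi0.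
pose g j := (f j - (i == j))%N.
have gf j : f j = ((i == j) + g j)%N.
  by rewrite /g subnKC //; case: eqP => // <-.
have sg : (\sum_j g j)%N = n.
  apply/eqP; rewrite -eqSS -sf (eq_bigr _ (fun j _ => gf j)) big_split /=.
  have -> : (\sum_(j < q) (i == j) = 1)%N.
    by rewrite (bigD1 i) //= eqxx big1 // => j /negbTE; rewrite eq_sym => ->.
  by rewrite add1n.
rewrite -(IH g sg) card_sum mulnCA; congr (_ * _)%N.
  apply: eq_bigr => t _; congr (nat_of_bool _); apply: eq_forallb => j.
  by rewrite type_count_cons gf eqn_add2l.
rewrite (bigD1 i) //= [in RHS](bigD1 i) //= mulnA gf eqxx add1n factS -mulnA.
rewrite -mulnA; congr (_ * (_ * _))%N; apply: eq_bigr => j /negbTE ji.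
by rewrite gf eq_sym ji.
Qed.

(** The left-hand side is the probability that n independent vertices of types
    distributed as f / n realize exactly the counts f. In Stirling's formula
    the powers and exponentials cancel, and one factor C sqrt n remains for
    each of the d types other than the first. *)
Lemma multinomial_estimate (K : realType) (d : nat) (e : K) : 0 < e ->
  exists k0, forall (n : nat) (f : 'I_d.+1 -> nat),
    (\sum_i f i)%N = n -> (forall i, (k0 < f i)%N) ->
    log_close e
      (#|@typings_with_counts d.+1 n f|%:R * \prod_i ((f i)%:R / n%:R) ^+ f i)
      ((stirling_const K * Num.sqrt n%:R) ^- d /
        Num.sqrt (\prod_i ((f i)%:R / n%:R))).
Proof.
move=> e0; set e' := e / d.+2%:R; have e'0 : 0 < e' by rewrite divr_gt0.
have [k0 Hk0] := stirling e'0; exists k0 => n f sf fk.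
have f_gt0 i : 0 < (f i)%:R :> K by rewrite ltr0n; apply: leq_trans (fk i).
have n_ge i : (f i <= n)%N by rewrite -sf (bigD1 i) //= leq_addr.
have nk : (k0 < n)%N := leq_trans (fk ord0) (n_ge ord0).
have n0 : 0 < n%:R :> K by rewrite ltr0n; apply: leq_trans nk.
set C := stirling_const K; have C0 : 0 < C := stirling_const_gt0 K.
pose S k : K := C * (k%:R ^+ k * expR (- k%:R) * Num.sqrt k%:R).
have S0 k : 0 < k%:R :> K -> 0 < S k.
  by move=> k1; rewrite !mulr_gt0 ?expR_gt0 ?sqrtr_gt0 ?exprn_gt0.
have E1 : #|@typings_with_counts d.+1 n f|%:R =
    n`!%:R * (\prod_i ((f i)`!)%:R)^-1 :> K.
  rewrite -(card_typings_with_counts sf) natrM natr_prod mulfK //.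
  by apply/prodf_neq0 => i _; rewrite pnatr_eq0 -lt0n fact_gt0.
have P : log_close (d.+1%:R * e') (\prod_i ((f i)`!)%:R) (\prod_i S (f i)).
  have := @log_close_prod K 'I_d.+1 e' (fun i => ((f i)`!)%:R) (fun i => S (f i)).
  by rewrite card_ord; apply=> i; [exact/ltW/S0 | exact: Hk0].
have Ppos : 0 < \prod_i S (f i) by apply: prodr_gt0 => i _; exact: S0.
have H := log_closeM (ltW (S0 n n0)) (ltW _) (Hk0 n nk) (log_closeV Ppos P).
have {}H := H (_ : _).
have Eee : e' + d.+1%:R * e' = e.
  by rewrite -{1}[e']mul1r -mulrDl -[1]/(1%:R) -natrD add1n mulrC divfK // pnatr_eq0.
rewrite E1.
set Q := \prod_i ((f i)%:R / n%:R) ^+ f i.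
have Q0 : 0 < Q by apply: prodr_gt0 => i _; rewrite exprn_gt0 // divr_gt0.
have -> : (C * Num.sqrt n%:R) ^- d / Num.sqrt (\prod_i ((f i)%:R / n%:R)) =
  S n * (\prod_i S (f i))^-1 * Q.
  pose A : K := \prod_i (f i)%:R ^+ f i; pose B : K := \prod_i Num.sqrt (f i)%:R.
  have A0 : 0 < A by apply: prodr_gt0 => i _; rewrite exprn_gt0.
  have B0 : 0 < B by apply: prodr_gt0 => i _; rewrite sqrtr_gt0.
  have -> : \prod_i S (f i) = C ^+ d.+1 * (A * expR (- n%:R) * B).
    rewrite /S big_split /= prodr_const card_ord; congr (_ * _).
    rewrite big_split /=; congr (_ * _); rewrite big_split /=; congr (_ * _).
    by rewrite -expR_sum -sf natr_sum sumrN.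
  have -> : Q = A / n%:R ^+ n.
    have -> : n%:R ^+ n = \prod_i n%:R ^+ f i :> K by rewrite -expr_sum sf.
    rewrite -prodfV -big_split; apply: eq_bigr => i _ /=.
    by rewrite expr_div_n.
  set w := Num.sqrt n%:R; have w0 : 0 < w by rewrite sqrtr_gt0.
  have -> : Num.sqrt (\prod_i ((f i)%:R / n%:R)) = B / w ^+ d.+1.
    have -> : \prod_i ((f i)%:R / n%:R) = (B / w ^+ d.+1) ^+ 2 :> K.
      rewrite big_split /= prodr_const card_ord exprVn expr_div_n; congr (_ / _).
        by rewrite -prodrXl; apply: eq_bigr => i _; rewrite sqr_sqrtr // ltW.
      by rewrite exprAC sqr_sqrtr // ltW.
    by rewrite sqrtr_sqr ger0_norm // divr_ge0 ?exprn_ge0 // ltW.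
  have e_gt0 := expR_gt0 (- n%:R : K); rewrite /S -/w exprMn !exprS.
  have Cd : 0 < C ^+ d by rewrite exprn_gt0.
  have wd : 0 < w ^+ d by rewrite exprn_gt0.
  have nn : 0 < n%:R ^+ n :> K by rewrite exprn_gt0.
  move: (C ^+ d) (w ^+ d) (n%:R ^+ n) (expR _) Cd wd nn e_gt0.
  move=> c v m x c0 v0 m0 x0; field.
  by rewrite !gt_eqF.
rewrite -[e]addr0; apply: log_closeM; [|exact: ltW| |].
- by rewrite mulr_ge0 ?invr_ge0 // ltW // S0.
- by rewrite -[X in log_close X]Eee; apply: H; rewrite invr_gt0.
by apply: log_close_refl => //; exact: ltW.
Qed.

(** * Gaussian sums over lattices *)

Definition gauss_prim (K : realType) (x : K) : K :=
  \int[lebesgue_measure]_(t in `]-oo, x]) gauss_fun t.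

Lemma integrable_gauss_ray (K : realType) (x : K) :
  lebesgue_measure.-integrable `]-oo, x] (EFin \o @gauss_fun K).
Proof.
by apply: integrableS (@integrableT_gauss K) => //; exact: measurable_itv.
Qed.

Lemma gauss_prim_derive (K : realType) (x : K) :
  is_derive x (1 : K) (@gauss_prim K) (gauss_fun x).
Proof.
have [] := @continuous_FTC1 K gauss_fun -oo%O x (x + 1) _
  (integrable_gauss_ray _) _ (@continuous_gauss_fun K x).
- by rewrite ltrDl.
- by rewrite ltNyr.
by move=> d e; apply: (DeriveDef d); rewrite -derive1E; exact: e.
Qed.

Lemma gauss_prim_MVT (K : realType) (x y : K) : x <= y ->
  exists2 c, x <= c <= y & gauss_prim y - gauss_prim x = gauss_fun c * (y - x).
Proof.
move=> xy; have [||c cI ->] := @MVT_segment K (@gauss_prim K) gauss_fun x y xy.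
- by move=> z _; exact: gauss_prim_derive.
- apply: derivable_within_continuous => z _.
  exact: (@ex_derive _ _ _ _ _ _ _ (gauss_prim_derive z)).
by exists c => //; move: cI; rewrite in_itv.
Qed.

Lemma gauss_prim_nondecr (K : realType) (x y : K) :
  x <= y -> gauss_prim x <= gauss_prim y.
Proof.
move=> xy; have [c _ E] := gauss_prim_MVT xy.
by rewrite -subr_ge0 E mulr_ge0 ?gauss_fun_ge0 // subr_ge0.
Qed.

Lemma gauss_prim_ge0 (K : realType) (x : K) : 0 <= gauss_prim x.
Proof. by apply: Rintegral_ge0 => // t _; exact: gauss_fun_ge0. Qed.

Lemma gauss_prim_le (K : realType) (x : K) :
  gauss_prim x <= \int[lebesgue_measure]_(t in [set: K]) gauss_fun t.
Proof.
apply: fine_le.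
- by apply: integrable_fin_num; [exact: measurable_itv|exact: integrable_gauss_ray].
- by apply: integrable_fin_num; [|exact: integrableT_gauss].
apply: ge0_subset_integral => //.
- exact: measurable_int integrableT_gauss.
- by move=> t _; rewrite lee_fin gauss_fun_ge0.
Qed.

(** The total mass of exp (- x ^ 2), written as the oscillation of its primitive,
    which is what telescoping sums are compared with. *)
Definition gauss_mass (K : realType) : K :=
  sup (range (@gauss_prim K)) - inf (range (@gauss_prim K)).

Lemma gauss_prim_has_sup (K : realType) : has_sup (range (@gauss_prim K)).
Proof.
split; first by exists (gauss_prim 0), 0.
by exists (\int[lebesgue_measure]_(t in [set: K]) gauss_fun t) => _ [x _ <-];
  exact: gauss_prim_le.
Qed.

Lemma gauss_prim_has_inf (K : realType) : has_inf (range (@gauss_prim K)).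
Proof.
split; first by exists (gauss_prim 0), 0.
by exists 0 => _ [x _ <-]; exact: gauss_prim_ge0.
Qed.

Lemma gauss_prim_le_mass (K : realType) (x y : K) :
  gauss_prim y - gauss_prim x <= gauss_mass K.
Proof.
rewrite /gauss_mass lerB //.
- by apply: ub_le_sup; [case: (gauss_prim_has_sup K) | exists y].
- by apply: ge_inf; [case: (gauss_prim_has_inf K) | exists x].
Qed.

Lemma gauss_prim_cvg_mass (K : realType) (d : K) : 0 < d ->
  exists2 L, 0 < L & gauss_mass K - d <= gauss_prim L - gauss_prim (- L).
Proof.
move=> d0.
have [_ [x _ <-] xs] := sup_adherent (divr_gt0 d0 (ltr0Sn K 1)) (gauss_prim_has_sup K).
have [_ [y _ <-] yi] := inf_adherent (divr_gt0 d0 (ltr0Sn K 1)) (gauss_prim_has_inf K).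
exists (`|x| + `|y| + 1).
  by rewrite ltr_wpDl // addr_ge0.
have : gauss_prim x <= gauss_prim (`|x| + `|y| + 1).
  apply: gauss_prim_nondecr.
  have := ler_norm x; have := normr_ge0 y; lra.
have : gauss_prim (- (`|x| + `|y| + 1)) <= gauss_prim y.
  apply: gauss_prim_nondecr.
  have := ler_norm (- y); rewrite normrN; have := normr_ge0 x; lra.
rewrite /gauss_mass; lra.
Qed.

Lemma gauss_mass_gt0 (K : realType) : 0 < gauss_mass K.
Proof.
apply: lt_le_trans (gauss_prim_le_mass 0 1).
have [c _ ->] := gauss_prim_MVT (@ler01 K).
by rewrite subr0 mulr1 expR_gt0.
Qed.

Lemma gauss_fun_le_norm (K : realType) (x y : K) :
  `|x| <= `|y| -> gauss_fun y <= gauss_fun x.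
Proof.
move=> xy; rewrite /gauss_fun ler_expR lerN2.
by rewrite -[x ^+ 2]real_normK ?num_real // -[y ^+ 2]real_normK ?num_real // lerXn2r ?nnegrE.
Qed.

Lemma gauss_prim_incr_le (K : realType) (x y z : K) : x <= y ->
  (forall c, x <= c <= y -> `|z| <= `|c|) ->
  gauss_prim y - gauss_prim x <= gauss_fun z * (y - x).
Proof.
move=> xy H; have [c cI ->] := gauss_prim_MVT xy.
by rewrite ler_wpM2r ?subr_ge0 // gauss_fun_le_norm // H.
Qed.

Lemma gauss_prim_incr_ge (K : realType) (x y z : K) : x <= y ->
  (forall c, x <= c <= y -> `|c| <= `|z|) ->
  gauss_fun z * (y - x) <= gauss_prim y - gauss_prim x.
Proof.
move=> xy H; have [c cI ->] := gauss_prim_MVT xy.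
by rewrite ler_wpM2r ?subr_ge0 // gauss_fun_le_norm // H.
Qed.

(** The primitive of a Gaussian cut at its mode, with an interval of length h
    and height 1 inserted there. On each side of the mode the function is
    monotone, so that increments compare with values at one end of the step. *)
Definition gauss_stretched (K : realType) (h v : K) : K :=
  gauss_prim (Num.min v 0) + Num.min (Num.max v 0) h +
  gauss_prim (Num.max (v - h) 0).

(** For the opposite comparison the part over [-h, h] is removed, and what lies
    to the left of it is shifted so as to end at 0. *)
Definition gauss_shrunk (K : realType) (h v : K) : K :=
  gauss_prim (Num.min v 0 - h) + gauss_prim (Num.max v h).

(** A step that meets the mode is split there; the part on the wrong side is
    paid for by the inserted interval of height 1. *)
Lemma gauss_step_upper (K : realType) (h u : K) : 0 < h ->
  gauss_fun u * h <= gauss_stretched h (u + h) - gauss_stretched h u.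
Proof.
move=> h0; rewrite /gauss_stretched.
have f1 := gauss_fun_le1 u; have f0 := gauss_fun_ge0 u.
have [u0|u0] := leP 0 u.
  rewrite [Num.min (u + h) 0]min_r; last by lra.
  rewrite [Num.max (u + h) 0]max_l; last by lra.
  rewrite [Num.min (u + h) h]min_r; last by lra.
  rewrite [Num.max (u + h - h) 0]max_l; last by lra.
  rewrite addrK.
  have [uh|uh] := leP h u.
    rewrite [Num.max (u - h) 0]max_l; last by lra.
    have : gauss_fun u * (u - (u - h)) <= gauss_prim u - gauss_prim (u - h).
      apply: gauss_prim_incr_ge; first by lra.
      by move=> c cI; rewrite !ger0_norm; lra.
    lra.
  rewrite [Num.max (u - h) 0]max_r; last by lra.
  have : gauss_fun u * (u - 0) <= gauss_prim u - gauss_prim 0.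
    apply: gauss_prim_incr_ge => //.
    by move=> c cI; rewrite !ger0_norm; lra.
  have := ler_wpM2r (_ : 0 <= h - u) f1; nra.
rewrite [Num.max (u + h - h) 0]max_r; last by lra.
rewrite [Num.max (u - h) 0]max_r; last by lra.
rewrite [Num.min 0 h]min_l; last by lra.
have [uh|uh] := leP 0 (u + h).
  rewrite min_l; last by lra.
  have : gauss_fun u * (0 - u) <= gauss_prim 0 - gauss_prim u.
    apply: gauss_prim_incr_ge; first by lra.
    by move=> c cI; rewrite !ler0_norm; lra.
  have := ler_wpM2r uh f1; lra.
rewrite min_l; last by lra.
have : gauss_fun u * (u + h - u) <= gauss_prim (u + h) - gauss_prim u.
  apply: gauss_prim_incr_ge; first by lra.
  by move=> c cI; rewrite !ler0_norm; lra.
lra.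
Qed.

Lemma gauss_sum_upper (K : realType) (h s : K) N : 0 < h ->
  h * \sum_(k < N) gauss_fun (h * k%:R + s) <= gauss_mass K + h.
Proof.
move=> h0.
pose W := gauss_stretched h.
apply: le_trans (_ : W (h * N%:R + s) - W (h * 0%:R + s) <= _).
  rewrite mulr_sumr -(big_mkord predT (fun k => h * gauss_fun (h * k%:R + s))).
  elim: N => [|N IH]; first by rewrite big_nil subrr.
  rewrite big_nat_recr //=.
  have := gauss_step_upper (h * N%:R + s) h0; rewrite -!/(W _).
  have -> : h * N%:R + s + h = h * N.+1%:R + s by rewrite -[N.+1%:R]natr1; ring.
  rewrite [h * gauss_fun _]mulrC; lra.
set y := h * N%:R + s; set x := h * 0%:R + s; rewrite /W /gauss_stretched.
have : Num.min (Num.max y 0) h - Num.min (Num.max x 0) h <= h.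
  have : Num.min (Num.max y 0) h <= h by rewrite ge_min lexx orbT.
  have : 0 <= Num.min (Num.max x 0) h by rewrite le_min le_max lexx orbT ltW.
  lra.
have : gauss_prim (Num.min y 0) <= gauss_prim (Num.max (x - h) 0).
  apply: gauss_prim_nondecr; apply: le_trans (_ : 0 <= _).
    by rewrite ge_min lexx orbT.
  by rewrite le_max lexx orbT.
have := gauss_prim_le_mass (Num.min x 0) (Num.max (y - h) 0); lra.
Qed.

Lemma gauss_step_lower (K : realType) (h u : K) : 0 < h ->
  gauss_shrunk h (u + h) - gauss_shrunk h u <= gauss_fun u * h.
Proof.
move=> h0; rewrite /gauss_shrunk; have f0 := gauss_fun_ge0 u.
have [u0|u0] := leP 0 u.
  rewrite [Num.min (u + h) 0]min_r; last by lra.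
  rewrite [Num.max (u + h) h]max_l; last by lra.
  have [uh|uh] := leP h u.
    have : gauss_prim (u + h) - gauss_prim u <= gauss_fun u * (u + h - u).
      apply: gauss_prim_incr_le; first by lra.
      by move=> c cI; rewrite !ger0_norm; lra.
    lra.
  have : gauss_prim (u + h) - gauss_prim h <= gauss_fun u * (u + h - h).
    apply: gauss_prim_incr_le; first by lra.
    by move=> c cI; rewrite !ger0_norm; lra.
  have := ler_wpM2l f0 (ltW uh); lra.
rewrite [Num.max u h]max_r; last by lra.
rewrite [Num.max (u + h) h]max_r; last by lra.
have [uh|uh] := leP 0 (u + h).
  have : gauss_prim (- h) - gauss_prim (u - h) <= gauss_fun u * (- h - (u - h)).
    apply: gauss_prim_incr_le; first by lra.
    by move=> c cI; rewrite !ler0_norm; lra.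
  have := mulr_ge0 f0 uh; rewrite sub0r; lra.
rewrite addrK.
have : gauss_prim u - gauss_prim (u - h) <= gauss_fun u * (u - (u - h)).
  apply: gauss_prim_incr_le; first by lra.
  by move=> c cI; rewrite !ler0_norm; lra.
lra.
Qed.

Lemma gauss_sum_lower (K : realType) (h s L : K) N : 0 < h -> h <= L ->
  s <= - L -> L <= h * N%:R + s ->
  gauss_prim L - gauss_prim (- L) - 2 * h <=
  h * \sum_(k < N | `|h * k%:R + s| <= L) gauss_fun (h * k%:R + s).
Proof.
move=> h0 hL sL NL.
pose W := gauss_shrunk h.
have W_homo x y : x <= y -> W x <= W y.
  move=> xy; rewrite /W /gauss_shrunk lerD // gauss_prim_nondecr //.
    by rewrite lerD2r le_min !ge_min xy lexx orbT.
  by rewrite ge_max !le_max xy lexx orbT.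
(* Clamping the argument makes the increments vanish where terms are omitted;
   the lower clamp is - L + h as a step is compared with its left end. *)
pose V v := W (Num.min (Num.max v (- L + h)) L).
have V_step k : V (h * k.+1%:R + s) - V (h * k%:R + s) <=
    if `|h * k%:R + s| <= L then h * gauss_fun (h * k%:R + s) else 0.
  set u := h * k%:R + s.
  have -> : h * k.+1%:R + s = u + h by rewrite /u -natr1; ring.
  case: ifP => [|/negbT].
    rewrite ler_norml => /andP [Lu uL].
    have Hs := gauss_step_lower u h0; rewrite -!/(W _) in Hs.
    rewrite [h * _]mulrC; apply: le_trans Hs; rewrite /V lerB // W_homo //.
      by rewrite ge_min ge_max lexx /= lerD2r Lu.
    by rewrite le_min uL andbT le_max lexx.
  rewrite -ltNge ltr_normr => /orP [uL|Lu].
    rewrite /V [Num.max (u + h) _]max_l; last by lra.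
    rewrite [Num.max u _]max_l; last by lra.
    by rewrite !min_r ?subrr //; lra.
  rewrite /V [Num.max u _]max_r; last by lra.
  by rewrite [Num.max (u + h) _]max_r ?subrr //; lra.
apply: le_trans (_ : V (h * N%:R + s) - V (h * 0%:R + s) <= _); last first.
  rewrite mulr_sumr.
  rewrite -(big_mkord (fun k => `|h * k%:R + s| <= L)
              (fun k => h * gauss_fun (h * k%:R + s))).
  elim: (N) => [|M IH]; first by rewrite big_nil subrr.
  rewrite big_mkcond big_nat_recr //= -big_mkcond /=.
  have sub_trans a b c x y : a - b <= x -> b - c <= y -> a - c <= y + x :> K by lra.
  exact: sub_trans (V_step M) IH.
rewrite /V mulr0 add0r [Num.max s _]max_r; last by lra.
rewrite [Num.min (- L + h) _]min_l; last by lra.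
rewrite [Num.min _ L]min_r; last by rewrite le_max NL.
rewrite /W /gauss_shrunk [Num.min L 0]min_r; last by lra.
rewrite [Num.max L h]max_l // [Num.min (- L + h) 0]min_l; last by lra.
rewrite [Num.max (- L + h) h]max_r; last by lra.
rewrite addrK sub0r.
have hh : - h <= h by lra.
have [c _] := gauss_prim_MVT hh.
have := ler_wpM2r (ltW h0) (gauss_fun_le1 c); lra.
Qed.

Lemma gauss_sqrtE (K : realType) (a u : K) :
  0 <= a -> expR (- (a * u ^+ 2)) = gauss_fun (Num.sqrt a * u).
Proof. by move=> a0; rewrite /gauss_fun exprMn sqr_sqrtr. Qed.

Lemma gauss_sum1_upper (K : realType) (a h s : K) N : 0 < a -> 0 < h ->
  h * \sum_(k < N) expR (- (a * (h * k%:R + s) ^+ 2)) <=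
  gauss_mass K / Num.sqrt a + h.
Proof.
move=> a0 h0; have sa : 0 < Num.sqrt a by rewrite sqrtr_gt0.
rewrite -(ler_pM2l sa) mulrDr [_ * (_ / _)]mulrC divfK ?gt_eqF // mulrA.
have := gauss_sum_upper (Num.sqrt a * s) N (mulr_gt0 sa h0).
congr (_ * _ <= _); apply: eq_bigr => k _.
by rewrite gauss_sqrtE ?ltW // mulrDr mulrA.
Qed.

Lemma gauss_sum1_lower (K : realType) (a d : K) : 0 < a -> 0 < d ->
  exists L0 h0, [/\ 0 < L0, 0 < h0 & forall h s N, 0 < h -> h <= h0 ->
    s <= - L0 -> L0 <= h * N%:R + s ->
    gauss_mass K / Num.sqrt a - d <=
    h * \sum_(k < N | `|h * k%:R + s| <= L0) expR (- (a * (h * k%:R + s) ^+ 2))].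
Proof.
move=> a0 d0; have sa : 0 < Num.sqrt a by rewrite sqrtr_gt0.
set w := Num.sqrt a in sa *.
have wd : 0 < w * d / 2 by rewrite divr_gt0 // mulr_gt0.
have [L L_gt0 HL] := gauss_prim_cvg_mass wd.
exists (L / w), (Num.min (L / w) (d / 4)); split; first by rewrite divr_gt0.
  by rewrite lt_min !divr_gt0.
move=> h s N h0; rewrite le_min => /andP [hL hd] sL NL.
rewrite -(ler_pM2l sa) mulrBr [_ * (_ / _)]mulrC divfK ?gt_eqF // mulrA.
have wh : w * h <= L by rewrite mulrC -ler_pdivlMr.
have ws : w * s <= - L by rewrite mulrC -ler_pdivlMr // mulNr.
have wN : L <= w * h * N%:R + w * s.
  by rewrite -mulrA -mulrDr mulrC -ler_pdivrMr.
have := gauss_sum_lower (mulr_gt0 sa h0) wh ws wN.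
rewrite (eq_bigl (fun k : 'I_N => `|h * k%:R + s| <= L / w)); last first.
  move=> k; rewrite -mulrA -mulrDr normrM (gtr0_norm sa) ler_pdivlMr //.
  by rewrite mulrC.
rewrite (eq_bigr (fun k : 'I_N => expR (- (a * (h * k%:R + s) ^+ 2)))); last first.
  by move=> k _; rewrite gauss_sqrtE ?ltW // mulrDr mulrA.
apply: le_trans; have := ler_wpM2l (ltW sa) hd; lra.
Qed.

Definition bilin (K : realType) (d : nat) (A : 'M[K]_d) (u : 'rV[K]_d) : K :=
  (u *m A *m u^T) 0 0.

Definition posdef (K : realType) (d : nat) (A : 'M[K]_d) : Prop :=
  forall u : 'rV[K]_d, u != 0 -> 0 < bilin A u.

Definition lattice_point (K : realType) (d N : nat) (h : K) (s : 'rV[K]_d)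
    (k : 'rV['I_N]_d) : 'rV[K]_d :=
  \row_i (h * (k 0 i)%:R + s 0 i).

(** What remains of a quadratic form after completing the square in the first
    coordinate, see bilin_schur. *)
Definition schur (K : realType) (d : nat) (A : 'M[K]_(1 + d)) : 'M[K]_d :=
  drsubmx A - (A 0 0)^-1 *: ((ursubmx A)^T *m ursubmx A).

Section Schur.
Context (K : realType) (d : nat) (A : 'M[K]_(1 + d)).
Hypothesis A_sym : A^T = A.
Hypothesis A_pos : posdef A.

Let a := A 0 0.
Let B := ursubmx A.

Let A_block : A = block_mx a%:M B B^T (drsubmx A).
Proof.
rewrite -[LHS]submxK; congr block_mx.
  by rewrite [ulsubmx A]mx11_scalar !mxE lshift0.
by rewrite /B trmx_ursub A_sym.
Qed.

Lemma bilin_block x (v : 'rV[K]_d) :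
  bilin A (row_mx (x%:M : 'M[K]_1) v) =
  a * x ^+ 2 + 2 * x * (B *m v^T) 0 0 + bilin (drsubmx A) v.
Proof.
have E1 : (x%:M *m a%:M *m (x%:M : 'M[K]_1)^T) 0 0 = a * x ^+ 2.
  by rewrite tr_scalar_mx -!scalar_mxM mxE eqxx mulr1n; ring.
have E2 : (v *m B^T *m (x%:M : 'M[K]_1)^T) 0 0 = x * (B *m v^T) 0 0.
  by rewrite tr_scalar_mx mul_mx_scalar mxE -[v *m B^T]trmxK trmx_mul trmxK [_^T _ _]mxE.
have E3 : (x%:M *m B *m v^T) 0 0 = x * (B *m v^T) 0 0.
  by rewrite mul_scalar_mx -scalemxAl [LHS]mxE.
rewrite /bilin [in LHS]A_block mul_row_block tr_row_mx mul_row_col !mulmxDl.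
have addE (M N : 'M[K]_1) : (M + N) 0 0 = M 0 0 + N 0 0 by rewrite mxE.
rewrite !addE E1 E2 E3; ring.
Qed.

Lemma posdef_pivot_gt0 : 0 < a.
Proof.
have := A_pos (_ : row_mx (1%:M : 'M[K]_1) 0 != 0); rewrite bilin_block.
rewrite /bilin trmx0 !mulmx0 !mxE expr1n mulr1 mulr0 !addr0; apply.
apply/eqP => /(congr1 (fun M : 'rV_(1 + d) => lsubmx M 0 0)).
by rewrite row_mxKl !mxE /= => /eqP; rewrite oner_eq0.
Qed.

Lemma bilin_schur x (v : 'rV[K]_d) :
  bilin A (row_mx (x%:M : 'M[K]_1) v) =
  a * (x + (B *m v^T) 0 0 / a) ^+ 2 + bilin (schur A) v.
Proof.
rewrite bilin_block /schur /bilin -/a -/B mulmxBr mulmxBl.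
have a0 : a != 0 by rewrite gt_eqF // posdef_pivot_gt0.
set w := (B *m v^T) 0 0.
have -> : (v *m (a^-1 *: (B^T *m B)) *m v^T) = (a^-1 * w ^+ 2)%:M.
  rewrite -scalemxAr -scalemxAl !mulmxA -(mulmxA (v *m _)).
  have -> : v *m B^T = (B *m v^T)^T by rewrite trmx_mul trmxK.
  rewrite [B *m v^T]mx11_scalar -/w tr_scalar_mx -scalar_mxM scale_scalar_mx.
  by rewrite expr2.
by rewrite [(_ - _%:M) 0 0]mxE [(- _%:M) 0 0]mxE [_%:M 0 0]mxE /= mulr1n; field.
Qed.

Lemma schur_sym : (schur A)^T = schur A.
Proof.
by rewrite /schur linearB linearZ /= trmx_mul trmxK trmx_drsub A_sym.
Qed.

Lemma schur_posdef : posdef (schur A).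
Proof.
move=> v v0; have := A_pos (_ : row_mx (- ((B *m v^T) 0 0 / a))%:M v != 0).
rewrite bilin_schur addNr expr0n mulr0 add0r; apply.
apply: contraNneq v0 => /(congr1 (@rsubmx _ _ 1 d)).
by rewrite row_mxKr => ->; apply/eqP/matrixP => i j; rewrite !mxE.
Qed.

Lemma det_schur : \det A = a * \det (schur A).
Proof.
have a0 : a != 0 by rewrite gt_eqF // posdef_pivot_gt0.
have E : A = block_mx 1%:M 0 (a^-1 *: B^T) 1%:M *m block_mx a%:M B 0 (schur A).
  rewrite mulmx_block !mul1mx !mul0mx !addr0.
  rewrite mul_mx_scalar scalerA mulfV // scale1r -scalemxAl.
  by rewrite /schur addrC subrK -A_block.
by rewrite [in LHS]E det_mulmx det_lblock det_ublock !det1 !mul1r det_scalar1.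
Qed.

End Schur.

Lemma posdef_det_gt0 (K : realType) (d : nat) (A : 'M[K]_d) :
  A^T = A -> posdef A -> 0 < \det A.
Proof.
elim: d A => [|d IH] A As Ap; first by rewrite det_mx00.
rewrite (det_schur (d := d)) // mulr_gt0 ?posdef_pivot_gt0 // IH //.
  exact: schur_sym.
exact: schur_posdef.
Qed.

Lemma big_row_split (K : realType) (d N : nat) (P : pred 'rV['I_N]_(1 + d))
    (F : 'rV['I_N]_(1 + d) -> K) :
  \sum_(k | P k) F k =
  \sum_(k' : 'rV['I_N]_d) \sum_(j < N | P (row_mx (const_mx j) k'))
     F (row_mx (const_mx j) k').
Proof.
rewrite pair_big_dep /=.
rewrite (reindex (fun p : 'rV['I_N]_d * 'I_N => row_mx (const_mx p.2) p.1)) /=.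
  by apply: eq_bigl => p.
apply: onW_bij; exists (fun k => (rsubmx k, lsubmx k 0 0)).
  by move=> [k' j] /=; rewrite row_mxKr row_mxKl mxE.
move=> k /=; rewrite -[RHS](@hsubmxK _ 1 1 d); congr row_mx.
by apply/matrixP => i j; rewrite !mxE !ord1.
Qed.

Lemma lattice_point_row (K : realType) (d N : nat) (h : K) (s : 'rV[K]_(1 + d))
    (j : 'I_N) (k' : 'rV['I_N]_d) :
  lattice_point h s (row_mx (const_mx j) k') =
  row_mx ((h * j%:R + s 0 0)%:M : 'M[K]_1) (lattice_point h (rsubmx s) k').
Proof.
apply/matrixP => i l; rewrite !mxE ord1; case: splitP => [l' E|l' E].
  have -> : l = lshift d l' by apply: val_inj.
  by rewrite !mxE !ord1 lshift0 /= mulr1n.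
by rewrite !mxE; congr (_ + s _ _); apply: val_inj.
Qed.

Lemma near_product (K : realType) (x y e : K) : 0 < x -> 0 < y -> 0 < e ->
  exists2 d, 0 < d & [/\ d <= x, (x + d) * (y + d) <= x * y + e &
                       x * y - e <= (x - d) * (y - d)].
Proof.
move=> x0 y0 e0; set d := Num.min (Num.min x 1) (e / (x + y + 1)).
have d0 : 0 < d.
  by rewrite /d !lt_min x0 ltr01 divr_gt0 // addr_gt0 // addr_gt0.
have dx : d <= x by rewrite /d !ge_min lexx.
have d1 : d <= 1 by rewrite /d !ge_min lexx orbT.
have de : d * (x + y + 1) <= e.
  by rewrite -ler_pdivlMr ?addr_gt0 // /d ge_min lexx orbT.
exists d => //; split=> //; first by have := ler_wpM2l (ltW d0) d1; lra.
have := mulr_ge0 (ltW d0) (ltW d0); lra.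
Qed.

(** By induction on the dimension: when the other coordinates are fixed, the sum
    over the first one is a one-dimensional sum with a shifted origin. The
    bound holds for all origins s, which makes the induction work and later
    allows summing around a minimum that moves with c. *)
Lemma gauss_lattice_upper (K : realType) (d : nat) (A : 'M[K]_d) (e : K) :
  A^T = A -> posdef A -> 0 < e ->
  exists2 h0, 0 < h0 & forall h (s : 'rV[K]_d) N, 0 < h -> h <= h0 ->
    h ^+ d * \sum_(k : 'rV['I_N]_d) expR (- bilin A (lattice_point h s k)) <=
    gauss_mass K ^+ d / Num.sqrt (\det A) + e.
Proof.
elim: d A e => [|d IH] A e As Ap e0.
  exists 1 => // h s N _ _.
  rewrite (eq_bigr (fun=> 1)); last first.
    by move=> k _; rewrite /bilin thinmx0 !mul0mx mxE oppr0 expR0.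
  by rewrite sumr_const card_mx muln0 expn0 det_mx00 sqrtr1 !expr0 divr1 mul1r lerDl ltW.
set a := (A : 'M[K]_(1 + d)) 0 0; have a0 : 0 < a by exact: posdef_pivot_gt0.
have Ss := schur_sym (d := d) As; have Sp := schur_posdef (d := d) As Ap.
set S := schur _ in Ss Sp; have S0 := posdef_det_gt0 Ss Sp.
have g0 := gauss_mass_gt0 K.
set x := gauss_mass K / Num.sqrt a; set y := gauss_mass K ^+ d / Num.sqrt (\det S).
have x0 : 0 < x by rewrite divr_gt0 // sqrtr_gt0.
have y0 : 0 < y by rewrite divr_gt0 ?exprn_gt0 // sqrtr_gt0.
have -> : gauss_mass K ^+ d.+1 / Num.sqrt (\det A) = x * y.
  rewrite (det_schur (d := d)) // -/S -/a sqrtrM ?ltW // exprS invfM /x /y; ring.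
have [dl dl0 [_ Hu _]] := near_product x0 y0 e0.
have [h1 h10 H1] := IH S dl Ss Sp dl0.
exists (Num.min h1 dl); first by rewrite lt_min h10.
move=> h s N h0; rewrite le_min => /andP [hh1 hdl].
apply: le_trans Hu.
rewrite (big_row_split (d := d)) /= exprSr -mulrA mulr_sumr.
set s' := rsubmx (s : 'rV[K]_(1 + d)).
apply: le_trans (_ : h ^+ d * \sum_(k' : 'rV['I_N]_d)
   expR (- bilin S (lattice_point h s' k')) * (x + dl) <= _); last first.
  rewrite -mulr_suml mulrA mulrC ler_wpM2l ?H1 //.
  by rewrite addr_ge0 ?ltW.
rewrite ler_wpM2l ?(exprn_ge0 _ (ltW h0)) //; apply: ler_sum => k' _.
set t := (ursubmx (A : 'M[K]_(1 + d)) *m (lattice_point h s' k')^T) 0 0 / a.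
under eq_bigr => j _.
  rewrite lattice_point_row bilin_schur // opprD expRD mulrC -/a -/t -addrA.
  over.
rewrite -mulr_sumr mulrCA ler_wpM2l ?expR_ge0 //.
apply: le_trans (gauss_sum1_upper _ N a0 h0) _.
by rewrite lerD2l.
Qed.

(** The sum is restricted to a bounded window, because the quadratic
    approximation of Phi is only available near the minimum. *)
Lemma gauss_lattice_lower (K : realType) (d : nat) (A : 'M[K]_d) (e : K) :
  A^T = A -> posdef A -> 0 < e ->
  exists L0 h0, [/\ 0 < L0, 0 < h0 & forall h (s : 'rV[K]_d) N, 0 < h -> h <= h0 ->
    (forall i, s 0 i <= - L0 /\ L0 <= h * N%:R + s 0 i) ->
    gauss_mass K ^+ d / Num.sqrt (\det A) - e <=
    h ^+ d * \sum_(k : 'rV['I_N]_d | [forall i, `|lattice_point h s k 0 i| <= L0])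
                expR (- bilin A (lattice_point h s k))].
Proof.
elim: d A e => [|d IH] A e As Ap e0.
  exists 1, 1; split => // h s N _ _ _.
  rewrite (eq_bigr (fun=> 1)); last first.
    by move=> k _; rewrite /bilin thinmx0 !mul0mx mxE oppr0 expR0.
  rewrite (eq_bigl predT); last by move=> k; apply/forallP => -[].
  rewrite sumr_const card_mx muln0 expn0 det_mx00 sqrtr1 !expr0 divr1 mul1r.
  by rewrite gerBl ltW.
set a := (A : 'M[K]_(1 + d)) 0 0; have a0 : 0 < a by exact: posdef_pivot_gt0.
have Ss := schur_sym (d := d) As; have Sp := schur_posdef (d := d) As Ap.
set S := schur _ in Ss Sp; have S0 := posdef_det_gt0 Ss Sp.
have g0 := gauss_mass_gt0 K.
set x := gauss_mass K / Num.sqrt a; set y := gauss_mass K ^+ d / Num.sqrt (\det S).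
have x0 : 0 < x by rewrite divr_gt0 // sqrtr_gt0.
have y0 : 0 < y by rewrite divr_gt0 ?exprn_gt0 // sqrtr_gt0.
have -> : gauss_mass K ^+ d.+1 / Num.sqrt (\det A) = x * y.
  rewrite (det_schur (d := d)) // -/S -/a sqrtrM ?ltW // exprS invfM /x /y; ring.
have [dl dl0 [dlx _ Hl]] := near_product x0 y0 e0.
have [L1 [h1 [L10 h10 H1]]] := IH S dl Ss Sp dl0.
have [L2 [h2 [L20 h20 H2]]] := gauss_sum1_lower a0 dl0.
set B := ursubmx (A : 'M[K]_(1 + d)).
set T := (\sum_i `|B 0 i| * L1) / a.
have T0 : 0 <= T by rewrite divr_ge0 ?(ltW a0) // sumr_ge0 // => i _; rewrite mulr_ge0 ?(ltW L10).
(* T bounds the shift of the first coordinate caused by completing the square *)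
exists (L1 + L2 + T), (Num.min h1 h2); split.
- by rewrite ltr_wpDr // addr_gt0.
- by rewrite lt_min h10.
move=> h s N h0; rewrite le_min => /andP [hh1 hh2] Hs.
apply: le_trans Hl _.
rewrite (big_row_split (d := d)) /= exprSr -mulrA mulr_sumr.
set s' := rsubmx (s : 'rV[K]_(1 + d)).
apply: le_trans (_ : h ^+ d * \sum_(k' : 'rV['I_N]_d |
     [forall i, `|lattice_point h s' k' 0 i| <= L1])
   expR (- bilin S (lattice_point h s' k')) * (x - dl) <= _).
  rewrite -mulr_suml mulrA mulrC ler_wpM2r ?subr_ge0 //.
  apply: H1 => // i; rewrite !mxE; have [] := Hs (rshift 1 i).
  move=> A1 A2; split; lra.
rewrite ler_wpM2l ?(exprn_ge0 _ (ltW h0)) // [X in X <= _]big_mkcond /=.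
apply: ler_sum => k' _; case: ifP => [/forallP Hk'|_]; last first.
  by rewrite mulr_ge0 ?(ltW h0) // sumr_ge0 // => j _; rewrite expR_ge0.
set v := lattice_point h s' k' in Hk' *; set t := (B *m v^T) 0 0 / a.
have tT : `|t| <= T.
  rewrite /t normrM normfV (gtr0_norm a0) ler_pM2r ?invr_gt0 //.
  rewrite mxE; apply: le_trans (ler_norm_sum _ _ _) _; apply: ler_sum => i _.
  by rewrite normrM ler_wpM2l // mxE Hk'.
apply: le_trans (_ : expR (- bilin S v) *
   (h * \sum_(j < N | `|h * j%:R + (s 0 0 + t)| <= L2)
     expR (- (a * (h * j%:R + (s 0 0 + t)) ^+ 2))) <= _).
  rewrite ler_wpM2l ?expR_ge0 //; apply: H2 => //; have [] := Hs 0;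
    move: tT; rewrite ler_norml; lra.
rewrite mulrCA ler_wpM2l ?(ltW h0) // mulr_sumr big_mkcond [X in _ <= X]big_mkcond /=; apply: ler_sum => j _.
case: ifP => [Hj|_]; last first.
  by case: ifP => // _; rewrite expR_ge0.
rewrite ifT; last first.
  apply/forallP => i; rewrite lattice_point_row.
  set r := row_mx _ _; case: (split_ordP (i : 'I_(1 + d))) => l ->.
    have -> : r 0 (lshift d l) = h * j%:R + s 0 0.
      by rewrite [LHS]row_mxEl (ord1 l) mxE eqxx mulr1n.
    have : `|h * j%:R + s 0 0| <= `|h * j%:R + (s 0 0 + t)| + `|t|.
      by have := ler_normB (h * j%:R + (s 0 0 + t)) t; rewrite addrA addrK.
    lra.
  have -> : r 0 (rshift 1 l) = v 0 l by exact: row_mxEr.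
  by have := Hk' l; lra.
rewrite lattice_point_row bilin_schur // -/S -/B -/v -/a -/t opprD expRD.
by rewrite -addrA mulrC.
Qed.

(** * Directions along the simplex *)

Definition std_directions (K : realType) (d : nat) : 'M[K]_(1 + d, d) :=
  col_mx (const_mx (-1)) 1%:M.

Lemma ones_std_directions (K : realType) d :
  (const_mx 1 : 'rV[K]_(1 + d)) *m std_directions K d = 0.
Proof.
rewrite /std_directions -row_mx_const mul_row_col mulmx1.
apply/matrixP => i j; rewrite !mxE big_ord1 !mxE; ring.
Qed.

Lemma ones_mulmx_eq0 (K : realType) d n (M : 'M[K]_(1 + d, n)) :
  (const_mx 1 : 'rV[K]_(1 + d)) *m M = 0 -> M = std_directions K d *m dsubmx M.
Proof.
move=> M1; rewrite /std_directions mul_col_mx mul1mx -[LHS]vsubmxK; congr col_mx.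
apply/matrixP => i j; rewrite [RHS]mxE.
move/matrixP/(_ 0 j): M1; rewrite !mxE big_split_ord big_ord1 /= !mxE mul1r (ord1 i).
move/eqP; rewrite addr_eq0 => /eqP ->.
by rewrite -sumrN; apply: eq_bigr => k _; rewrite !mxE; ring.
Qed.

(** Factoring the block matrix [1, -v; u, 1] in two ways. *)
Lemma det_1D_mul (K : realType) d (u : 'cV[K]_d) (v : 'rV[K]_d) :
  \det (1%:M + u *m v) = 1 + (v *m u) 0 0.
Proof.
pose M := block_mx (1%:M : 'M[K]_1) (- v) u 1%:M.
have E1 : \det M = \det (1%:M + u *m v).
  have : M *m block_mx 1%:M v 0 1%:M = block_mx 1%:M 0 u (1%:M + u *m v).
    by rewrite mulmx_block !mulmx1 !mulmx0 mul1mx !addr0 addrN addrC.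
  by move=> /(congr1 determinant); rewrite det_mulmx det_ublock det_lblock !det1 !mulr1 mul1r.
have E2 : \det M = \det (1%:M + v *m u).
  have : block_mx 1%:M v 0 1%:M *m M = block_mx (1%:M + v *m u) 0 u 1%:M.
    by rewrite mulmx_block !mulmx1 !mul0mx !mul1mx !add0r addNr.
  by move=> /(congr1 determinant); rewrite det_mulmx det_ublock det_lblock !det1 !mulr1 !mul1r.
by rewrite -E1 E2 [X in \det X]mx11_scalar det_scalar1 !mxE.
Qed.

Lemma det_std_directions (K : realType) d :
  \det ((std_directions K d)^T *m std_directions K d) = d.+1%:R.
Proof.
rewrite /std_directions tr_col_mx mul_row_col trmx1 mulmx1 addrC det_1D_mul.
rewrite mxE (eq_bigr (fun=> 1)); last by move=> i _; rewrite !mxE; ring.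
by rewrite sumr_const card_ord -natr1 addrC.
Qed.

(** The columns of E span the hyperplane of sum 0, and the normalization of
    the Gram determinant fixes the determinant of the change of basis up to
    sign. *)
Lemma simplex_directionsE (K : realType) d (E : 'M[K]_(1 + d, d)) :
  @simplex_directions K (1 + d) E ->
  exists2 P : 'M[K]_d, E = std_directions K d *m P & \det P ^+ 2 = 1.
Proof.
move=> [_ /ones_mulmx_eq0 EP detE]; exists (dsubmx E) => //.
have {detE} : \det (E^T *m E : 'M[K]_d) = d.+1%:R by [].
rewrite [in X in X -> _]EP trmx_mul.
have -> : (dsubmx E)^T *m (std_directions K d)^T *m (std_directions K d *m dsubmx E) =
  (dsubmx E)^T *m ((std_directions K d)^T *m std_directions K d) *m dsubmx E.
  by rewrite !mulmxA.
rewrite (det_mulmx _ (dsubmx E)) (det_mulmx _ (_ *m _)) det_tr det_std_directions.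
rewrite mulrAC -expr2 mulrC -[X in _ = X -> _]mulr1.
by apply: mulfI; rewrite pnatr_eq0.
Qed.

Lemma hess_Phi_mulmx (K : realType) d (R : 'M[K]_(1 + d)) (P : 'M[K]_d) c x :
  @hess_Phi K (1 + d) R (std_directions K d *m P) c x =
  P^T *m @hess_Phi K (1 + d) R (std_directions K d) c x *m P.
Proof. by rewrite /hess_Phi trmx_mul !mulmxA. Qed.

Lemma SG_estimate_std (K : realType) d (R : 'M[K]_(1 + d)) r (E : 'M[K]_(1 + d, d)) :
  @simplex_directions K (1 + d) E ->
  (forall c x, \det (@hess_Phi K (1 + d) R E c x) =
               \det (@hess_Phi K (1 + d) R (std_directions K d) c x)) /\
  (forall n m, @SG_estimate K (1 + d) R r E n m =
               @SG_estimate K (1 + d) R r (std_directions K d) n m).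
Proof.
move=> /simplex_directionsE [P -> detP].
have detE c x : \det (@hess_Phi K (1 + d) R (std_directions K d *m P) c x) =
               \det (@hess_Phi K (1 + d) R (std_directions K d) c x).
  by rewrite hess_Phi_mulmx !det_mulmx det_tr mulrAC -expr2 detP mul1r.
split=> // n m; rewrite /SG_estimate; congr (_ * _).
have Pu : P \in unitmx.
  by rewrite unitmxE unitfE; apply/eqP => P0; move: detP; rewrite P0 expr0n => /eqP;
    rewrite eq_sym oner_eq0.
have -> : @critical_minima K (1 + d) R r (std_directions K d *m P) (m%:R / n%:R) =
          @critical_minima K (1 + d) R r (std_directions K d) (m%:R / n%:R).
  have gradE x : @grad_Phi K (1 + d) R r (std_directions K d *m P) (m%:R / n%:R) x =
      @grad_Phi K (1 + d) R r (std_directions K d) (m%:R / n%:R) x *m P.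
    by rewrite /grad_Phi mulmxA.
  apply/seteqP; split=> x [xI xg xm]; split=> //.
    by rewrite -[LHS](mulmxK Pu) -gradE xg mul0mx.
  by rewrite gradE xg mul0mx.
apply: eq_fsbigr => x _.
by rewrite /minimum_term detE.
Qed.

Definition tail (K : realType) d (x : 'cV[K]_(1 + d)) : 'rV[K]_d := (dsubmx x)^T.

Lemma simplex_diff (K : realType) d (x y : 'cV[K]_(1 + d)) :
  \sum_i x i 0 = 1 -> \sum_i y i 0 = 1 ->
  y = x + std_directions K d *m (tail y - tail x)^T.
Proof.
move=> sx sy.
suff <- : y - x = std_directions K d *m (tail y - tail x)^T by rewrite addrC subrK.
rewrite /tail linearB /= !trmxK -linearB /=; apply: ones_mulmx_eq0.
apply/matrixP => i j; rewrite !mxE (eq_bigr (fun k => y k 0 - x k 0)).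
  by rewrite sumrB sx sy subrr.
by move=> k _; rewrite !mxE (ord1 j) mul1r.
Qed.

Lemma sum_std_directions (K : realType) d (e : 'rV[K]_d) :
  \sum_i (std_directions K d *m e^T) i 0 = 0.
Proof.
have := congr1 (fun M => (M *m e^T) 0 0) (ones_std_directions K d).
rewrite /= mul0mx [RHS]mxE -mulmxA => H; rewrite -[RHS]H mxE.
by apply: eq_bigr => i _; rewrite [X in X * _]mxE mul1r.
Qed.

(** * Quadratic forms *)

Definition norm1 (K : realType) d (u : 'rV[K]_d) : K := \sum_i `|u 0 i|.

Lemma norm1_ge0 (K : realType) d (u : 'rV[K]_d) : 0 <= norm1 u.
Proof. exact: sumr_ge0. Qed.

Lemma bilinE (K : realType) d (A : 'M[K]_d) u :
  bilin A u = \sum_i \sum_j u 0 i * A i j * u 0 j.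
Proof.
rewrite /bilin mxE exchange_big /=; apply: eq_bigr => j _.
by rewrite !mxE mulr_suml; apply: eq_bigr => i _.
Qed.

Lemma bilin_diff_le (K : realType) d (A B : 'M[K]_d) (e : K) u :
  (forall i j, `|A i j - B i j| <= e) ->
  `|bilin A u - bilin B u| <= e * norm1 u ^+ 2.
Proof.
move=> H; rewrite !bilinE -sumrB.
apply: le_trans (ler_norm_sum _ _ _) _.
rewrite expr2 /norm1 mulr_suml mulr_sumr; apply: ler_sum => i _.
rewrite -sumrB; apply: le_trans (ler_norm_sum _ _ _) _.
rewrite mulr_sumr mulr_sumr; apply: ler_sum => j _.
have -> : u 0 i * A i j * u 0 j - u 0 i * B i j * u 0 j =
  (A i j - B i j) * (u 0 i * u 0 j) by ring.
by rewrite !normrM ler_wpM2r ?mulr_ge0.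
Qed.

Lemma bilinZ (K : realType) d (A : 'M[K]_d) a u :
  bilin A (a *: u) = a ^+ 2 * bilin A u.
Proof.
rewrite !bilinE mulr_sumr; apply: eq_bigr => i _; rewrite mulr_sumr.
by apply: eq_bigr => j _; rewrite !mxE; ring.
Qed.

(** By induction with the Schur complement: the pivot controls the first
    coordinate, the complement the other ones. *)
Lemma posdef_lower (K : realType) d (A : 'M[K]_d) : A^T = A -> posdef A ->
  exists2 mu, 0 < mu & forall u, mu * norm1 u ^+ 2 <= bilin A u.
Proof.
elim: d A => [|d IH] A As Ap.
  exists 1 => // u; rewrite /norm1 big_ord0 expr0n mulr0.
  by rewrite bilinE big_ord0.
have [mu mu0 H] := IH _ (schur_sym (d := d) As) (schur_posdef (d := d) As Ap).
have a0 := posdef_pivot_gt0 (d := d) As Ap; set a := A _ _ in a0.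
set B := ursubmx (A : 'M[K]_(1 + d)).
pose C := \sum_i `|B 0 i| / a.
have C0 : 0 <= C by apply: sumr_ge0 => i _; rewrite divr_ge0 // ltW.
pose nu := Num.min (a / 2) (mu / (2 * (C + 1) ^+ 2)).
have C1 : 0 < (C + 1) ^+ 2 by rewrite exprn_gt0 // ltr_wpDl.
have nu0 : 0 < nu by rewrite lt_min !divr_gt0 // mulr_gt0.
exists nu => // u; rewrite -[u](@hsubmxK _ 1 1 d) [lsubmx _]mx11_scalar.
set x := lsubmx _ 0 0; set v := rsubmx _.
rewrite bilin_schur // -/B -/a; set t := (B *m v^T) 0 0 / a.
have Et : `|t| <= C * norm1 v.
  rewrite /t normrM normfV (gtr0_norm a0) /C mulr_suml mxE.
  apply: le_trans (_ : (\sum_i `|B 0 i * v^T i 0|) / a <= _).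
    by rewrite ler_pM2r ?invr_gt0 // ler_norm_sum.
  rewrite mulr_suml; apply: ler_sum => i _.
  rewrite normrM mulrAC ler_wpM2l ?divr_ge0 ?(ltW a0) // mxE /norm1.
  by rewrite (bigD1 i) //= lerDl sumr_ge0.
have -> : norm1 (row_mx x%:M v : 'rV[K]_(1 + d)) = `|x| + norm1 v.
  rewrite /norm1 big_split_ord big_ord1 /= row_mxEl mxE mulr1n; congr (_ + _).
  by apply: eq_bigr => i _; rewrite row_mxEr.
have v0 := norm1_ge0 v; set w := norm1 v in Et v0 *.
have Hx : `|x| <= `|x + t| + C * w.
  by have := ler_normB (x + t) t; rewrite addrK; lra.
have H1 : (`|x| + w) ^+ 2 <= 2 * (x + t) ^+ 2 + 2 * ((C + 1) ^+ 2 * w ^+ 2).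
  apply: le_trans (_ : (`|x + t| + (C + 1) * w) ^+ 2 <= _).
    rewrite lerXn2r ?nnegrE ?addr_ge0 ?mulr_ge0 ?addr_ge0 //; lra.
  rewrite -[(x + t) ^+ 2]real_normK ?num_real // -exprMn.
  have := sqr_ge0 (`|x + t| - (C + 1) * w); lra.
apply: le_trans (ler_wpM2l (ltW nu0) H1) _; rewrite mulrDr; apply: lerD.
  rewrite mulrA ler_wpM2r ?sqr_ge0 // -ler_pdivlMr //.
  by rewrite /nu ge_min lexx.
apply: le_trans (H v); rewrite -/w.
have -> : nu * (2 * ((C + 1) ^+ 2 * w ^+ 2)) = nu * (2 * (C + 1) ^+ 2) * w ^+ 2 by ring.
rewrite ler_wpM2r ?sqr_ge0 //.
have C2 : 0 < 2 * (C + 1) ^+ 2 by rewrite mulr_gt0.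
by rewrite -ler_pdivlMr // /nu ge_min lexx orbT.
Qed.

Lemma posdef_log_close (K : realType) d (A : 'M[K]_d) (e : K) :
  A^T = A -> posdef A -> 0 < e ->
  exists2 eta, 0 < eta & forall B : 'M[K]_d,
    (forall i j, `|B i j - A i j| <= eta) ->
    forall u, log_close e (bilin B u) (bilin A u).
Proof.
move=> As Ap e0; have [mu mu0 H] := posdef_lower As Ap.
have e1 : 0 < 1 - expR (- e) by rewrite subr_gt0 -expR0 ltr_expR oppr_lt0.
exists (mu * (1 - expR (- e))); first by rewrite mulr_gt0.
move=> B HB u; have := bilin_diff_le u HB.
rewrite mulrAC => H1.
have {}H1 : `|bilin B u - bilin A u| <= (1 - expR (- e)) * bilin A u.
  by apply: le_trans H1 _; rewrite mulrC ler_wpM2l // ltW.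
have b0 : 0 <= bilin A u.
  by apply: le_trans (H u); rewrite mulr_ge0 ?sqr_ge0 // ltW.
move: H1; rewrite ler_norml => /andP [H1 H2]; split; first by lra.
apply: le_trans (_ : (2 - expR (- e)) * bilin A u <= _); first by lra.
rewrite ler_wpM2r //.
have : 2 <= expR e + expR (- e).
  have := sqr_ge0 (expR (e / 2) - expR (- (e / 2))).
  rewrite sqrrB -!expRM_natl -expRD subrr expR0.
  have -> : 2%:R * (e / 2) = e by field.
  have -> : 2%:R * (- (e / 2)) = - e by field.
  lra.
lra.
Qed.

Lemma row_sqr_eq0 (K : realType) d (u : 'rV[K]_d) : (u *m u^T) 0 0 = 0 -> u = 0.
Proof.
rewrite mxE => /eqP; rewrite psumr_eq0 => [/allP H|k _]; last first.
  by rewrite mxE -expr2 sqr_ge0.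
apply/matrixP => i j; rewrite (ord1 i) [RHS]mxE.
by have := H j (mem_index_enum _); rewrite /= mxE mulf_eq0 orbb => /eqP.
Qed.

(** If the form vanishes at u, moving from u against u A makes it negative
    unless u A = 0. *)
Lemma possemidef_posdef (K : realType) d (A : 'M[K]_d) : A^T = A ->
  \det A != 0 -> (forall u, 0 <= bilin A u) -> posdef A.
Proof.
move=> As dA H u u0; rewrite lt_neqAle H andbT eq_sym; apply: contraNneq u0 => bu.
have Au : A \in unitmx by rewrite unitmxE unitfE.
suff uA : u *m A = 0 by rewrite -(mulmxK Au u) uA mul0mx.
set w := u *m A.
have E t : bilin A (u + t *: w) = 2 * t * (w *m w^T) 0 0 + t ^+ 2 * bilin A w.
  rewrite -bilinZ /bilin !mulmxDl linearD /= !mulmxDr.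
  have -> : (u *m A *m u^T + u *m A *m (t *: w)^T +
     (t *: w *m A *m u^T + t *: w *m A *m (t *: w)^T)) 0 0 =
     (u *m A *m u^T) 0 0 + (u *m A *m (t *: w)^T) 0 0 + ((t *: w *m A *m u^T) 0 0 +
     (t *: w *m A *m (t *: w)^T) 0 0) by rewrite !mxE.
  rewrite -/(bilin A u) bu -/w linearZ /= -scalemxAr.
  have -> : t *: w *m A *m u^T = t *: (w *m w^T).
    by rewrite -!scalemxAl -mulmxA /w trmx_mul As.
  have scaleE (k : K) (M : 'M[K]_1) : (k *: M) 0 0 = k * M 0 0 by rewrite mxE.
  rewrite !scaleE; ring.
have s0 : 0 <= (w *m w^T) 0 0.
  by rewrite mxE sumr_ge0 // => i _; rewrite [w^T _ _]mxE -expr2 sqr_ge0.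
apply: row_sqr_eq0; set s := (w *m w^T) 0 0 in E s0 *; set b := bilin A w in E.
have b0 : 0 <= b by exact: H.
apply/eqP; rewrite eq_le s0 andbT leNgt; apply/negP => sp.
have := H (u + (- (s / (b + 1))) *: w); rewrite E.
have b1 : 0 < b + 1 by lra.
set t := s / (b + 1); have t0 : 0 < t by rewrite divr_gt0.
have : t * (b + 1) = s by rewrite divfK // gt_eqF.
have := mulr_gt0 t0 sp; have := mulr_gt0 t0 t0; nra.
Qed.

(** * Entrywise convergence of matrices *)

(** Working with entries reduces limits of Phi and of its derivatives to limits
    of real functions. *)
Definition mx_cvg (K : realType) (T : Type) (F : set_system T) m n
    (A : T -> 'M[K]_(m, n)) (A0 : 'M[K]_(m, n)) : Prop :=
  forall i j, A t i j @[t --> F] --> A0 i j.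

Lemma cvg_sum_ord (K : realType) (T : Type) (F : set_system T) (FF : Filter F) n
    (f : 'I_n -> T -> K) (l : 'I_n -> K) :
  (forall i, f i t @[t --> F] --> l i) ->
  \sum_i f i t @[t --> F] --> \sum_i l i.
Proof.
move=> H; elim: n f l H => [|n IH] f l H.
  rewrite big_ord0; under eq_cvg => t do rewrite big_ord0.
  exact: cvg_cst.
rewrite big_ord_recl; under eq_cvg => t do rewrite big_ord_recl.
by apply: cvgD; [exact: H | apply: IH => i; exact: H].
Qed.

Lemma cvg_prod_ord (K : realType) (T : Type) (F : set_system T) (FF : Filter F) n
    (f : 'I_n -> T -> K) (l : 'I_n -> K) :
  (forall i, f i t @[t --> F] --> l i) ->
  \prod_i f i t @[t --> F] --> \prod_i l i.
Proof.
move=> H; elim: n f l H => [|n IH] f l H.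
  rewrite big_ord0; under eq_cvg => t do rewrite big_ord0.
  exact: cvg_cst.
rewrite big_ord_recl; under eq_cvg => t do rewrite big_ord_recl.
by apply: cvgM; [exact: H | apply: IH => i; exact: H].
Qed.

Section MxCvg.
Context (K : realType) (T : Type) (F : set_system T) (FF : Filter F).

Lemma mx_cvg_cst m n (A : 'M[K]_(m, n)) : mx_cvg F (fun=> A) A.
Proof. by move=> i j; exact: cvg_cst. Qed.

Lemma mx_cvgD m n (A B : T -> 'M[K]_(m, n)) A0 B0 :
  mx_cvg F A A0 -> mx_cvg F B B0 -> mx_cvg F (fun t => A t + B t) (A0 + B0).
Proof.
move=> HA HB i j; rewrite mxE; under eq_cvg => t do rewrite mxE.
by apply: cvgD.
Qed.

Lemma mx_cvgN m n (A : T -> 'M[K]_(m, n)) A0 :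
  mx_cvg F A A0 -> mx_cvg F (fun t => - A t) (- A0).
Proof.
move=> HA i j; rewrite mxE; under eq_cvg => t do rewrite mxE.
by apply: cvgN.
Qed.

Lemma mx_cvgM m n p (A : T -> 'M[K]_(m, n)) (B : T -> 'M[K]_(n, p)) A0 B0 :
  mx_cvg F A A0 -> mx_cvg F B B0 -> mx_cvg F (fun t => A t *m B t) (A0 *m B0).
Proof.
move=> HA HB i j; rewrite mxE; under eq_cvg => t do rewrite mxE.
by apply: cvg_sum_ord => k; exact: cvgM.
Qed.

Lemma mx_cvgZ m n (a : T -> K) (a0 : K) (A : T -> 'M[K]_(m, n)) A0 :
  a t @[t --> F] --> a0 ->
  mx_cvg F A A0 -> mx_cvg F (fun t => a t *: A t) (a0 *: A0).
Proof.
move=> Ha HA i j; rewrite mxE; under eq_cvg => t do rewrite mxE.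
by apply: cvgM.
Qed.

Lemma mx_cvg_tr m n (A : T -> 'M[K]_(m, n)) A0 :
  mx_cvg F A A0 -> mx_cvg F (fun t => (A t)^T) A0^T.
Proof.
by move=> HA i j; rewrite mxE; under eq_cvg => t do rewrite mxE; exact: HA.
Qed.

Lemma mx_cvg_det n (A : T -> 'M[K]_n) A0 :
  mx_cvg F A A0 -> \det (A t) @[t --> F] --> \det A0.
Proof.
move=> HA; rewrite /determinant.
elim: (index_enum _) => [|s S IH].
  rewrite big_nil; under eq_cvg => t do rewrite big_nil; exact: cvg_cst.
rewrite big_cons; under eq_cvg => t do rewrite big_cons.
apply: cvgD IH; apply: cvgM; first exact: cvg_cst.
by apply: cvg_prod_ord => i; exact: HA.
Qed.

End MxCvg.

(** * The function Phi along lines of the simplex *)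

(** The Hessian and the gradient before restriction to the directions along the
    simplex. *)
Definition full_hess (K : realType) (q : nat) (R : 'M[K]_q) (c : K) (x : 'cV[K]_q) :
    'M[K]_q :=
  diag_mx (map_mx GRing.inv x^T) +
  (2 * c / qform R x) *: ((2 / qform R x) *: (R *m x *m x^T *m R) - R).

Definition full_grad (K : realType) (q : nat) (R : 'M[K]_q) (r : 'cV[K]_q) (c : K)
    (x : 'cV[K]_q) : 'rV[K]_q :=
  (map_mx (@ln K) x)^T - (map_mx (@ln K) r)^T - (2 * c / qform R x) *: (x^T *m R).

Definition bform (K : realType) (q : nat) (R : 'M[K]_q) (u w : 'cV[K]_q) : K :=
  (u^T *m R *m w) 0 0.

Section QuadraticForm.
Context (K : realType) (q : nat) (R : 'M[K]_q).
Hypothesis R_sym : R^T = R.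
Hypothesis R_ge0 : forall i j, 0 <= R i j.

Lemma bformC u w : bform R u w = bform R w u.
Proof.
have E : u^T *m R *m w = (w^T *m R *m u)^T by rewrite !trmx_mul trmxK R_sym mulmxA.
by rewrite /bform E mxE.
Qed.

Lemma qform_line (x v : 'cV[K]_q) t :
  qform R (x + t *: v) = qform R x + 2 * t * bform R x v + t ^+ 2 * qform R v.
Proof.
have addE (M N : 'M[K]_1) : (M + N) 0 0 = M 0 0 + N 0 0 by rewrite mxE.
have scaleE k (M : 'M[K]_1) : (k *: M) 0 0 = k * M 0 0 by rewrite mxE.
have trE : (x + t *: v)^T = x^T + t *: v^T by rewrite linearD linearZ.
rewrite /qform trE mulmxDr !mulmxDl -!scalemxAr -!scalemxAl.
rewrite !addE !scaleE -/(bform R x v) -/(bform R v x) bformC; ring.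
Qed.

Lemma qform_ge0 (x : 'cV[K]_q) : (forall i, 0 <= x i 0) -> 0 <= qform R x.
Proof.
move=> x0; rewrite qformE sumr_ge0 // => i _; rewrite mulr_ge0 //.
by rewrite sumr_ge0 // => j _; rewrite mulr_ge0.
Qed.

Lemma qform_gt0 (x : 'cV[K]_q) : R != 0 -> (forall i, 0 < x i 0) -> 0 < qform R x.
Proof.
move=> R0 x0; have x0' i : 0 <= x i 0 by exact: ltW.
rewrite lt_neqAle eq_sym qform_ge0 // andbT.
apply: contraNneq R0 => /eqP; rewrite qformE psumr_eq0 => [/allP H|i _]; last first.
  by rewrite mulr_ge0 // sumr_ge0 // => j _; rewrite mulr_ge0.
apply/eqP/matrixP => i j; rewrite mxE.
have := H i (mem_index_enum _); rewrite /= mulf_eq0 gt_eqF //=.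
rewrite psumr_eq0 => [/allP H'|k _]; last by rewrite mulr_ge0.
by have := H' j (mem_index_enum _); rewrite /= mulf_eq0 gt_eqF //= => /eqP.
Qed.

Lemma qform_cvg (T : Type) (F : set_system T) (FF : Filter F) (x : T -> 'cV[K]_q) x0 :
  mx_cvg F x x0 -> qform R (x t) @[t --> F] --> qform R x0.
Proof.
move=> Hx; rewrite /qform.
have H : mx_cvg F (fun t => (x t)^T *m R *m x t) (x0^T *m R *m x0).
  by do 2?apply: mx_cvgM => //; [exact: mx_cvg_tr | exact: mx_cvg_cst].
exact: H.
Qed.

Lemma full_hess_cvg (T : Type) (F : set_system T) (FF : Filter F)
    (c : T -> K) (c0 : K) (x : T -> 'cV[K]_q) x0 :
  c t @[t --> F] --> c0 -> mx_cvg F x x0 ->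
  (forall i, x0 i 0 != 0) -> qform R x0 != 0 ->
  mx_cvg F (fun t => full_hess R (c t) (x t)) (full_hess R c0 x0).
Proof.
move=> Hc Hx x0n Qn; rewrite /full_hess.
have HQ := qform_cvg FF Hx.
have HQV : (qform R (x t))^-1 @[t --> F] --> (qform R x0)^-1 by exact: cvgV.
apply: mx_cvgD.
  move=> i j.
  have E (y : 'cV[K]_q) : diag_mx (map_mx GRing.inv y^T) i j = (y i 0)^-1 *+ (i == j).
    by rewrite !mxE.
  rewrite E; under eq_cvg => t do rewrite E.
  by case: (i == j); [apply: cvgV => //; exact: Hx | exact: cvg_cst].
apply: mx_cvgZ; first by apply: cvgM => //; apply: cvgM => //; exact: cvg_cst.
apply: mx_cvgD; last exact: mx_cvg_cst.
apply: mx_cvgZ; first by apply: cvgM => //; exact: cvg_cst.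
apply: mx_cvgM; last exact: mx_cvg_cst.
by do 2?apply: mx_cvgM => //; [exact: mx_cvg_cst | exact: mx_cvg_tr].
Qed.

Lemma full_hess_formE c x (v : 'cV[K]_q) :
  (v^T *m full_hess R c x *m v) 0 0 =
  \sum_i v i 0 ^+ 2 / x i 0 -
  c * (2 * qform R v / qform R x - (2 * bform R x v / qform R x) ^+ 2).
Proof.
have addE (M N : 'M[K]_1) : (M + N) 0 0 = M 0 0 + N 0 0 by rewrite mxE.
have subE (M N : 'M[K]_1) : (M - N) 0 0 = M 0 0 - N 0 0 by rewrite !mxE.
have scaleE k (M : 'M[K]_1) : (k *: M) 0 0 = k * M 0 0 by rewrite mxE.
rewrite /full_hess mulmxDr mulmxDl addE; congr (_ + _).
  rewrite mxE; apply: eq_bigr => i _.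
  by rewrite mul_mx_diag !mxE expr2; ring.
rewrite -scalemxAr -scalemxAl scaleE mulmxBr mulmxBl subE -scalemxAr -scalemxAl scaleE.
rewrite -/(qform R v).
have -> : (v^T *m (R *m x *m x^T *m R) *m v) 0 0 = bform R x v ^+ 2.
  rewrite !mulmxA -[_ *m v]mulmxA -[_ *m (R *m v)]mulmxA [v^T *m R *m x *m _]mulmxA.
  have -> : v^T *m R *m x *m x^T *m (R *m v) = (v^T *m R *m x) *m (x^T *m R *m v).
    by rewrite !mulmxA.
  rewrite mxE big_ord1 -/(bform R v x) -/(bform R x v) bformC -expr2.
  by [].
rewrite expr_div_n exprMn; set Q := qform R x.
have [->|Q0] := eqVneq Q 0.
  by rewrite expr0n /= invr0 !mulr0 !mul0r subrr mulr0 oppr0.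
by field.
Qed.

End QuadraticForm.

(** With k the remainder, the mean value theorem for f t - f' 0 * t - k * t^2
    gives f' x - f' 0 = 2 k x for some x; applied to f' on [0, x] it shows that
    f'' takes the value 2 k. *)
Lemma taylor2 (K : realType) (f f' f'' : K -> K) :
  (forall t : K, 0 <= t <= 1 -> is_derive t (1 : K) f (f' t)) ->
  (forall t : K, 0 <= t <= 1 -> is_derive t (1 : K) f' (f'' t)) ->
  exists2 th, 0 <= th <= 1 & f 1 = f 0 + f' 0 + f'' th / 2.
Proof.
move=> df df'; set k := f 1 - f 0 - f' 0.
pose g (t : K) := f t - f' 0 * t - k * t ^+ 2.
have dg (t : K) : 0 <= t <= 1 -> is_derive t (1 : K) g (f' t - f' 0 - 2 * k * t).
  move=> t01; have h := df t t01; rewrite /g.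
  by apply: is_derive_eq; rewrite /GRing.scale /=; ring.
have [||x] := @MVT K g (fun t => f' t - f' 0 - 2 * k * t) 0 1 ltr01.
- by move=> t; rewrite in_itv /= => /andP [t0 t1]; apply: dg; rewrite !ltW.
- apply: derivable_within_continuous => t; rewrite in_itv /= => t01.
  exact: (@ex_derive _ _ _ _ _ _ _ (dg t t01)).
rewrite in_itv /= => /andP [x0 x1].
rewrite /g subr0 mulr1 !mulr0 !mulr1 expr0n expr1n /= mulr0 !subr0 mulr1 => E.
have [||y] := @MVT K f' f'' 0 x x0.
- move=> t; rewrite in_itv /= => /andP [t0 tx]; apply: df'; rewrite !ltW //.
  exact: lt_trans x1.
- apply: derivable_within_continuous => t; rewrite in_itv /= => /andP [t0 tx].
  have t01 : 0 <= t <= 1 by rewrite t0 (le_trans tx) // ltW.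
  exact: (@ex_derive _ _ _ _ _ _ _ (df' t t01)).
rewrite in_itv /= => /andP [y0 yx] E2.
exists y; first by rewrite ltW //= (le_trans (ltW yx)) // ltW.
have : f'' y = 2 * k.
  apply: (mulIf (lt0r_neq0 x0)) => //.
  move: E2; rewrite subr0 => <-; move: E; rewrite /k; lra.
by move=> ->; rewrite /k; field.
Qed.

Section PhiTaylor.
Context (K : realType) (q : nat) (R : 'M[K]_q) (r : 'cV[K]_q).
Hypothesis R_sym : R^T = R.
Hypothesis R_ge0 : forall i j, 0 <= R i j.
Hypothesis R_neq0 : R != 0.

Lemma full_grad_formE c (x v : 'cV[K]_q) :
  (full_grad R r c x *m v) 0 0 =
  \sum_i v i 0 * (ln (x i 0) - ln (r i 0)) - 2 * c / qform R x * bform R x v.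
Proof.
have subE (M N : 'M[K]_1) : (M - N) 0 0 = M 0 0 - N 0 0 by rewrite !mxE.
have scaleE k (M : 'M[K]_1) : (k *: M) 0 0 = k * M 0 0 by rewrite mxE.
rewrite /full_grad mulmxBl subE -scalemxAl scaleE; congr (_ - _).
rewrite mulmxBl subE !mxE -sumrB; apply: eq_bigr => i _; rewrite !mxE; ring.
Qed.

Lemma is_derive_sum_fun n (h : 'I_n -> K -> K) (x : K) (dh : 'I_n -> K) :
  (forall i, is_derive x (1 : K) (h i) (dh i)) ->
  is_derive x (1 : K) (fun t => \sum_i h i t) (\sum_i dh i).
Proof.
move=> H; have := is_derive_sum H; congr is_derive.
by apply/funext => t; rewrite fct_sumE.
Qed.

Lemma is_derive_ln_affine (a b t : K) : 0 < a + t * b ->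
  is_derive t (1 : K) (fun s => ln (a + s * b)) (b / (a + t * b)).
Proof.
move=> H.
have h1 : is_derive t (1 : K) (fun s : K => a + s * b) b.
  by apply: is_derive_eq; rewrite /GRing.scale /=; ring.
by have := @is_derive1_comp _ (@ln K) (fun s => a + s * b) t _ _ (is_derive1_ln H) h1;
  rewrite mulrC.
Qed.

(** As v has sum 0, the constant in the derivative of x log x drops out of the
    gradient. *)
Lemma Phi_taylor c (x v : 'cV[K]_q) :
  (forall i, 0 < x i 0) -> (forall i, 0 < (x + v) i 0) -> \sum_i v i 0 = 0 ->
  exists2 th, 0 <= th <= 1 &
    Phi R r c (x + v) = Phi R r c x + (full_grad R r c x *m v) 0 0 +
      (v^T *m full_hess R c (x + th *: v) *m v) 0 0 / 2.
Proof.
move=> x0 xv0 sv.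
set q0 := qform R x; set q1 := bform R x v; set q2 := qform R v.
have pos (t : K) i : 0 <= t <= 1 -> 0 < x i 0 + t * v i 0.
  move=> /andP [t0 t1]; have := x0 i; have := xv0 i; rewrite mxE.
  have [->|t_neq1] := eqVneq t 1; first by rewrite mul1r.
  have : 0 < 1 - t by rewrite subr_gt0 lt_neqAle t_neq1.
  move=> s0 a0 b0; have := mulr_gt0 s0 b0; have := mulr_ge0 t0 (ltW a0); lra.
pose Q (t : K) := q0 + 2 * t * q1 + t ^+ 2 * q2.
have QE t : Q t = qform R (x + t *: v) by rewrite qform_line.
have Qpos (t : K) : 0 <= t <= 1 -> 0 < Q t.
  by move=> t01; rewrite QE; apply: qform_gt0 => // i; rewrite !mxE pos.
pose f (t : K) := \sum_i ((x i 0 + t * v i 0) * (ln (x i 0 + t * v i 0) - ln (r i 0))) -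
  c * ln (Q t).
pose f' (t : K) := \sum_i (v i 0 * (ln (x i 0 + t * v i 0) - ln (r i 0)) + v i 0) -
  c * ((2 * q1 + 2 * t * q2) / Q t).
pose f'' (t : K) := \sum_i (v i 0 * (v i 0 / (x i 0 + t * v i 0))) -
  c * (2 * q2 / Q t - (2 * q1 + 2 * t * q2) ^+ 2 / Q t ^+ 2).
have dQ (t : K) : is_derive t (1 : K) Q (2 * q1 + 2 * t * q2).
  by rewrite /Q; apply: is_derive_eq; rewrite /GRing.scale /=; ring.
have df (t : K) : 0 <= t <= 1 -> is_derive t (1 : K) f (f' t).
  move=> t01; rewrite /f /f'.
  have h2 := is_derive1_comp (is_derive1_ln (Qpos t t01)) (dQ t).
  have h1 : is_derive t (1 : K) (fun t => \sum_i ((x i 0 + t * v i 0) *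
     (ln (x i 0 + t * v i 0) - ln (r i 0))))
     (\sum_i (v i 0 * (ln (x i 0 + t * v i 0) - ln (r i 0)) + v i 0)).
    apply: is_derive_sum_fun => i; have h := is_derive_ln_affine (pos t i t01).
    apply: is_derive_eq; rewrite /GRing.scale /=; field.
    by rewrite gt_eqF // pos.
  by apply: is_derive_eq; rewrite /GRing.scale /=; ring.
have df' (t : K) : 0 <= t <= 1 -> is_derive t (1 : K) f' (f'' t).
  move=> t01; rewrite /f' /f''.
  have Qn : Q t != 0 by rewrite gt_eqF // Qpos.
  have h2 : is_derive t (1 : K) (fun t => (Q t)^-1)
      (- (Q t) ^- 2 *: (2 * q1 + 2 * t * q2)).
    by apply: is_deriveV => //; exact: dQ.
  have h1 : is_derive t (1 : K)
     (fun t => \sum_i (v i 0 * (ln (x i 0 + t * v i 0) - ln (r i 0)) + v i 0))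
     (\sum_i (v i 0 * (v i 0 / (x i 0 + t * v i 0)))).
    apply: is_derive_sum_fun => i; have h := is_derive_ln_affine (pos t i t01).
    by apply: is_derive_eq; rewrite /GRing.scale /=; ring.
  apply: is_derive_eq; rewrite /GRing.scale /=; field.
  exact: Qn.
have [th th01 E] := taylor2 df df'; exists th => //.
have f1 : f 1 = Phi R r c (x + v).
  rewrite /f /Phi QE scale1r; congr (_ - _).
  by apply: eq_bigr => i _; rewrite mxE mul1r.
have f0 : f 0 = Phi R r c x.
  rewrite /f /Phi QE scale0r addr0; congr (_ - _).
  by apply: eq_bigr => i _; rewrite mul0r addr0.
rewrite -f1 -f0 E; congr (_ + _ + _ / _).
  rewrite full_grad_formE /f' big_split /= sv addr0; congr (_ - _).
    by apply: eq_bigr => i _; rewrite mul0r addr0.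
  by rewrite QE scale0r addr0 mulr0 mul0r addr0 -/q0 -/q1; ring.
rewrite full_hess_formE // /f''; congr (_ - _).
  by apply: eq_bigr => i _; rewrite !mxE expr2 mulrA.
rewrite -QE; have -> : bform R (x + th *: v) v = q1 + th * q2.
  have trE : (x + th *: v)^T = x^T + th *: v^T by rewrite linearD linearZ.
  have addE (M N : 'M[K]_1) : (M + N) 0 0 = M 0 0 + N 0 0 by rewrite mxE.
  have scaleE k (M : 'M[K]_1) : (k *: M) 0 0 = k * M 0 0 by rewrite mxE.
  by rewrite /bform trE !mulmxDl -!scalemxAl addE scaleE.
rewrite -/q2; congr (_ * _).
have Qn : Q th != 0 by rewrite gt_eqF // Qpos.
by field.
Qed.

End PhiTaylor.

Lemma bilin_hess_Phi (K : realType) d (R : 'M[K]_(1 + d)) c x (e : 'rV[K]_d) :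
  bilin (@hess_Phi K (1 + d) R (std_directions K d) c x) e =
  ((std_directions K d *m e^T)^T *m full_hess R c x *m (std_directions K d *m e^T)) 0 0.
Proof. by rewrite /bilin /hess_Phi -/(full_hess R c x) trmx_mul trmxK !mulmxA. Qed.

Lemma grad_PhiE (K : realType) d (R : 'M[K]_(1 + d)) r c x (e : 'rV[K]_d) :
  (@grad_Phi K (1 + d) R r (std_directions K d) c x *m e^T) 0 0 =
  (full_grad R r c x *m (std_directions K d *m e^T)) 0 0.
Proof. by rewrite /grad_Phi mulmxA. Qed.

Lemma hess_Phi_sym (K : realType) d (R : 'M[K]_(1 + d)) c x : R^T = R ->
  (@hess_Phi K (1 + d) R (std_directions K d) c x)^T =
  @hess_Phi K (1 + d) R (std_directions K d) c x.
Proof.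
move=> Rs; rewrite /hess_Phi !trmx_mul trmxK mulmxA; congr (_ *m _ *m _).
rewrite linearD linearZ linearB linearZ /= tr_diag_mx !trmx_mul trmxK Rs.
by rewrite !mulmxA.
Qed.

(** * Local minima of Phi *)

(** Boolean, since boxes select the typings that finite sums range over. *)
Definition box (K : realType) (q : nat) (x : 'cV[K]_q) (rho : K) (y : 'cV[K]_q) : bool :=
  [forall i, `|y i 0 - x i 0| < rho].

Lemma nbhs_box (K : realType) (q : nat) (x : 'cV[K]_q) (P : set 'cV[K]_q) :
  nbhs x P <-> exists2 rho, 0 < rho & forall y, box x rho y -> P y.
Proof.
split=> [/nbhs_ballP [e /= e0 H]|[rho rho0 H]].
  exists e => // y /forallP yx; apply: H; split=> // i j.
  by rewrite (ord1 j) /ball /= distrC; exact: yx.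
apply/nbhs_ballP; exists rho => // y [_ yx]; apply: H; apply/forallP => i.
by have := yx i 0; rewrite /ball /= distrC.
Qed.

Lemma nbhs_pair_box (K : realType) (q : nat) (c0 : K) (x : 'cV[K]_q)
    (P : set (K * 'cV[K]_q)) :
  nbhs (c0, x) P -> exists2 rho, 0 < rho & forall c y,
    `|c - c0| < rho -> box x rho y -> P (c, y).
Proof.
move=> [[A B] /= [/nbhs_ballP [e /= e0 HA] /nbhs_box [rho rho0 HB]] H].
exists (Num.min e rho); first by rewrite lt_min e0.
move=> c y; rewrite lt_min => /andP [ce _] /forallP yx; apply: H; split=> /=.
  by apply: HA; rewrite /ball /= distrC.
by apply: HB; apply/forallP => i; have := yx i; rewrite lt_min => /andP [].
Qed.

Lemma box_widen (K : realType) (q : nat) (x : 'cV[K]_q) (rho rho' : K) y :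
  rho <= rho' -> box x rho y -> box x rho' y.
Proof. by move=> H /forallP b; apply/forallP => i; apply: lt_le_trans (b i) H. Qed.

Lemma box_refl (K : realType) (q : nat) (x : 'cV[K]_q) (rho : K) : 0 < rho -> box x rho x.
Proof. by move=> H; apply/forallP => i; rewrite subrr normr0. Qed.

Lemma box_convex (K : realType) (q : nat) (x : 'cV[K]_q) (rho : K) y z t :
  0 <= t <= 1 -> box x rho y -> box x rho (y + z) -> box x rho (y + t *: z).
Proof.
move=> /andP [t0 t1] /forallP by_ /forallP byz; apply/forallP => i.
have := by_ i; have := byz i; rewrite !mxE !ltr_norml => /andP [a1 a2] /andP [b1 b2].
have [->|tn] := eqVneq t 1; first by rewrite mul1r a1 a2.
have s0 : 0 < 1 - t by rewrite subr_gt0 lt_neqAle tn.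
apply/andP; split.
  have : 0 < (1 - t) * (y i 0 - x i 0 + rho) by rewrite mulr_gt0 //; lra.
  have : 0 <= t * (y i 0 + z i 0 - x i 0 + rho) by rewrite mulr_ge0 //; lra.
  lra.
have : 0 < (1 - t) * (rho - (y i 0 - x i 0)) by rewrite mulr_gt0 //; lra.
have : 0 <= t * (rho - (y i 0 + z i 0 - x i 0)) by rewrite mulr_ge0 //; lra.
lra.
Qed.

Lemma mx_cvg_snd (K : realType) (T : topologicalType) (c0 : T) (q : nat) (x : 'cV[K]_q) :
  mx_cvg (nbhs (c0, x)) (fun p => p.2) x.
Proof.
move=> i j; apply: (@cvg_comp _ _ _ snd (fun y : 'cV[K]_q => y i j) _ (nbhs x)).
  exact: cvg_snd.
exact: coord_continuous.
Qed.

Lemma lineE (K : realType) (q : nat) (x v : 'cV[K]_q) s t i :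
  (x + s *: (t *: v)) i 0 - x i 0 = s * (t * v i 0).
Proof. by rewrite !mxE; ring. Qed.

Section LocalMinima.
Context (K : realType) (d : nat) (R : 'M[K]_(1 + d)) (r : 'cV[K]_(1 + d)).
Hypothesis R_sym : R^T = R.
Hypothesis R_ge0 : forall i j, 0 <= R i j.
Hypothesis R_neq0 : R != 0.

Let S := std_directions K d.
Let hess c x : 'M[K]_d := @hess_Phi K (1 + d) R S c x.
Let grad c x : 'rV[K]_d := @grad_Phi K (1 + d) R r S c x.

Lemma full_hess_continuous c0 (x0 : 'cV[K]_(1 + d)) : (forall i, 0 < x0 i 0) ->
  mx_cvg (nbhs (c0, x0)) (fun p => full_hess R p.1 p.2) (full_hess R c0 x0).
Proof.
move=> x00; apply: full_hess_cvg.
- exact: cvg_fst.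
- exact: mx_cvg_snd.
- by move=> i; rewrite gt_eqF.
- by rewrite gt_eqF // qform_gt0.
Qed.

Lemma hess_continuous c0 (x0 : 'cV[K]_(1 + d)) : (forall i, 0 < x0 i 0) ->
  mx_cvg (nbhs (c0, x0)) (fun p => hess p.1 p.2) (hess c0 x0).
Proof.
move=> x00; rewrite /hess /hess_Phi; apply: mx_cvgM; last exact: mx_cvg_cst.
by apply: mx_cvgM; [exact: mx_cvg_cst | exact: full_hess_continuous].
Qed.

Lemma near_forall_ord (T : Type) (F : set_system T) (FF : Filter F) n (P : 'I_n -> T -> Prop) :
  (forall i, \forall t \near F, P i t) -> \forall t \near F, forall i, P i t.
Proof. by move=> H; exact: filter_forall. Qed.

Lemma near_pos (T : topologicalType) (c0 : T) (x0 : 'cV[K]_(1 + d)) : (forall i, 0 < x0 i 0) ->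
  \forall p \near (c0, x0), forall i, 0 < (p.2 : 'cV[K]_(1 + d)) i 0.
Proof.
move=> x00.
apply: (@near_forall_ord _ (nbhs (c0, x0)) _ _
  (fun i p => 0 < (p.2 : 'cV[K]_(1 + d)) i 0)) => i.
have := @mx_cvg_snd K T c0 _ x0 i 0.
by move/cvgr_gt => /(_ 0 (x00 i)).
Qed.

Lemma local_hess (c0 : K) (x0 : 'cV[K]_(1 + d)) (e : K) :
  (forall i, 0 < x0 i 0) -> posdef (hess c0 x0) -> 0 < e ->
  exists2 rho, 0 < rho & forall c x, `|c - c0| < rho -> box x0 rho x ->
    (forall i, 0 < x i 0) /\
    forall u, log_close e (bilin (hess c x) u) (bilin (hess c0 x0) u).
Proof.
move=> x00 Hp e0.
have [eta eta0 H] := posdef_log_close (hess_Phi_sym _ _ R_sym) Hp e0.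
have Hn : \forall p \near (c0, x0), forall i j, `|hess p.1 p.2 i j - hess c0 x0 i j| <= eta.
  apply: (@near_forall_ord _ (nbhs (c0, x0)) _ _
    (fun i p => forall j, `|hess p.1 p.2 i j - hess c0 x0 i j| <= eta)) => i.
  apply: (@near_forall_ord _ (nbhs (c0, x0)) _ _
    (fun j p => `|hess p.1 p.2 i j - hess c0 x0 i j| <= eta)) => j.
  have /cvgrPdist_le /(_ eta eta0) := @hess_continuous c0 x0 x00 i j.
  by apply: filterS => p; rewrite distrC.
have [rho rho0 Hrho] := nbhs_pair_box (filterI (@near_pos _ c0 x0 x00) Hn).
exists rho => // c x cc bx; have [x_gt0 /= Hx] := Hrho c x cc bx.
by split=> // u; exact: H.
Qed.

(** The expansion holds between any two points of the box and for all c near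
    c0, with a quadratic remainder that stays close to the Hessian at c0. It
    can thus be centred at the minimum of Phi c, which moves with c. *)
Lemma local_quadratic (c0 : K) (x0 : 'cV[K]_(1 + d)) (e : K) :
  (forall i, 0 < x0 i 0) -> posdef (hess c0 x0) -> 0 < e ->
  exists2 rho, 0 < rho & forall c x y, `|c - c0| < rho ->
    box x0 rho x -> box x0 rho y -> \sum_i x i 0 = 1 -> \sum_i y i 0 = 1 ->
    exists2 B, log_close e B (bilin (hess c0 x0) (tail y - tail x)) &
      Phi R r c y = Phi R r c x + (grad c x *m (tail y - tail x)^T) 0 0 + B / 2.
Proof.
move=> x00 Hp e0; have [rho rho0 H] := local_hess x00 Hp e0.
exists rho => // c x y cc bx by_ sx sy.
have Ey := simplex_diff sx sy; set u := tail y - tail x in Ey *.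
have [x_gt0 _] := H c x cc bx; have [y_gt0 _] := H c y cc by_.
rewrite Ey in y_gt0 by_ *; set v := std_directions K d *m u^T in y_gt0 by_ *.
have [th th01 ->] := Phi_taylor r R_sym R_ge0 R_neq0 c x_gt0 y_gt0 (sum_std_directions u).
rewrite -/v; exists ((v^T *m full_hess R c (x + th *: v) *m v) 0 0).
  rewrite -bilin_hess_Phi -/S -/(hess _ _).
  by have [_] := H c _ cc (box_convex th01 bx by_); apply.
by rewrite /grad grad_PhiE.
Qed.

(** The remainder in Taylor's formula involves the Hessian at an intermediate
    point, which by continuity exceeds the one at x by less than any prescribed
    amount. *)
Lemma local_minimum_conditions c x : simplex_interior x -> local_minimum_Phi R r c x ->
  grad c x = 0 /\ forall u, 0 <= bilin (hess c x) u.
Proof.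
move=> [x_gt0 sx] xmin.
have key (u : 'rV[K]_d) (e : K) : 0 < e -> exists2 tau, 0 < tau &
    forall t, `|t| < tau -> 0 <= t * (grad c x *m u^T) 0 0 +
      t ^+ 2 * (bilin (hess c x) u + e) / 2.
  move=> e0; set v := S *m u^T.
  have Hcvg : mx_cvg (nbhs (c, x)) (fun p => v^T *m full_hess R p.1 p.2 *m v)
      (v^T *m full_hess R c x *m v).
    apply: mx_cvgM; last exact: mx_cvg_cst.
    by apply: mx_cvgM; [exact: mx_cvg_cst | exact: full_hess_continuous].
  have /cvgrPdist_le /(_ e e0) := Hcvg 0 0.
  rewrite -bilin_hess_Phi -/S -/(hess _ _) => Hnear.
  have Hm : \forall p \near (c, x), simplex p.2 -> Phi R r c x <= Phi R r c p.2.
    exact: (@cvg_snd _ _ (nbhs c) (nbhs x) _ _ xmin).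
  have [rho rho0 H] := nbhs_pair_box (filterI Hm (filterI (@near_pos _ c x x_gt0) Hnear)).
  set M := \sum_i `|v i 0| + 1; have M0 : 0 < M by rewrite ltr_wpDl // sumr_ge0.
  exists (rho / M); first by rewrite divr_gt0.
  move=> t; rewrite ltr_pdivlMr // => tM.
  have bt s : 0 <= s <= 1 -> box x rho (x + s *: (t *: v)).
    move=> /andP [s0 s1]; apply/forallP => i; rewrite lineE.
    apply: le_lt_trans tM; rewrite !normrM (ger0_norm s0).
    apply: le_trans (_ : `|t| * `|v i 0| <= _).
      by rewrite ler_piMl // mulr_ge0.
    rewrite ler_wpM2l // /M (bigD1 i) //= -addrA lerDl addr_ge0 //.
    by rewrite sumr_ge0.
  have b1 := bt 1; rewrite scale1r ler01 lexx in b1; have {}b1 := b1 isT.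
  have cc : `|c - c| < rho by rewrite subrr normr0.
  have [Hmin [xt_gt0 _]] := H c _ cc b1.
  have sv : \sum_i (t *: v) i 0 = 0.
    by rewrite (eq_bigr (fun i => t * v i 0)) ?(-mulr_sumr) => [|i _];
      rewrite ?mxE // -mulr_sumr sum_std_directions mulr0.
  have [th th01 E] := Phi_taylor r R_sym R_ge0 R_neq0 c x_gt0 xt_gt0 sv.
  have [_ [_ /=]] := H c _ cc (bt th th01).
  set y := x + th *: (t *: v) in E *.
  have : Phi R r c x <= Phi R r c (x + t *: v).
    apply: Hmin; split=> [i|]; first exact/ltW.
    rewrite (eq_bigr (fun i => x i 0 + (t *: v) i 0)) => [|i _]; last by rewrite mxE.
    by rewrite big_split /= sx sv addr0.
  have scaleE k (N : 'M[K]_1) : (k *: N) 0 0 = k * N 0 0 by rewrite mxE.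
  have trE : (t *: v)^T = t *: v^T by rewrite linearZ.
  rewrite E trE -!scalemxAr -!scalemxAl !scaleE -grad_PhiE -/S -/(grad _ _).
  set g := (grad c x *m u^T) 0 0; set b := (v^T *m full_hess R c y *m v) 0 0.
  rewrite -addrA lerDl => H1; rewrite ler_norml => /andP [H2 _].
  apply: le_trans H1 _; rewrite lerD2l ler_pM2r ?invr_gt0 // mulrA -expr2.
  rewrite ler_wpM2l ?sqr_ge0 //; lra.
have g0 (u : 'rV[K]_d) : (grad c x *m u^T) 0 0 = 0.
  have [tau tau0 H] := key u 1 ltr01; set g := (_ *m _) 0 0 in H *.
  set b := bilin _ _ in H.
  apply/eqP; rewrite -normr_le0 leNgt; apply/negP => gp.
  set M := `|b + 1| + 1; have M0 : 0 < M by rewrite ltr_wpDl.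
  set s := Num.min (tau / 2) (`|g| / M).
  have s0 : 0 < s by rewrite lt_min !divr_gt0.
  have s1 : s < tau by rewrite gt_min; apply/orP; left; lra.
  have s2 : s * M <= `|g| by rewrite -ler_pdivlMr // /s ge_min lexx orbT.
  have := H (- (Num.sg g * s)); rewrite normrN normrM normr_sg.
  have gn : g != 0 by rewrite -normr_gt0.
  rewrite gn mul1r (gtr0_norm s0) => /(_ s1).
  rewrite sqrrN exprMn sqr_sg gn mul1r.
  have -> : - (Num.sg g * s) * g = - (s * `|g|) by rewrite [`|g|]normrEsg; ring.
  have : s ^+ 2 * (b + 1) <= s * `|g|.
    rewrite expr2 -mulrA ler_wpM2l ?(ltW s0) //; apply: le_trans s2.
    rewrite ler_wpM2l ?(ltW s0) //; have := ler_norm (b + 1); rewrite /M; lra.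
  have := mulr_gt0 s0 gp; lra.
split.
  exact: row_sqr_eq0 (g0 _).
move=> u; rewrite leNgt; apply/negP => b0.
have e0 : 0 < - bilin (hess c x) u / 2 by lra.
have [tau tau0 H] := key u _ e0.
have := H (tau / 2); rewrite g0 mulr0 add0r gtr0_norm ?divr_gt0 //.
have t2 : tau / 2 < tau by lra.
move=> /(_ t2); have : 0 < (tau / 2) ^+ 2 by rewrite exprn_gt0 // divr_gt0.
set b := bilin _ _ in b0 *; nra.
Qed.

End LocalMinima.

(** * The exponential growth rate *)

Definition entropy (K : realType) (q : nat) (r x : 'cV[K]_q) : K :=
  \sum_i x i 0 * (ln (x i 0) - ln (r i 0)).

(** This is exp (- Phi) in a form that makes sense on the boundary of the
    simplex, where x^T R x may vanish: there 0^c is 0 for c > 0 and 1 for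
    c = 0. *)
Definition growth (K : realType) (q : nat) (R : 'M[K]_q) (r : 'cV[K]_q) (c : K)
    (x : 'cV[K]_q) : K :=
  expR (- entropy r x) * qform R x `^ c.

Lemma vpow_entropy (K : realType) (q : nat) (r x : 'cV[K]_q) :
  (forall i, 0 < r i 0) -> (forall i, 0 <= x i 0) ->
  vpow r x / vpow x x = expR (- entropy r x).
Proof.
move=> r0 x0; rewrite /vpow -prodfV -big_split /= /entropy -sumrN expR_sum.
apply: eq_bigr => i _; rewrite mulrBr opprB expRD expRN; congr (_ * _^-1).
  by rewrite /powR gt_eqF.
rewrite /powR; case: eqVneq => [->|//].
by rewrite mul0r expR0.
Qed.

Lemma growth_Phi (K : realType) (q : nat) (R : 'M[K]_q) (r : 'cV[K]_q) c x :
  0 < qform R x -> growth R r c x = expR (- Phi R r c x).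
Proof.
move=> Q0; rewrite /growth /Phi /powR gt_eqF // -expRD; congr expR.
by rewrite /entropy; ring.
Qed.

Lemma growth_ge0 (K : realType) (q : nat) (R : 'M[K]_q) (r : 'cV[K]_q) c x :
  0 <= growth R r c x.
Proof. by rewrite mulr_ge0 ?expR_ge0 ?powR_ge0. Qed.

Lemma xlnx_cvg (K : realType) (T : Type) (F : set_system T) (FF : Filter F)
    (y : T -> K) (y0 : K) : 0 <= y0 -> y t @[t --> F] --> y0 ->
  y t * ln (y t) @[t --> F] --> y0 * ln y0.
Proof.
rewrite le_eqVlt => /predU1P [<-|y00] Hy; last first.
  by apply: cvgM => //; apply: (@cvg_comp _ _ _ y (@ln K) _ (nbhs y0)) => //;
    exact: continuous_ln.
rewrite mul0r; apply/cvgr0Pnorm_le => e e0.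
have s0 : 0 < Num.min 1 ((e / 2) ^+ 2) by rewrite lt_min ltr01 exprn_gt0 ?divr_gt0.
have N : \forall t \near F, `|y t| < Num.min 1 ((e / 2) ^+ 2).
  exact: (cvgr0Pnorm_lt _).1 Hy _ s0.
apply: filterS N => t.
set z := y t; rewrite lt_min => /andP [z1 z2].
have [z0|z0] := leP z 0; first by rewrite ln0 // mulr0 normr0 ltW.
rewrite (gtr0_norm z0) in z1 z2; set w := Num.sqrt z.
have w0 : 0 < w by rewrite sqrtr_gt0.
have zw : z = w ^+ 2 by rewrite sqr_sqrtr // ltW.
have we : w <= e / 2.
  by rewrite leNgt; apply/negP => ew; move: z2; rewrite zw !expr2; nra.
have lw : - ln w <= w^-1.
  have wi : 0 < w^-1 by rewrite invr_gt0.
  have : ln (1 + (w^-1 - 1)) <= w^-1 - 1 by apply: le_ln1Dx; lra.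
  by rewrite addrC subrK lnV ?posrE // => H; apply: le_trans H _; lra.
have lz : ln z = 2 * ln w by rewrite zw lnXn // mulr_natl.
have lz0 : ln z <= 0 by rewrite ln_le0 // ltW.
rewrite normrM (gtr0_norm z0) (ler0_norm lz0) lz zw expr2.
have : w * - ln w <= 1.
  by have := ler_wpM2l (ltW w0) lw; rewrite divff // gt_eqF.
have := mulr_gt0 w0 w0; nra.
Qed.

Lemma entropy_cvg (K : realType) (q : nat) (r : 'cV[K]_q) (T : Type)
    (F : set_system T) (FF : Filter F) (x : T -> 'cV[K]_q) (x0 : 'cV[K]_q) :
  (forall i, 0 <= x0 i 0) -> mx_cvg F x x0 ->
  entropy r (x t) @[t --> F] --> entropy r x0.
Proof.
move=> x00 Hx; apply: cvg_sum_ord => i; rewrite mulrBr.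
under eq_cvg => t do rewrite mulrBr.
apply: cvgB; first by apply: xlnx_cvg.
by apply: cvgM; [exact: Hx | exact: cvg_cst].
Qed.

Lemma compact_simplex (K : realType) (q : nat) : compact (@simplex K q).
Proof.
pose A := [set v : 'rV[K]_q | forall i, `[0, 1]%classic (v ord0 i)].
have cA : compact A.
  by apply: (@rV_compact K q (fun=> `[0, 1]%classic)) => i; exact: segment_compact.
pose B := [set v : 'rV[K]_q | \sum_i v 0 i = 1].
have clB : closed B.
  have -> : B = (fun v : 'rV[K]_q => \sum_i v 0 i) @^-1` [set 1] by [].
  apply: closed_comp; last exact: closed_eq.
  by move=> v _; apply: (cvg_sum_ord (nbhs_filter v)) => i; exact: coord_continuous.
have cAB : compact (A `&` B) by exact: compact_closedI.
have -> : @simplex K q = trmx @` (A `&` B).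
  apply/seteqP; split=> [x [x0 sx]|_ [v [vA vB] <-]].
    exists x^T; last by rewrite trmxK.
    split=> [i|]; last by rewrite /B /=; rewrite -[RHS]sx; apply: eq_bigr => i _; rewrite mxE.
    rewrite /= in_itv /= mxE x0 /= -sx (bigD1 i) //= lerDl.
    by rewrite sumr_ge0 // => j _; exact: x0.
  split=> [i|].
    by have := vA i; rewrite /= in_itv /= mxE => /andP [].
  by rewrite -[RHS]vB; apply: eq_bigr => i _; rewrite mxE.
apply: continuous_compact => //; apply: continuous_subspaceT => v P.
move=> /nbhs_ballP [e /= e0 H]; apply/nbhs_ballP; exists e => // w [_ vw].
by apply: H; split=> // i j; rewrite !mxE.
Qed.

(** The compactness argument is applied with the distance to M as an additional
    parameter that tends to 0 from above, so that finitely many bounds m < M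
    are replaced by one. *)
Lemma compact_uniform_gap (K : realType) (X : topologicalType) (T : Type)
    (F : set_system T) (FF : Filter F) (A : set X) (f : T -> X -> K) (M : K) :
  compact A ->
  (forall x, A x -> exists2 m, m < M &
     \forall x' \near x & t \near F, A x' -> f t x' <= m) ->
  exists2 m, m < M & \forall t \near F, forall x, A x -> f t x <= m.
Proof.
move=> /compact_near_coveringP/near_covering_withinP cA H.
have := cA _ (filter_prod F (0:K)^'+) (fun p x => f p.1 x <= M - p.2) _.
have cov x : A x -> \forall x' \near x & p \near filter_prod F (0:K)^'+,
    A x' -> f p.1 x' <= M - p.2.
  move=> Ax; have [m mM [[U V] /= [Ux FV] UV]] := H x Ax.
  exists (U, V `*` [set e | 0 < e < M - m]).
    split=> //=; exists (V, [set e | 0 < e < M - m]) => //; split=> //=.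
    have N1 : \forall e \near (0:K)^'+, 0 < e by exact: nbhs_right_gt.
    have N2 : \forall e \near (0:K)^'+, e < M - m.
      by apply: nbhs_right_lt; rewrite subr_gt0.
    by apply: filterS2 N1 N2 => e /= -> ->.
  move=> [x' [t e]] /= [Ux' [Vt /andP [e0 e1]]] Ax'.
  by have := UV (x', t) (conj Ux' Vt) Ax'; rewrite /=; lra.
move=> /(_ _ cov) [[U V] /= [FU V0] UV].
have [e [Ve e0]] : exists e, V e /\ 0 < e.
  have := @filter_ex _ (0:K)^'+ _ (V `&` [set e | 0 < e]).
  by apply; apply: filterI => //; exact: nbhs_right_gt.
exists (M - e); first by lra.
apply: filterS FU => t Ut x Ax.
by have := UV (t, e) (conj Ut Ve) x Ax.
Qed.

(** The extreme value theorem for upper semicontinuous functions. *)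
Lemma compact_usc_max (K : realType) (X : topologicalType) (A : set X) (f : X -> K) :
  compact A -> A !=set0 ->
  (forall x m, A x -> f x < m -> \forall y \near x, A y -> f y <= m) ->
  exists2 x, A x & forall y, A y -> f y <= f x.
Proof.
move=> cA [a Aa] usc.
have [M HM] : exists M, forall x, A x -> f x <= M.
  move/compact_near_coveringP/near_covering_withinP: (cA) => cov.
  have := cov K (+oo%R) (fun M x => f x <= M) _ _.
  have cov' x : A x -> \forall x' \near x & M \near +oo%R, A x' -> f x' <= M.
    move=> Ax; have fx1 : f x < f x + 1 by rewrite ltrDl.
    exists ([set y | A y -> f y <= f x + 1], [set M | f x + 1 <= M]).
      by split=> /=; [exact: usc | apply: nbhs_pinfty_ge; exact: num_real].
    by move=> [y M] /= [H1 H2] Ay; apply: le_trans (H1 Ay) H2.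
  by move=> /(_ _ cov') /filter_ex [M HM]; exists M.
apply: contrapT => nomax.
pose s := sup (f @` A).
have hs : has_sup (f @` A).
  by split; [exists (f a), a | exists M => _ [x Ax <-]; exact: HM].
have lts x : A x -> f x < s.
  move=> Ax; rewrite lt_neqAle ub_le_sup ?andbT; [|by case: hs|by exists x].
  apply/eqP => fxs; apply: nomax; exists x => // y Ay; rewrite fxs.
  by apply: ub_le_sup; [case: hs|exists y].
have gap x : A x -> exists2 m, m < s &
    \forall x' \near x & t \near (0 : K), A x' -> f x' <= m.
  move=> Ax; exists ((f x + s) / 2); first by have := lts x Ax; lra.
  exists ([set y | A y -> f y <= (f x + s) / 2], setT).
    split=> /=; last exact: filterT.
    apply: usc => //; have := lts x Ax; lra.
  by move=> [y t] /= [H _].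
have [m ms] := @compact_uniform_gap K X K (nbhs 0) _ A (fun _ => f) s cA gap.
move=> /filter_ex [_ Hm].
have : s <= m by apply: ge_sup; [exists (f a), a | move=> _ [x Ax <-]; exact: Hm].
by rewrite leNgt ms.
Qed.

Section Growth.
Context (K : realType) (q : nat) (R : 'M[K]_q) (r : 'cV[K]_q).
Hypothesis R_sym : R^T = R.
Hypothesis R_ge0 : forall i j, 0 <= R i j.
Hypothesis R_neq0 : R != 0.

Lemma growth_cvg (c0 : K) (x0 : 'cV[K]_q) : (forall i, 0 <= x0 i 0) -> 0 < qform R x0 ->
  growth R r p.1 p.2 @[p --> nbhs (c0, x0)] --> growth R r c0 x0.
Proof.
move=> x00 Q0; have Hx := @mx_cvg_snd K _ c0 _ x0.
have HQ := @qform_cvg K q R _ _ (nbhs_filter _) _ _ Hx.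
apply: cvgM.
  apply: (@cvg_comp _ _ _ _ (@expR K) _ (nbhs (- entropy r x0))).
    by apply: cvgN; exact: (@entropy_cvg K q r _ _ (nbhs_filter _) _ _ x00 Hx).
  exact: continuous_expR.
have N : \forall p \near (c0, x0), 0 < qform R p.2 by exact: cvgr_gt _ HQ _ Q0.
have E : {near nbhs (c0, x0), (fun p => expR (p.1 * ln (qform R p.2))) =1
    (fun p => qform R p.2 `^ p.1)}.
  by apply: filterS N => p Qp; rewrite /powR gt_eqF.
apply: (cvg_trans (near_eq_cvg E)).
rewrite /powR gt_eqF //.
apply: (@cvg_comp _ _ _ _ (@expR K) _ (nbhs (c0 * ln (qform R x0)))).
  apply: cvgM; first exact: cvg_fst.
  apply: (@cvg_comp _ _ _ _ (@ln K) _ (nbhs (qform R x0))) => //.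
  exact: continuous_ln.
exact: continuous_expR.
Qed.

(** Where x^T R x and c both vanish the growth rate is not continuous, but it
    is upper semicontinuous: nearby values of (x^T R x)^c are at most 1. Where
    x^T R x vanishes and c does not, they tend to 0. *)
Lemma growth_usc (c0 : K) (x0 : 'cV[K]_q) (m : K) : 0 <= c0 -> simplex x0 ->
  growth R r c0 x0 < m ->
  \forall p \near (c0, x0), 0 <= p.1 -> simplex p.2 -> growth R r p.1 p.2 <= m.
Proof.
move=> c00 [x00 sx0] gm.
have Hx := @mx_cvg_snd K _ c0 _ x0.
have Hc : p.1 @[p --> nbhs (c0, x0)] --> c0 by exact: cvg_fst.
have He := @entropy_cvg K q r _ _ (nbhs_filter _) _ _ x00 Hx.
have HQ := @qform_cvg K q R _ _ (nbhs_filter _) _ _ Hx.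
have Hexp : expR (- entropy r p.2) @[p --> nbhs (c0, x0)] --> expR (- entropy r x0).
  apply: (@cvg_comp _ _ _ _ (@expR K) _ (nbhs (- entropy r x0))); first exact: cvgN.
  exact: continuous_expR.
have Q0 := qform_ge0 R_ge0 x00; rewrite le_eqVlt in Q0.
case/predU1P: Q0 => [Q0|Q0].
  rewrite le_eqVlt in c00; case/predU1P: c00 => [c00|c00].
    have gE : growth R r c0 x0 = expR (- entropy r x0).
      by rewrite /growth -c00 powRr0 mulr1.
    rewrite gE in gm.
    have N1 : \forall p \near (c0, x0), expR (- entropy r p.2) <= m.
      exact: cvgr_le _ Hexp _ gm.
    have N2 : \forall p \near (c0, x0), qform R p.2 <= 1.
      by apply: (cvgr_le _ HQ); rewrite -Q0.
    apply: filterS2 N1 N2 => p H1 H2 p1 [p20 _].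
    have Qp := qform_ge0 R_ge0 p20.
    apply: le_trans H1; rewrite /growth ger_pMr ?expR_gt0 //.
    have one_pow : 1 `^ p.1 = 1 :> K by rewrite powR1.
    rewrite -[leRHS]one_pow; apply: ge0_ler_powR; rewrite ?nnegrE //.
  have gE : growth R r c0 x0 = 0.
    by rewrite /growth -Q0 /powR eqxx gt_eqF ?mulr0.
  rewrite gE in gm; set A := expR (- entropy r x0) + 1.
  have A0 : 0 < A by rewrite addr_gt0 // expR_gt0.
  set s := expR (2 * ln (m / A) / c0).
  have N1 : \forall p \near (c0, x0), expR (- entropy r p.2) <= A.
    by apply: (cvgr_le _ Hexp); rewrite ltrDl.
  have N2 : \forall p \near (c0, x0), qform R p.2 <= Num.min 1 s.
    by apply: (cvgr_le _ HQ); rewrite -Q0 lt_min ltr01 expR_gt0.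
  have N3 : \forall p \near (c0, x0), c0 / 2 <= p.1.
    by apply: (cvgr_ge _ Hc); lra.
  apply: filterS3 N1 N2 N3 => p H1 H2 H3 p1 [p20 _].
  have Qp := qform_ge0 R_ge0 p20.
  have mA : 0 < m / A by rewrite divr_gt0.
  have -> : m = A * (m / A) by rewrite mulrCA divff ?mulr1 // gt_eqF.
  apply: ler_pM; rewrite ?expR_ge0 ?powR_ge0 //.
  rewrite /powR; case: eqVneq => [_|Qn].
    by rewrite gt_eqF ?ltW //; lra.
  have {}Qp : 0 < qform R p.2 by rewrite lt_neqAle eq_sym Qn.
  move: H2; rewrite le_min => /andP [Q1 Qs].
  have lQ0 : ln (qform R p.2) <= 0 by rewrite ln_le0.
  have lQs : ln (qform R p.2) <= 2 * ln (m / A) / c0.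
    by rewrite -[leRHS]expRK ler_ln ?posrE ?expR_gt0.
  rewrite -[leRHS]lnK ?posrE // ler_expR.
  apply: le_trans (_ : (c0 / 2) * ln (qform R p.2) <= _).
    by rewrite ler_wnM2r.
  have := ler_wpM2l (_ : 0 <= c0 / 2) lQs.
  have -> : c0 / 2 * (2 * ln (m / A) / c0) = ln (m / A) by field; rewrite gt_eqF.
  by apply; rewrite divr_ge0 // ltW.
have N : \forall p \near (c0, x0), growth R r p.1 p.2 <= m.
  have Hg := @growth_cvg c0 x0 x00 Q0.
  exact: (cvgr_le _ Hg _ gm).
by apply: filterS N => p ? _ _.
Qed.

(** The derivative of the entropy at the boundary is infinite, so moving a
    little towards the centre of the simplex increases the growth rate. *)
Lemma growth_max_interior (c : K) (x : 'cV[K]_q) : 0 <= c -> simplex x ->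
  (forall y, simplex y -> growth R r c y <= growth R r c x) ->
  forall i, 0 < x i 0.
Proof.
move=> c0 [x0 sx] xmax i0; rewrite lt_neqAle x0 andbT; apply/eqP => xi0.
have q0 : (0 < q)%N by apply: leq_ltn_trans (ltn_ord i0).
set u : K := q%:R^-1; have u0 : 0 < u by rewrite invr_gt0 ltr0n.
pose U : 'cV[K]_q := const_mx u.
have sU : \sum_i U i 0 = 1.
  rewrite (eq_bigr (fun=> u)) => [|i _]; last by rewrite mxE.
  by rewrite sumr_const card_ord -mulr_natl divff // pnatr_eq0 -lt0n.
have U_gt0 i : 0 < U i 0 by rewrite mxE.
have gU : 0 < growth R r c U.
  by rewrite /growth mulr_gt0 ?expR_gt0 // powR_gt0 // qform_gt0.
have gx : 0 < growth R r c x.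
  by apply: lt_le_trans gU _; apply: xmax; split=> // i; exact: ltW.
(* a move of relative size t towards U gains u t |ln t| in entropy and loses at
   most a multiple of t elsewhere *)
set A := entropy r U - entropy r x + 4 * c.
set t := Num.min (1 / 2) (expR (- (`|A| + 1) / u)).
have t0 : 0 < t by rewrite lt_min divr_gt0 // expR_gt0.
have t12 : t <= 1 / 2 by rewrite ge_min lexx.
have lnt : ln t * u <= - (`|A| + 1).
  rewrite -ler_pdivlMr // -[leRHS]expRK ler_ln ?posrE ?expR_gt0 //.
  by rewrite ge_min lexx orbT.
pose y : 'cV[K]_q := (1 - t) *: x + t *: U.
have yE i : y i 0 = (1 - t) * x i 0 + t * u by rewrite !mxE.
have t1 : 0 < 1 - t by lra.
have y_gt0 i : 0 < y i 0.
  by rewrite yE ltr_wpDl ?mulr_gt0 // mulr_ge0 // ltW.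
have sy : \sum_i y i 0 = 1.
  rewrite (eq_bigr (fun i => (1 - t) * x i 0 + t * U i 0)) => [|i _]; last first.
    by rewrite yE mxE.
  by rewrite big_split /= -!mulr_sumr sx sU; ring.
have Hent : entropy r y <= (1 - t) * entropy r x + t * entropy r U + t * (u * ln t).
  rewrite /entropy !mulr_sumr -big_split /= (bigD1 i0) //= [X in _ <= X + _](bigD1 i0) //=.
  rewrite addrAC; apply: lerD.
    rewrite yE -xi0 mulr0 add0r mul0r mulr0 add0r mxE lnM ?posrE //; lra.
  apply: ler_sum => i _; rewrite yE mxE.
  have := x0 i; rewrite le_eqVlt => /predU1P [<-|xi].
    rewrite mulr0 add0r mul0r mulr0 add0r -mulrA ler_pM2l // ler_pM2l //.
    rewrite lerD2r ler_ln ?posrE ?mulr_gt0 // ger_pMl //; lra.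
  have := y_gt0 i; rewrite yE; set z := (1 - t) * x i 0 + t * u => z0.
  have lnz w : 0 < w -> w * ln z <= w * ln w + (z - w).
    move=> w0; have : ln (1 + (z / w - 1)) <= z / w - 1.
      by apply: le_ln1Dx; have := divr_gt0 z0 w0; lra.
    rewrite addrC subrK ln_div ?posrE // => H.
    have := ler_wpM2l (ltW w0) H; rewrite !mulrBr mulr1 mulrCA divff ?gt_eqF //; lra.
  have H1 := ler_wpM2l (ltW t1) (lnz _ xi); have H2 := ler_wpM2l (ltW t0) (lnz _ u0).
  rewrite /z in H1 H2 *; lra.
have Hpow : expR (- (4 * c * t)) * qform R x `^ c <= qform R y `^ c.
  move: c0; rewrite le_eqVlt => /predU1P [<-|cpos].
    by rewrite !powRr0 mulr0 mul0r oppr0 expR0 mulr1.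
  have Qx : 0 < qform R x.
    rewrite lt_neqAle eq_sym qform_ge0 // andbT; apply/eqP => Q0.
    by move: gx; rewrite /growth Q0 /powR eqxx (gt_eqF cpos) mulr0 ltxx.
  have QyQx : (1 - t) ^+ 2 * qform R x <= qform R y.
    rewrite !qformE mulr_sumr; apply: ler_sum => i _.
    set s := \sum_j x j 0 * R i j.
    have -> : (1 - t) ^+ 2 * (x i 0 * s) = ((1 - t) * x i 0) * ((1 - t) * s) by ring.
    apply: ler_pM.
    + by rewrite mulr_ge0 // ltW.
    + by rewrite mulr_ge0 ?(ltW t1) // sumr_ge0 // => j _; rewrite mulr_ge0.
    + by rewrite yE lerDl mulr_ge0 // ltW.
    rewrite mulr_sumr; apply: ler_sum => j _; rewrite mulrA ler_wpM2r //.
    by rewrite yE lerDl mulr_ge0 // ltW.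
  have Qy : 0 < qform R y.
    by apply: lt_le_trans QyQx; rewrite mulr_gt0 // exprn_gt0.
  rewrite /powR !gt_eqF // -expRD ler_expR.
  have : ln ((1 - t) ^+ 2 * qform R x) <= ln (qform R y).
    by rewrite ler_ln ?posrE ?mulr_gt0 ?exprn_gt0.
  rewrite lnM ?posrE ?exprn_gt0 // lnXn // -mulr_natl.
  have : - (2 * t) <= ln (1 - t).
    rewrite -[ln _]opprK lerN2 -lnV ?posrE //.
    have : ln (1 + ((1 - t)^-1 - 1)) <= (1 - t)^-1 - 1.
      by apply: le_ln1Dx; have : 0 < (1 - t)^-1; [rewrite invr_gt0|lra].
    rewrite [1 + _]addrC subrK => H; apply: le_trans H _.
    have : (1 - t)^-1 <= 1 + 2 * t.
      rewrite -[leLHS]mul1r ler_pdivrMr //; have := mulr_ge0 (ltW t0) (_ : 0 <= 1 - 2 * t); lra.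
    lra.
  move=> H1 H2; have := ler_wpM2l (ltW cpos) H1; have := ler_wpM2l (ltW cpos) H2; lra.
have := xmax y (conj (fun i => ltW (y_gt0 i)) sy).
rewrite leNgt => /negP; apply; rewrite /growth.
apply: lt_le_trans (_ : expR (- entropy r y) * (expR (- (4 * c * t)) * qform R x `^ c) <= _);
  last by rewrite ler_wpM2l ?expR_ge0.
rewrite mulrA -expRD ltr_pM2r; last first.
  by move: gx; rewrite /growth pmulr_rgt0 ?expR_gt0.
rewrite ltr_expR.
have HA := ler_norm A.
have : 0 < t * (- (u * ln t) - A).
  by rewrite mulr_gt0 //; lra.
rewrite /A; lra.
Qed.

End Growth.

Section GrowthMax.
Context (K : realType) (d : nat) (R : 'M[K]_(1 + d)) (r : 'cV[K]_(1 + d)).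
Hypothesis R_sym : R^T = R.
Hypothesis R_ge0 : forall i j, 0 <= R i j.
Hypothesis R_neq0 : R != 0.

Let S := std_directions K d.
Let crit c : set 'cV[K]_(1 + d) := @critical_minima K (1 + d) R r S c.

(** So the dominant points of the simplex are critical minima. *)
Lemma growth_max_crit (c : K) x : 0 <= c -> simplex x ->
  (forall y, simplex y -> growth R r c y <= growth R r c x) -> crit c x.
Proof.
move=> c0 xS xmax.
have x_gt0 := growth_max_interior R_ge0 R_neq0 c0 xS xmax.
have xI : simplex_interior x by case: xS.
have xmin : local_minimum_Phi R r c x.
  have := @near_pos K d _ c x x_gt0 => -[[A B] /= [Ac Bx] AB].
  apply: filterS Bx => y By yS; have y_gt0 : forall i, 0 < y i 0.
    by apply: (AB (c, y)); split=> //=; exact: nbhs_singleton.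
  have := xmax y yS; rewrite !growth_Phi ?qform_gt0 //.
  by rewrite ler_expR lerN2.
have [g0 _] := local_minimum_conditions R_sym R_ge0 R_neq0 xI xmin.
by split.
Qed.

Lemma growth_usc_fixed (c : K) x m : 0 <= c -> simplex x -> growth R r c x < m ->
  \forall y \near x, simplex y -> growth R r c y <= m.
Proof.
move=> c0 xS gm.
have [[A B] /= [Ac Bx] AB] := growth_usc R_ge0 c0 xS gm.
apply: filterS Bx => y By yS; apply: (AB (c, y)) => //; split=> //=.
exact: nbhs_singleton.
Qed.

Lemma growth_has_max (c : K) : 0 <= c ->
  exists2 x, simplex x & forall y, simplex y -> growth R r c y <= growth R r c x.
Proof.
move=> c0; apply: compact_usc_max (@compact_simplex K _) _ _.
  set u : K := (1 + d)%:R^-1; exists (const_mx u).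
  split=> [i|]; first by rewrite mxE invr_ge0.
  rewrite (eq_bigr (fun=> u)) => [|i _]; last by rewrite mxE.
  by rewrite sumr_const card_ord -mulr_natl divff.
by move=> x m; exact: growth_usc_fixed.
Qed.

(** At a critical point the coordinates are r_i exp (lambda + 2 c (R x)_i /
    x^T R x) with a multiplier lambda that is bounded below. Hence critical
    points keep away from the boundary while c stays bounded. *)
Lemma crit_coord_lower (C : K) : (forall i, 0 < r i 0) ->
  exists2 dl, 0 < dl & forall c x, 0 <= c <= C -> simplex_interior x ->
    @grad_Phi K (1 + d) R r S c x = 0 -> forall i, dl <= x i 0.
Proof.
move=> r0.
set L := (1 + d)%:R + \sum_i `|ln (r i 0)|.
pose e i := expR (ln (r i 0) - L - 2 * C).
exists (\big[Num.min/1]_i e i).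
  by elim/big_ind: _ => // [a b a0 b0|i _]; rewrite ?lt_min ?a0 //; exact: expR_gt0.
move=> c x /andP [c0 cC] [x0 sx] g0 i.
have [m_le _] : (\big[Num.min/1]_i e i <= e i) /\ True.
  by split=> //; rewrite (bigD1 i) //= ge_min lexx.
apply: le_trans m_le _; rewrite /e -[leRHS]lnK ?posrE // ler_expR.
pose v : 'cV[K]_(1 + d) := delta_mx i 0 - x.
have vE k : v k 0 = (k == i)%:R - x k 0 by rewrite !mxE eqxx andbT.
have sv : (const_mx 1 : 'rV[K]_(1 + d)) *m v = 0.
  apply/matrixP => a b; rewrite !mxE (ord1 b).
  rewrite (eq_bigr (fun k => (k == i)%:R - x k 0)) => [|k _]; last first.
    by rewrite vE mxE mul1r.
  rewrite sumrB sx (bigD1 i) //= eqxx big1 ?addr0 ?subrr // => k /negbTE -> //.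
have := @grad_PhiE K d R r c x (dsubmx v)^T.
rewrite -/S g0 mul0mx mxE trmxK -ones_mulmx_eq0 // full_grad_formE.
have -> : \sum_k v k 0 * (ln (x k 0) - ln (r k 0)) =
    ln (x i 0) - ln (r i 0) - entropy r x.
  rewrite /entropy (eq_bigr (fun k => (k == i)%:R * (ln (x k 0) - ln (r k 0)) -
    x k 0 * (ln (x k 0) - ln (r k 0)))) => [|k _]; last by rewrite vE mulrBl.
  rewrite sumrB (bigD1 i) //= eqxx mul1r big1 ?addr0 // => k /negbTE ->.
  by rewrite mul0r.
have Q0 : 0 < qform R x by exact: qform_gt0.
have -> : bform R x v = bform R x (delta_mx i 0) - qform R x.
  have subE (M N : 'M[K]_1) : (M - N) 0 0 = M 0 0 - N 0 0 by rewrite !mxE.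
  by rewrite /bform /v mulmxBr subE.
have b0 : 0 <= bform R x (delta_mx i 0).
  rewrite /bform mxE sumr_ge0 // => k _; rewrite mulr_ge0 //; last by rewrite mxE ler0n.
  by rewrite mxE sumr_ge0 // => j _; rewrite mulr_ge0 // mxE ltW.
set b := bform _ _ _ in b0 *; set Q := qform R x in Q0 *.
have bQ : 0 <= 2 * c / Q * b by rewrite !mulr_ge0 ?invr_ge0 // ltW.
have QQ : 2 * c / Q * Q = 2 * c by rewrite divfK // gt_eqF.
have : - L <= entropy r x.
  rewrite /L /entropy opprD -sumrN.
  have -> : - (1 + d)%:R = \sum_(k < 1 + d) (-1) :> K.
    by rewrite sumr_const card_ord mulNrn.
  rewrite -big_split /=; apply: ler_sum => k _.
  have xk1 : x k 0 <= 1.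
    by rewrite -sx (bigD1 k) //= lerDl sumr_ge0 // => j _; exact: ltW.
  have l1 : x k 0 - 1 <= x k 0 * ln (x k 0).
    have : ln (1 + ((x k 0)^-1 - 1)) <= (x k 0)^-1 - 1.
      by apply: le_ln1Dx; have := x0 k; rewrite -invr_gt0; lra.
    rewrite addrC subrK lnV ?posrE // => H.
    have := ler_wpM2l (ltW (x0 k)) H; rewrite mulrBr divff ?gt_eqF //; lra.
  have l2 : x k 0 * ln (r k 0) <= `|ln (r k 0)|.
    apply: le_trans (_ : x k 0 * `|ln (r k 0)| <= _).
      by rewrite ler_wpM2l ?(ltW (x0 k)) // ler_norm.
    by rewrite ler_piMl.
  have := x0 k; rewrite mulrBr; lra.
rewrite mulrBr QQ; lra.
Qed.

End GrowthMax.

(** * Critical minima under perturbation of c *)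

Section CriticalMinima.
Context (K : realType) (d : nat) (R : 'M[K]_(1 + d)) (r : 'cV[K]_(1 + d)).
Hypothesis R_sym : R^T = R.
Hypothesis R_ge0 : forall i j, 0 <= R i j.
Hypothesis R_neq0 : R != 0.
Hypothesis r_gt0 : forall i, 0 < r i 0.

Let S := std_directions K d.
Let hess c x : 'M[K]_d := @hess_Phi K (1 + d) R S c x.
Let grad c x : 'rV[K]_d := @grad_Phi K (1 + d) R r S c x.
Let crit c : set 'cV[K]_(1 + d) := @critical_minima K (1 + d) R r S c.

Variable c0 : K.
Hypothesis c0_ge0 : 0 <= c0.
Hypothesis nondeg : forall x, simplex_interior x -> \det (hess c0 x) != 0.

(** The second order condition leaves out only a degenerate Hessian. *)
Lemma crit_posdef phi : crit c0 phi -> posdef (hess c0 phi).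
Proof.
move=> [phiI g0 phimin].
have [_ H] := local_minimum_conditions R_sym R_ge0 R_neq0 phiI phimin.
apply: possemidef_posdef => //; first exact: hess_Phi_sym.
exact: nondeg.
Qed.

Lemma posdef_local_minimum x : simplex_interior x -> grad c0 x = 0 ->
  posdef (hess c0 x) -> local_minimum_Phi R r c0 x.
Proof.
move=> [x0 sx] g0 Hp.
have [rho rho0 H] := local_quadratic r R_sym R_ge0 R_neq0 x0 Hp ltr01.
apply/nbhs_box; exists rho => // y byx [y0 sy].
have c0c0 : `|c0 - c0| < rho by rewrite subrr normr0.
have [B HB ->] := H c0 x y c0c0 (box_refl x rho0) byx sx sy.
rewrite -/S -/(grad _ _) g0 mul0mx mxE addr0 lerDl divr_ge0 //.
apply: log_close_ge0 HB _; have [mu mu0 Hmu] := posdef_lower (hess_Phi_sym _ _ R_sym) Hp.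
by apply: le_trans (Hmu _); rewrite mulr_ge0 ?sqr_ge0 // ltW.
Qed.

(** Two critical minima close to the same nondegenerate minimum coincide, as
    Phi is strictly convex there. *)
Lemma crit_unique phi : crit c0 phi -> exists2 rho, 0 < rho &
  forall c x y, `|c - c0| < rho -> box phi rho x -> box phi rho y ->
    crit c x -> crit c y -> x = y.
Proof.
move=> phic; have Hp := crit_posdef phic; have [[phi0 _] _ _] := phic.
have [rho rho0 H] := local_quadratic r R_sym R_ge0 R_neq0 phi0 Hp ltr01.
exists rho => // c x y cc bx by_ [[x0 sx] gx _] [[y0 sy] gy _].
have [B HB E1] := H c x y cc bx by_ sx sy.
have [B' HB' E2] := H c y x cc by_ bx sy sx.
move: E1 E2; rewrite gx gy !mul0mx !mxE !addr0 => E1 E2.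
rewrite (simplex_diff sx sy); set u := tail y - tail x in HB *.
have [->|u0] := eqVneq u 0; first by rewrite trmx0 mulmx0 addr0.
have B_gt0 : 0 < B by apply: log_close_gt0 HB _; exact: Hp.
have : 0 < B'.
  by apply: log_close_gt0 HB' _; apply: Hp; rewrite -opprB oppr_eq0.
by move=> B'0; exfalso; lra.
Qed.

Lemma grad_continuous (x0 : 'cV[K]_(1 + d)) : (forall i, 0 < x0 i 0) ->
  mx_cvg (nbhs (c0, x0)) (fun p => grad p.1 p.2) (grad c0 x0).
Proof.
move=> x00; rewrite /grad /grad_Phi; apply: mx_cvgM; last exact: mx_cvg_cst.
have Hx := @mx_cvg_snd K _ c0 _ x0.
have HQ := @qform_cvg K _ R _ _ (nbhs_filter _) _ _ Hx.
apply: mx_cvgD.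
  apply: mx_cvgD; last exact: mx_cvg_cst.
  apply: mx_cvg_tr => i j; rewrite mxE; under eq_cvg => t do rewrite mxE.
  apply: (@cvg_comp _ _ _ _ (@ln K) _ (nbhs (x0 i j))); first exact: Hx.
  by rewrite (ord1 j); exact: continuous_ln.
apply: mx_cvgN; apply: mx_cvgZ.
  apply: cvgM; first by apply: cvgM; [exact: cvg_cst | exact: cvg_fst].
  by apply: cvgV => //; rewrite gt_eqF // qform_gt0.
by apply: mx_cvgM; [exact: mx_cvg_tr | exact: mx_cvg_cst].
Qed.

Lemma near_prod_swap (X Y : topologicalType) (x : X) (y : Y) (P : X * Y -> Prop) :
  (\forall p \near (x, y), P p) -> \forall y' \near y & x' \near x, P (x', y').
Proof.
move=> [[A B] /= [Ax By] AB]; exists (B, A) => // -[y' x'] [/= By' Ax'].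
exact: (AB (x', y')).
Qed.

(** A point fails to be a critical minimum because a coordinate or the gradient
    rules it out, or because the Hessian takes a negative value. Each of these
    obstructions persists for nearby points and nearby c. *)
Lemma not_crit_near x0 : simplex x0 -> ~ crit c0 x0 ->
  \forall x \near x0 & c \near c0, 0 <= c -> ~ crit c x.
Proof.
move=> [x00 sx0] ncrit.
have Hx := @mx_cvg_snd K _ c0 _ x0.
have [[i xi0]|x0_gt0] := pselect (exists i, x0 i 0 = 0).
  have [dl dl0 H] := crit_coord_lower R_ge0 R_neq0 (c0 + 1) r_gt0.
  have N1 : \forall p \near (c0, x0), (p.2 : 'cV[K]_(1 + d)) i 0 < dl.
    by apply: (cvgr_lt _ (Hx i 0)); rewrite xi0.
  have N2 : \forall p \near (c0, x0), p.1 <= c0 + 1.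
    by apply: (cvgr_le _ (@cvg_fst _ _ (nbhs c0) (nbhs x0) _)); rewrite ltrDl.
  apply: (@near_prod_swap _ _ c0 x0 (fun p => 0 <= p.1 -> ~ crit p.1 p.2)).
  apply: filterS2 N1 N2 => p p2 p1 p10 [pI pg _].
  have p01 : 0 <= p.1 <= c0 + 1 by rewrite p10.
  by have := H p.1 p.2 p01 pI pg i; rewrite leNgt p2.
have {}x0_gt0 i : 0 < x0 i 0.
  by rewrite lt_neqAle x00 andbT; apply/eqP => xi; apply: x0_gt0; exists i.
have x0I : simplex_interior x0 by [].
have [g0|gn0] := eqVneq (grad c0 x0) 0; last first.
  have [j gj] : exists j, grad c0 x0 0 j != 0.
    apply: contrapT => H; move/eqP: gn0; apply; apply/matrixP => i j.
    rewrite (ord1 i) [RHS]mxE; apply/eqP/negP => /negP gj; apply: H.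
    by exists j.
  have N : \forall p \near (c0, x0), grad p.1 p.2 0 j != 0.
    exact: cvgr_neq0 _ (@grad_continuous x0 x0_gt0 0 j) gj.
  apply: (@near_prod_swap _ _ c0 x0 (fun p => 0 <= p.1 -> ~ crit p.1 p.2)).
  apply: filterS N => p pj _ [_ pg _]; move: pj.
  by rewrite /grad pg mxE eqxx.
have [u Hu] : exists u, bilin (hess c0 x0) u < 0.
  apply: contrapT => H; apply: ncrit; split=> //.
  apply: posdef_local_minimum => //.
  apply: possemidef_posdef; [exact: hess_Phi_sym | exact: nondeg|move=> u].
  by rewrite leNgt; apply/negP => Hu; apply: H; exists u.
have Hb : bilin (hess p.1 p.2) u @[p --> nbhs (c0, x0)] --> bilin (hess c0 x0) u.
  have H : mx_cvg (nbhs (c0, x0)) (fun p => u *m hess p.1 p.2 *m u^T)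
      (u *m hess c0 x0 *m u^T).
    apply: mx_cvgM; last exact: mx_cvg_cst.
    by apply: mx_cvgM; [exact: mx_cvg_cst | exact: hess_continuous].
  exact: H.
have N : \forall p \near (c0, x0), bilin (hess p.1 p.2) u < 0 by exact: cvgr_lt _ Hb _ Hu.
apply: (@near_prod_swap _ _ c0 x0 (fun p => 0 <= p.1 -> ~ crit p.1 p.2)).
apply: filterS N => p pu _ [pI _ pmin].
have [_ H] := local_minimum_conditions R_sym R_ge0 R_neq0 pI pmin.
by have := H u; rewrite leNgt -/S -/(hess _ _) pu.
Qed.

Lemma crit_simplex c x : crit c x -> simplex x.
Proof. by move=> [[x0 sx] _ _]; split=> // i; exact: ltW. Qed.

Lemma near_box (x0 phi : 'cV[K]_(1 + d)) (rho : K) : box phi rho x0 ->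
  \forall x \near x0, box phi rho x.
Proof.
move=> /forallP H.
have N : \forall p \near ((0 : K), x0), forall i, `|(p.2 : 'cV[K]_(1 + d)) i 0 - phi i 0| < rho.
  apply: (@near_forall_ord _ (nbhs ((0 : K), x0)) _ _
    (fun i p => `|(p.2 : 'cV[K]_(1 + d)) i 0 - phi i 0| < rho)) => i.
  have Hi : `|(p.2 : 'cV[K]_(1 + d)) i 0 - phi i 0| @[p --> nbhs ((0 : K), x0)] -->
      `|x0 i 0 - phi i 0|.
    by apply: cvg_norm; apply: cvgB; [exact: mx_cvg_snd | exact: cvg_cst].
  exact: cvgr_lt _ Hi _ (H i).
case: N => -[A B] /= [A0 Bx] AB; apply: filterS Bx => x Bx.
by apply/forallP => i; apply: (AB (0, x)); split=> //=; exact: nbhs_singleton.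
Qed.

(** Critical minima can only appear near existing ones, by compactness. *)
Lemma crit_near_crit (rho : K) : 0 < rho ->
  \forall c \near c0, 0 <= c -> forall x, crit c x -> exists2 phi, crit c0 phi & box phi rho x.
Proof.
move=> rho0.
have /compact_near_coveringP/near_covering_withinP cov := @compact_simplex K (1 + d).
have := cov K (nbhs c0) (fun c x => 0 <= c -> crit c x ->
  exists2 phi, crit c0 phi & box phi rho x) _.
move=> /(_ _) H.
have H' : forall x, simplex x -> \forall x' \near x & c \near c0, simplex x' -> 0 <= c ->
    crit c x' -> exists2 phi, crit c0 phi & box phi rho x'.
  move=> x xS; have [xc|xc] := pselect (crit c0 x).
    exists (([set y | box x rho y] : set _), setT); first by split=> /=; [exact/near_box/box_refl | exact: filterT].
    by move=> [x' c] [/= bx _] _ _ _; exists x.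
  have [[A B] /= [Ax Bc] AB] := not_crit_near xS xc.
  exists (A, B) => // -[x' c] /= Hxc _ c_ge0 xc'.
  by have := AB (x', c) Hxc c_ge0 xc'.
apply: filterS (H H') => c Hc c_ge0 x xc; apply: Hc => //.
exact: crit_simplex xc.
Qed.

(** A cluster point of infinitely many critical minima would be neither a
    critical minimum, since these are isolated, nor any other point. *)
Lemma crit_finite : finite_set (crit c0).
Proof.
apply: contrapT => /infiniteP/pcard_leP/unsquash u.
have uc n : crit c0 (u n) by exact: funS.
have u_inj : injective u by move=> m n E; apply: (@inj _ _ _ u); rewrite ?inE.
have uS : (u @ \oo) (@simplex K (1 + d)).
  by exists 0%N => // n _; apply: crit_simplex (uc n).
have [p [pS pcl]] := @compact_simplex K (1 + d) (u @ \oo) _ uS.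
have [U Up HU] : exists2 U, nbhs p U & forall x y, U x -> U y -> crit c0 x -> crit c0 y -> x = y.
  have [pc|pc] := pselect (crit c0 p).
    have [rho rho0 H] := crit_unique pc.
    exists (box p rho); first exact/near_box/box_refl.
    move=> x y bx by_; apply: (H c0) => //.
    by rewrite subrr normr0.
  have [[A B] /= [Ap Bc] AB] := not_crit_near pS pc.
  exists A => // x y Ax _ xc _.
  by have := AB (x, c0) (conj Ax (nbhs_singleton Bc)) c0_ge0 xc.
have hit N : exists2 n, (N <= n)%N & U (u n).
  have := pcl [set u n | n in [set n | (N <= n)%N]] U _ Up.
  case=> [|_ [[n Nn <-] Un]]; last by exists n.
  by exists N => // n Nn; exists n.
have [n1 _ U1] := hit 0%N; have [n2 n12 U2] := hit n1.+1.
have := HU _ _ U1 U2 (uc n1) (uc n2) => /u_inj E.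
by move: n12; rewrite E ltnn.
Qed.

Lemma box_tail_norm1 (phi x : 'cV[K]_(1 + d)) : \sum_i phi i 0 = 1 -> \sum_i x i 0 = 1 ->
  forall i, `|x i 0 - phi i 0| <= norm1 (tail x - tail phi).
Proof.
move=> sp sx i; set u := tail x - tail phi.
have E j : x (rshift 1 j) 0 - phi (rshift 1 j) 0 = u 0 j by rewrite !mxE.
case: (split_ordP i) => j ->; last first.
  by rewrite E /norm1 (bigD1 j) //= lerDl sumr_ge0.
have -> : x (lshift d j) 0 - phi (lshift d j) 0 = - \sum_k u 0 k.
  have := sp; have := sx; rewrite !big_split_ord !big_ord1 /= (ord1 j) => E1 E2.
  rewrite (eq_bigr (fun k => x (rshift 1 k) 0 - phi (rshift 1 k) 0)) => [|k _]; last by rewrite E.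
  rewrite sumrB; move: E1 E2; set a := \sum_k _; set b := \sum_k _; lra.
by rewrite normrN /norm1 ler_norm_sum.
Qed.

(** Every critical minimum persists when c changes: the growth rate has a
    maximum on a small closed box around phi, and this maximum is not attained
    on the boundary of the box, where the quadratic part of Phi outweighs the
    gradient at phi, which is small for c close to c0. *)
Lemma crit_exists phi (rho : K) : crit c0 phi -> 0 < rho ->
  \forall c \near c0, 0 <= c -> exists2 psi, crit c psi & box phi rho psi.
Proof.
move=> phic rho_gt0; have Hp := crit_posdef phic; have [[phi0 sphi] gphi _] := phic.
have [rho1 rho10 H] := local_quadratic r R_sym R_ge0 R_neq0 phi0 Hp ltr01.
have [rho3 rho30 Hpos] := local_hess R_sym R_ge0 R_neq0 phi0 Hp ltr01.
have [mu mu0 Hmu] := posdef_lower (hess_Phi_sym _ _ R_sym) Hp.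
set rho2 := Num.min (Num.min rho rho1) rho3 / 2.
have rho20 : 0 < rho2 by rewrite divr_gt0 // !lt_min rho_gt0 rho10.
have rho2E : 2 * rho2 = Num.min (Num.min rho rho1) rho3 by rewrite mulrC divfK.
have [r2 r21 r23] : [/\ rho2 < rho, rho2 < rho1 & rho2 < rho3].
  have : 2 * rho2 <= rho by rewrite rho2E !ge_min lexx.
  have : 2 * rho2 <= rho1 by rewrite rho2E !ge_min lexx orbT.
  have : 2 * rho2 <= rho3 by rewrite rho2E !ge_min lexx orbT.
  by move=> *; split; lra.
(* a gradient of this size is outweighed by the quadratic part at distance rho2 *)
set eta := expR (-1) * mu * rho2 / 4.
have eta0 : 0 < eta by rewrite divr_gt0 // mulr_gt0 // mulr_gt0 // expR_gt0.
have Ngrad : \forall c \near c0, forall j, `|grad c phi 0 j| <= eta.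
  have N : \forall p \near (c0, phi), forall j, `|grad p.1 p.2 0 j| <= eta.
    apply: (@near_forall_ord _ (nbhs (c0, phi)) _ _ (fun j p => `|grad p.1 p.2 0 j| <= eta)) => j.
    have := @grad_continuous phi phi0 0 j; rewrite {2}/grad gphi mxE => Hc.
    exact: (cvgr0Pnorm_le _).1 Hc _ eta0.
  case: N => -[A B] /= [Ac Bphi] AB; apply: filterS Ac => c Ac.
  by apply: (AB (c, phi)); split=> //=; exact: nbhs_singleton.
have Nc : \forall c \near c0, `|c - c0| < rho1.
  apply/nbhs_ballP; exists rho1 => // c; rewrite /ball /= distrC //.
have Nc3 : \forall c \near c0, `|c - c0| < rho3.
  apply/nbhs_ballP; exists rho3 => // c; rewrite /ball /= distrC //.
apply: filterS3 Ngrad Nc Nc3 => c Hgrad cc cc3 c_ge0.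
pose A := [set x : 'cV[K]_(1 + d) | simplex x /\ forall i, `|x i 0 - phi i 0| <= rho2].
have Abox x : A x -> box phi rho1 x.
  by move=> [_ Hx]; apply/forallP => i; apply: le_lt_trans (Hx i) r21.
have Apos x : A x -> forall i, 0 < x i 0.
  move=> [_ Hx]; have bx : box phi rho3 x.
    by apply/forallP => i; apply: le_lt_trans (Hx i) r23.
  by have [] := Hpos c x cc3 bx.
have cA : compact A.
  pose B := [set x : 'cV[K]_(1 + d) | forall i, `|x i 0 - phi i 0| <= rho2].
  rewrite -[A]/(@simplex K (1 + d) `&` B).
  apply: compact_closedI; first exact: compact_simplex.
  have -> : B =
      \bigcap_(i in [set: 'I_(1 + d)])
        (fun x : 'cV[K]_(1 + d) => `|x i 0 - phi i 0|) @^-1` [set z | z <= rho2].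
    by apply/seteqP; split=> x Hx i; [move=> _; exact: Hx | exact: Hx].
  apply: closed_bigI => i _; apply: closed_comp; last exact: closed_le.
  move=> x _.
  have Hx : `|(y : 'cV[K]_(1 + d)) i 0 - phi i 0| @[y --> nbhs x] --> `|x i 0 - phi i 0|.
    by apply: cvg_norm; apply: cvgB; [exact: coord_continuous | exact: cvg_cst].
  exact: Hx.
have Aphi : A phi.
  split=> [|i]; first exact: crit_simplex phic.
  by rewrite subrr normr0 ltW.
have usc x m : A x -> growth R r c x < m -> \forall y \near x, A y -> growth R r c y <= m.
  move=> [xS _] gm.
  have N : \forall y \near x, simplex y -> growth R r c y <= m.
    exact: (growth_usc_fixed R_ge0 c_ge0 xS gm).
  by apply: filterS N => y Hy [yS _]; exact: Hy.
have [psi Apsi psimax] := @compact_usc_max K _ A (growth R r c) cA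
  (ex_intro _ phi Aphi) usc.
have psi_gt0 := Apos _ Apsi; have [[_ spsi] _] := Apsi.
(* on the boundary of the box Phi would exceed its value at phi *)
have psibox i : `|psi i 0 - phi i 0| < rho2.
  rewrite lt_neqAle Apsi.2 andbT; apply/eqP => Ei.
  have [B [HB _] E] := H c phi psi cc (box_refl phi rho10) (Abox _ Apsi) sphi spsi.
  have := psimax _ Aphi; rewrite !growth_Phi ?qform_gt0 // ler_expR lerN2 E.
  rewrite -/S -/(grad _ _); set u := tail psi - tail phi in HB *.
  have un : rho2 <= norm1 u by rewrite -Ei box_tail_norm1.
  have gu : - (eta * norm1 u) <= (grad c phi *m u^T) 0 0.
    have : `|(grad c phi *m u^T) 0 0| <= eta * norm1 u.
      rewrite [X in `|X|]mxE; apply: le_trans (ler_norm_sum _ _ _) _.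
      rewrite /norm1 mulr_sumr; apply: ler_sum => j _.
      by rewrite normrM [u^T _ _]mxE ler_wpM2r.
    by rewrite ler_norml => /andP [].
  have Bl : expR (-1) * (mu * norm1 u ^+ 2) <= B.
    by apply: le_trans HB; rewrite ler_wpM2l ?expR_ge0.
  have B2 : expR (-1) * (mu * (rho2 * norm1 u)) <= B.
    apply: le_trans Bl; rewrite !ler_wpM2l ?expR_ge0 ?(ltW mu0) // expr2 ler_wpM2r //.
    exact: norm1_ge0.
  have un0 : 0 < norm1 u by apply: lt_le_trans un.
  have := mulr_gt0 eta0 un0.
  have : expR (-1) * (mu * (rho2 * norm1 u)) = 4 * (eta * norm1 u).
    by rewrite /eta; field.
  lra.
have psiI : simplex_interior psi by [].
have psimin : local_minimum_Phi R r c psi.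
  apply/nbhs_box.
  have := near_box (rho := rho2) (x0 := psi) (phi := phi) _ => /(_ _)/wrap[].
    by apply/forallP.
  move/nbhs_box => [e e0 He]; exists e => // y /He /forallP bphi yS.
  have Ay : A y by split=> // i; exact: ltW.
  have := psimax y Ay; rewrite !growth_Phi ?qform_gt0 //; last exact: Apos.
  by rewrite ler_expR lerN2.
have [g0 _] := local_minimum_conditions R_sym R_ge0 R_neq0 psiI psimin.
exists psi; first by split.
by apply/forallP => i; apply: lt_trans (psibox i) r2.
Qed.

(** Away from the critical minima the growth rate is strictly below its maximum,
    uniformly in c. *)
Lemma growth_gap phi (rho : K) : 0 < rho -> crit c0 phi ->
  (forall y, simplex y -> growth R r c0 y <= growth R r c0 phi) ->
  exists2 m, m < growth R r c0 phi & \forall c \near c0, 0 <= c -> forall y, simplex y ->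
    (forall z, crit c0 z -> ~~ box z rho y) -> growth R r c y <= m.
Proof.
move=> rho0 phic phimax; set M := growth R r c0 phi.
have M0 : 0 < M.
  have [[phi0 _] _ _] := phic.
  by rewrite /M growth_Phi ?expR_gt0 // qform_gt0.
pose far y := `[< forall z, crit c0 z -> ~~ box z rho y >].
pose f c y := if (0 <= c) && far y then growth R r c y else 0.
have [|m mM Hm] := @compact_uniform_gap K _ K (nbhs c0) _ _ f M (@compact_simplex K (1 + d)).
  move=> x xS; have [[z zc zx]|xfar] := pselect (exists2 z, crit c0 z & box z rho x).
    exists (M / 2); first lra.
    exists (([set y | box z rho y] : set _), setT); first by split=> /=; [exact: near_box | exact: filterT].
    move=> [x' c] [/= bx _] _; rewrite /f ifF; first by rewrite divr_ge0 ?ltW.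
    apply/negP => /andP [_ /asboolP /(_ z zc)]; rewrite (_ : box z rho x') //.
  have gx : growth R r c0 x < M.
    rewrite lt_neqAle phimax // andbT; apply/eqP => gM; apply: xfar.
    exists x; last exact: box_refl.
    apply: growth_max_crit => // y yS.
    by rewrite gM; exact: phimax.
  exists ((growth R r c0 x + M) / 2); first lra.
  have gx2 : growth R r c0 x < (growth R r c0 x + M) / 2 by lra.
  have [[A B] /= [Ac Bx] AB] := growth_usc R_ge0 c0_ge0 xS gx2.
  exists (B, A) => // -[x' c] [/= Bx' Ac'] xS'; rewrite /f; case: ifP => [/andP [c_ge0 _]|_].
    exact: (AB (c, x')).
  by have := growth_ge0 R r c0 x; lra.
exists m => //; apply: filterS Hm => c Hc c_ge0 y yS yfar.
by have := Hc y yS; rewrite /f c_ge0 /= ifT //; exact/asboolP.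
Qed.

End CriticalMinima.

(** * Edges between typed vertices *)

Definition edge_const (K : realType) (q : nat) (R : 'M[K]_q) (c : K) (x : 'cV[K]_q) : K :=
  let k := c / qform R x in let D := diag_mx x^T in
  expR (- k * \tr (D *m R) - k ^+ 2 * \tr ((D *m R) *m (D *m R))).

Lemma entry_pow1 (K : realType) (q : nat) (R : 'M[K]_q) : entry_pow R 1 = R.
Proof. by apply/matrixP => i j; rewrite mxE expr1. Qed.

(** The two traces are the diagonal sum of R and the quadratic form of the
    squared entries, which the power sums of the edge weights are made of. *)
Lemma edge_constE (K : realType) (q : nat) (R : 'M[K]_q) (c : K) (x : 'cV[K]_q) : R^T = R ->
  edge_const R c x = expR (- (c ^+ 2 * (2 * qform (entry_pow R 2) x / qform R x ^+ 2) / 2)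
                           - c * (diag_sum R x / qform R x)).
Proof.
move=> R_sym; rewrite /edge_const; congr expR.
have DR i j : (diag_mx x^T *m R) i j = x i 0 * R i j.
  rewrite mxE (bigD1 i) //= big1 ?addr0 => [|k /negbTE ki]; last first.
    by rewrite mxE eq_sym ki mulr0n mul0r.
  by rewrite !mxE eqxx mulr1n.
have -> : \tr (diag_mx x^T *m R) = diag_sum R x.
  by apply: eq_bigr => i _; exact: DR.
have -> : \tr ((diag_mx x^T *m R) *m (diag_mx x^T *m R)) = qform (entry_pow R 2) x.
  rewrite qformE; apply: eq_bigr => i _; rewrite mxE mulr_sumr; apply: eq_bigr => j _.
  by rewrite !DR mxE -[in R j i]R_sym mxE; ring.
set T := qform (entry_pow _ _) _; set Q := qform R x; set D := diag_sum _ _.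
rewrite exprMn -exprVn; set iQ := Q^-1.
by field.
Qed.

Section EdgeBounds.
Context (K : realType) (q : nat) (R : 'M[K]_q).
Hypothesis R_sym : R^T = R.
Hypothesis R_ge0 : forall i j, 0 <= R i j.

Let Q x := qform R x.
Let D1 x := diag_sum R x.
Let E2 (x : 'cV[K]_q) (h : K) :=
  2 * (qform (entry_pow R 2) x - h * diag_sum (entry_pow R 2) x) / (Q x - h * D1 x) ^+ 2.
Let E3 (x : 'cV[K]_q) (h : K) :=
  4 * (qform (entry_pow R 3) x - h * diag_sum (entry_pow R 3) x) / (Q x - h * D1 x) ^+ 3.
Let lo (c : K) (x : 'cV[K]_q) (h : K) :=
  - (c ^+ 2 * E2 x h / 2) - 12 * (h * c ^+ 3 * E2 x h ^+ 2)
  - c * (D1 x / Q x) - 2 * (c * h * (D1 x / Q x) ^+ 2).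
Let up (c : K) (x : 'cV[K]_q) (h : K) :=
  - (c ^+ 2 * E2 x h / 2) + h * c * E2 x h / 2 + 4 * (h * c ^+ 3 * E3 x h)
  - c * (D1 x / Q x).

(** With h = 1 / n the power sums give al = h^2 E2 and be = h^4 E3, and p_1 is
    n^2 / 2 (x^T R x - h D1). Since m = c / h, the main terms are al m^2 / 2,
    caused by repeated edges, and h m D1 / (x^T R x), caused by loops. All
    others contain a positive power of h. *)
Lemma edge_bounds (n m : nat) (t : {ffun 'I_n -> 'I_q}) (x := density K t)
    (c : K := m%:R / n%:R) (h : K := n%:R^-1) (M := (n%:R ^+ 2 / 2 * Q x) ^+ m) :
  (0 < n)%N -> 0 < Q x - h * D1 x -> 0 < Q x ->
  h * c * E2 x h <= 1 / 4 -> h * (D1 x / Q x) <= 1 / 2 ->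
  expR (lo c x h) * M <= m`!%:R * elem_sym (edge_weights R t) m <= expR (up c x h) * M.
Proof.
move=> n0 P0 Q0 al4 y2.
have n0' : 0 < n%:R :> K by rewrite ltr0n.
have nn0 : n%:R != 0 :> K by rewrite gt_eqF.
have h0 : 0 < h by rewrite invr_gt0.
have [x0 sx] := @density_simplex K q n t n0.
have D0 : 0 <= D1 x by rewrite sumr_ge0 // => i _; rewrite mulr_ge0.
set s := edge_weights R t; have s0 := edge_weights_ge0 (t := t) R_ge0; rewrite -/s in s0.
have p1E : power_sum s 1 = n%:R ^+ 2 / 2 * (Q x - h * D1 x).
  rewrite (power_sum_edge_weights 1 t R_sym n0) entry_pow1 -/x /h /Q /D1.
  by field.
have p1_gt0 : 0 < power_sum s 1 by rewrite p1E mulr_gt0 // divr_gt0 // exprn_gt0.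
set P := Q x - h * D1 x in P0 p1E *.
have Pn0 : P != 0 by rewrite gt_eqF.
have alE : power_sum s 2 / power_sum s 1 ^+ 2 = h ^+ 2 * E2 x h.
  rewrite p1E (power_sum_edge_weights 2 t R_sym n0) -/x /E2 -/P /h.
  by set N : K := n%:R in nn0 *; field; rewrite nn0 Pn0.
have beE : power_sum s 3 / power_sum s 1 ^+ 3 = h ^+ 4 * E3 x h.
  rewrite p1E (power_sum_edge_weights 3 t R_sym n0) -/x /E3 -/P /h.
  by set N : K := n%:R in nn0 *; field; rewrite nn0 Pn0.
have mE : m%:R = c / h by rewrite /c /h invrK divfK.
have hn0 : h != 0 by rewrite gt_eqF.
have al4' : power_sum s 2 / power_sum s 1 ^+ 2 * m%:R <= 1 / 4.
  rewrite alE mE; apply: le_trans al4; rewrite le_eqVlt; apply/orP; left.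
  by apply/eqP; field.
have := distinct_ratio_ge s0 p1_gt0 al4'; have := distinct_ratio_le s0 p1_gt0 al4'.
rewrite alE beE mE.
have -> : h ^+ 2 * E2 x h * (c / h) ^+ 2 / 2 = c ^+ 2 * E2 x h / 2 by field.
have -> : h ^+ 2 * E2 x h * (c / h) / 2 = h * c * E2 x h / 2 by field.
have -> : 4 * (h ^+ 4 * E3 x h) * (c / h) ^+ 3 = 4 * (h * c ^+ 3 * E3 x h) by field.
have -> : 12 * (h ^+ 2 * E2 x h) ^+ 2 * (c / h) ^+ 3 = 12 * (h * c ^+ 3 * E2 x h ^+ 2) by field.
set b := distinct_ratio s m => b_le b_ge.
have -> : m`!%:R * elem_sym s m = b * power_sum s 1 ^+ m.
  by rewrite /b /distinct_ratio divfK // expf_neq0 // gt_eqF.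
set y := h * (D1 x / Q x) in y2.
have Qn0 : Q x != 0 by rewrite gt_eqF.
have y0 : 0 <= y by rewrite mulr_ge0 ?divr_ge0 // ltW.
have p1M : power_sum s 1 ^+ m = M * (1 - y) ^+ m.
  rewrite /M -exprMn p1E /P /y; congr (_ ^+ _).
  by field.
rewrite p1M.
have M0 : 0 <= M by rewrite exprn_ge0 // mulr_ge0 ?(ltW Q0) // divr_ge0 // sqr_ge0.
have y_up : (1 - y) ^+ m <= expR (- c * (D1 x / Q x)).
  apply: le_trans (_ : expR (- y) ^+ m <= _).
    rewrite lerXn2r ?nnegrE ?expR_ge0 //; last exact: expR_ge1Dx.
    by rewrite subr_ge0; apply: le_trans y2 _; lra.
  rewrite -expRM_natl ler_expR /y mE.
  by rewrite le_eqVlt; apply/orP; left; apply/eqP; field; rewrite Qn0.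
have y_lo : expR (- c * (D1 x / Q x) - 2 * (c * h * (D1 x / Q x) ^+ 2)) <= (1 - y) ^+ m.
  apply: le_trans (_ : expR (- (y + 2 * y ^+ 2)) ^+ m <= _); last first.
    rewrite lerXn2r ?nnegrE ?expR_ge0 //; last exact: expR_lower_quadratic.
    by rewrite subr_ge0; apply: le_trans y2 _; lra.
  rewrite -expRM_natl ler_expR /y mE.
  by rewrite le_eqVlt; apply/orP; left; apply/eqP; field; rewrite Qn0.
have b0 : 0 <= b by apply: le_trans b_ge; exact: expR_ge0.
have y10 : 0 <= (1 - y) ^+ m by apply: le_trans y_lo; exact: expR_ge0.
apply/andP; split.
  rewrite mulrCA [leLHS]mulrC ler_wpM2l //.
  apply: le_trans (_ : expR (- (c ^+ 2 * E2 x h / 2) - 12 * (h * c ^+ 3 * E2 x h ^+ 2)) *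
    expR (- c * (D1 x / Q x) - 2 * (c * h * (D1 x / Q x) ^+ 2)) <= _).
    by rewrite -expRD ler_expR /lo; lra.
  by apply: ler_pM => //; exact: expR_ge0.
rewrite mulrCA [leRHS]mulrC ler_wpM2l //.
apply: le_trans (_ : expR (- (c ^+ 2 * E2 x h / 2) + h * c * E2 x h / 2 + 4 * (h * c ^+ 3 * E3 x h)) *
  expR (- c * (D1 x / Q x)) <= _).
  by apply: ler_pM.
by rewrite -expRD ler_expR /up; lra.
Qed.

(** Both exponents in the previous bounds are continuous in (c, x, h) at h = 0. *)
Lemma edge_factor (c0 : K) (phi : 'cV[K]_q) (dl : K) :
  R != 0 -> (forall i, 0 < phi i 0) -> 0 < dl ->
  exists2 rho, 0 < rho & \forall n \near \oo, forall m (t : {ffun 'I_n -> 'I_q}),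
    `|m%:R / n%:R - c0| < rho -> box phi rho (density K t) ->
    log_close dl (m`!%:R * elem_sym (edge_weights R t) m)
      ((n%:R ^+ 2 / 2 * qform R (density K t)) ^+ m * edge_const R c0 phi).
Proof.
move=> R_neq0 phi0 dl0.
pose F := nbhs ((c0, phi), 0 : K).
have FF : Filter F := nbhs_filter _.
have Hp : p.1 @[p --> F] --> (c0, phi) by exact: cvg_fst.
have Hc : p.1.1 @[p --> F] --> c0.
  by apply: (@cvg_comp _ _ _ (fun p => p.1) fst _ (nbhs (c0, phi))) => //; exact: cvg_fst.
have Hh : p.2 @[p --> F] --> (0 : K) by exact: cvg_snd.
have Hx : mx_cvg F (fun p => p.1.2) phi.
  move=> i j; apply: (@cvg_comp _ _ _ (fun p => p.1) (fun p => (p.2 : 'cV[K]_q) i j) _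
    (nbhs (c0, phi))) => //.
  exact: mx_cvg_snd.
have HQ (A : 'M[K]_q) : qform A p.1.2 @[p --> F] --> qform A phi.
  exact: (@qform_cvg K q A _ F FF _ _ Hx).
have HD (A : 'M[K]_q) : diag_sum A p.1.2 @[p --> F] --> diag_sum A phi.
  by apply: cvg_sum_ord => i; apply: cvgM; [exact: Hx | exact: cvg_cst].
have Q0 : 0 < Q phi by rewrite /Q qform_gt0.
have Qn0 : Q phi != 0 by rewrite gt_eqF.
have HP : Q p.1.2 - p.2 * D1 p.1.2 @[p --> F] --> Q phi.
  rewrite -[Q phi]subr0 -[X in _ - X](mul0r (D1 phi)).
  by apply: cvgB; [exact: HQ | apply: cvgM => //; exact: HD].
have HN (A : 'M[K]_q) : qform A p.1.2 - p.2 * diag_sum A p.1.2 @[p --> F] --> qform A phi.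
  rewrite -[qform A phi]subr0 -[X in _ - X](mul0r (diag_sum A phi)).
  by apply: cvgB; [exact: HQ | apply: cvgM => //; exact: HD].
have HX (f : (K * 'cV[K]_q) * K -> K) (l : K) k : f p @[p --> F] --> l -> f p ^+ k @[p --> F] --> l ^+ k.
  move=> Hf; elim: k => [|k IH]; first by rewrite expr0; exact: cvg_cst.
  by rewrite exprS; under eq_cvg => p do rewrite exprS; exact: cvgM.
have H2 : E2 p.1.2 p.2 @[p --> F] --> 2 * qform (entry_pow R 2) phi / Q phi ^+ 2.
  apply: cvgM; first by apply: cvgM; [exact: cvg_cst | exact: HN].
  by apply: cvgV; [rewrite expf_neq0 | exact: HX].
have H3 : E3 p.1.2 p.2 @[p --> F] --> 4 * qform (entry_pow R 3) phi / Q phi ^+ 3.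
  apply: cvgM; first by apply: cvgM; [exact: cvg_cst | exact: HN].
  by apply: cvgV; [rewrite expf_neq0 | exact: HX].
have Ht : D1 p.1.2 / Q p.1.2 @[p --> F] --> D1 phi / Q phi.
  by apply: cvgM; [exact: HD | apply: cvgV => //; exact: HQ].
set L := - (c0 ^+ 2 * (2 * qform (entry_pow R 2) phi / Q phi ^+ 2) / 2) - c0 * (D1 phi / Q phi).
have Hhc k : p.2 * p.1.1 ^+ k @[p --> F] --> (0 : K).
  by rewrite -(mul0r (c0 ^+ k)); apply: cvgM => //; exact: HX.
have Hc2 : - (p.1.1 ^+ 2 * E2 p.1.2 p.2 / 2) @[p --> F] -->
    - (c0 ^+ 2 * (2 * qform (entry_pow R 2) phi / Q phi ^+ 2) / 2).
  apply: cvgN; apply: cvgM; last exact: cvg_cst.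
  by apply: cvgM => //; exact: HX.
have Hlo : lo p.1.1 p.1.2 p.2 @[p --> F] --> L.
  have E : L = - (c0 ^+ 2 * (2 * qform (entry_pow R 2) phi / Q phi ^+ 2) / 2) -
     12 * (0 * (2 * qform (entry_pow R 2) phi / Q phi ^+ 2) ^+ 2) - c0 * (D1 phi / Q phi) -
     2 * (c0 * 0 * (D1 phi / Q phi) ^+ 2) by rewrite /L; ring.
  rewrite E; apply: cvgB; last first.
    apply: cvgM; first exact: cvg_cst.
    by apply: cvgM; [exact: cvgM | exact: HX].
  apply: cvgB; last exact: cvgM.
  apply: cvgB => //; apply: cvgM; first exact: cvg_cst.
  by apply: cvgM; [exact: Hhc | exact: HX].
have Hup : up p.1.1 p.1.2 p.2 @[p --> F] --> L.
  have E : L = - (c0 ^+ 2 * (2 * qform (entry_pow R 2) phi / Q phi ^+ 2) / 2) +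
     0 * c0 * (2 * qform (entry_pow R 2) phi / Q phi ^+ 2) / 2 +
     4 * (0 * (4 * qform (entry_pow R 3) phi / Q phi ^+ 3)) - c0 * (D1 phi / Q phi).
    by rewrite /L; ring.
  rewrite E; apply: cvgB; last exact: cvgM.
  apply: cvgD.
    apply: cvgD => //; apply: cvgM; last exact: cvg_cst.
    by apply: cvgM => //; exact: cvgM.
  apply: cvgM; first exact: cvg_cst.
  by apply: cvgM; [exact: Hhc | exact: H3].
have N1 : \forall p \near F, L - dl <= lo p.1.1 p.1.2 p.2.
  by apply: (cvgr_ge _ Hlo); rewrite ltrBlDr ltrDl.
have N2 : \forall p \near F, up p.1.1 p.1.2 p.2 <= L + dl.
  by apply: (cvgr_le _ Hup); rewrite ltrDl.
have N3 : \forall p \near F, 0 < Q p.1.2 - p.2 * D1 p.1.2 by exact: (cvgr_gt _ HP).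
have N4 : \forall p \near F, 0 < Q p.1.2 by exact: (cvgr_gt _ (HQ R)).
have N5 : \forall p \near F, p.2 * p.1.1 * E2 p.1.2 p.2 <= 1 / 4.
  have H : p.2 * p.1.1 * E2 p.1.2 p.2 @[p --> F] -->
      0 * c0 * (2 * qform (entry_pow R 2) phi / Q phi ^+ 2).
    by apply: cvgM => //; exact: cvgM.
  by apply: (cvgr_le _ H); rewrite !mul0r divr_gt0.
have N6 : \forall p \near F, p.2 * (D1 p.1.2 / Q p.1.2) <= 1 / 2.
  have H : p.2 * (D1 p.1.2 / Q p.1.2) @[p --> F] --> 0 * (D1 phi / Q phi) by exact: cvgM.
  by apply: (cvgr_le _ H); rewrite mul0r divr_gt0.
have [[A B] /= [HA HB] AB] := filterI N1 (filterI N2 (filterI N3 (filterI N4 (filterI N5 N6)))).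
have [rho rho0 Hrho] := nbhs_pair_box HA.
exists rho => //.
have Nh : \forall n \near \oo, B (n%:R^-1 : K).
  have H : (n.+1%:R^-1 : K) @[n --> \oo] --> (0 : K) by exact: cvg_harmonic.
  have [N _ HN'] := H _ HB.
  exists N.+1 => // -[//|n] /= Nn; exact: HN'.
have Npos : \forall n \near \oo, (0 < n)%N by exists 1%N.
apply: filterS2 Nh Npos => n Bn n0 m t cc bx.
have [H1 [H2' [H3' [H4 [H5 H6]]]]] := AB ((_, density K t), n%:R^-1) (conj (Hrho _ _ cc bx) Bn).
rewrite /= in H1 H2' H3' H4 H5 H6.
have /andP [Hl Hu] := edge_bounds n0 H3' H4 H5 H6.
rewrite edge_constE // -/(Q phi) -/(D1 phi) -/L.
set M := (_ ^+ m) in Hl Hu *.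
have M0 : 0 <= M.
  by rewrite exprn_ge0 // mulr_ge0 ?(ltW H4) // divr_ge0 // sqr_ge0.
split.
  apply: le_trans Hl; rewrite mulrCA [leRHS]mulrC ler_wpM2l // -expRD ler_expR; lra.
apply: le_trans Hu _; rewrite mulrCA [leLHS]mulrC ler_wpM2l // -expRD ler_expR; lra.
Qed.

End EdgeBounds.

(** * Contribution of the types near a minimum *)

Lemma log_closeZ (K : realType) (d a X Y : K) : 0 <= a ->
  log_close d X Y -> log_close d (a * X) (a * Y).
Proof. by move=> a0 [H1 H2]; split; rewrite mulrCA ler_wpM2l. Qed.

Lemma near_log_close (K : realType) (T : Type) (F : set_system T) (FF : Filter F)
    (f : T -> K) (l e : K) : f t @[t --> F] --> l -> 0 < l -> 0 < e ->
  \forall t \near F, log_close e (f t) l.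
Proof.
move=> Hf l0 e0.
have N1 : \forall t \near F, expR (- e) * l <= f t.
  apply: (cvgr_ge _ Hf); rewrite gtr_pMl // -[ltRHS]expR0 ltr_expR; lra.
have N2 : \forall t \near F, f t <= expR e * l.
  apply: (cvgr_le _ Hf); rewrite ltr_pMl // -[ltLHS]expR0 ltr_expR; lra.
by apply: filterS2 N1 N2.
Qed.

Definition count_density (K : realType) (q n : nat) (f : 'I_q -> nat) : 'cV[K]_q :=
  \col_i ((f i)%:R / n%:R).

(** Counts with sum n are parametrized by those of the types other than the
    first; they make sense when these do not exceed n in total. *)
Definition complete_counts (d n : nat) (k : 'rV['I_n.+1]_d) (i : 'I_(1 + d)) : nat :=
  match fintype.split i with inl _ => (n - \sum_j k 0%R j)%N | inr j => k 0 j end.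

Lemma complete_counts_tail d n (k : 'rV['I_n.+1]_d) j :
  complete_counts k (rshift 1 j) = k 0 j.
Proof.
by rewrite /complete_counts; case: (split_ordP (rshift 1 j)) => i /eqP;
  rewrite ?eq_rlshift // eq_rshift => /eqP ->.
Qed.

Lemma complete_counts_head d n (k : 'rV['I_n.+1]_d) j :
  complete_counts k (lshift d j) = (n - \sum_j k 0%R j)%N.
Proof.
by rewrite /complete_counts; case: (split_ordP (lshift d j)) => i /eqP;
  rewrite ?eq_lrshift.
Qed.

Lemma sum_complete_counts d n (k : 'rV['I_n.+1]_d) :
  (\sum_j k 0%R j <= n)%N -> (\sum_i complete_counts k i)%N = n.
Proof.
move=> kn; rewrite big_split_ord big_ord1 /= complete_counts_head.
rewrite (eq_bigr (fun j => nat_of_ord (k 0%R j))) => [|j _]; first by rewrite subnK.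
exact: complete_counts_tail.
Qed.

Lemma sum_type_count q n (t : {ffun 'I_n -> 'I_q}) : (\sum_i type_count t i)%N = n.
Proof.
under eq_bigr => i _ do rewrite type_countE.
rewrite exchange_big /= -[RHS]card_ord -sum1_card; apply: eq_bigr => u _.
by rewrite (bigD1 (t u)) //= eqxx big1 ?addn0 // => i; rewrite eq_sym => /negbTE ->.
Qed.

Lemma sum_typings_by_counts (K : realType) (d n : nat) (P : pred ('I_(1 + d) -> nat))
    (F : ('I_(1 + d) -> nat) -> K) :
  \sum_(t : {ffun 'I_n -> 'I_(1 + d)} | P (type_count t)) F (type_count t) =
  \sum_(k : 'rV['I_n.+1]_d | (\sum_j k 0%R j <= n)%N && P (complete_counts k))
    #|@typings_with_counts (1 + d) n (complete_counts k)|%:R * F (complete_counts k).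
Proof.
pose p (t : {ffun 'I_n -> 'I_(1 + d)}) : 'rV['I_n.+1]_d :=
  \row_j inord (type_count t (rshift 1 j)).
have tc_le (t : {ffun 'I_n -> 'I_(1 + d)}) i : (type_count t i <= n)%N.
  by rewrite -[leqRHS](sum_type_count t) (bigD1 i) //= leq_addr.
have pE t j : p t 0 j = type_count t (rshift 1 j) :> nat.
  by rewrite mxE inordK // ltnS.
have sum_p t : (\sum_j p t 0%R j <= n)%N.
  rewrite -[leqRHS](sum_type_count t) big_split_ord /=.
  by under eq_bigr => j _ do rewrite pE; rewrite leq_addl.
have spl t : complete_counts (p t) = type_count t.
  apply: funext => i; case: (split_ordP i) => j ->; last first.
    by rewrite complete_counts_tail pE.
  rewrite complete_counts_head (eq_bigr (fun l => type_count t (rshift 1 l))) => [|l _].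
    have := sum_type_count t; rewrite big_split_ord big_ord1 /= (ord1 j) => E.
    by apply: (canLR (addnK _)); rewrite E.
  exact: pE.
rewrite (partition_big p (fun k => (\sum_j k 0%R j <= n)%N && P (complete_counts k))) /=;
  last by move=> t bt; rewrite sum_p spl.
apply: eq_bigr => k /andP [kn kb].
have E t : (P (type_count t) && (p t == k)) =
    (t \in @typings_with_counts (1 + d) n (complete_counts k)).
  apply/andP/forallP => [[_ /eqP <-] i|H]; first by rewrite spl.
  have tk : type_count t = complete_counts k by apply: funext => i; exact/eqP/H.
  split; first by rewrite tk.
  apply/eqP/matrixP => i j; rewrite (ord1 i); apply/val_inj; rewrite /= pE tk.
  exact: complete_counts_tail.
rewrite (eq_bigl _ _ E) mulr_natl -sumr_const.
apply: eq_bigr => t /forallP H; congr F.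
by apply: funext => i; exact/eqP/H.
Qed.

Section CountTerm.
Context (K : realType) (d : nat) (R : 'M[K]_(1 + d)) (r : 'cV[K]_(1 + d)).
Hypothesis R_ge0 : forall i j, 0 <= R i j.
Hypothesis R_neq0 : R != 0.
Hypothesis r_gt0 : forall i, 0 < r i 0.

(** The entropy part of Phi comes from comparing the weights r of the types with
    the proportions x, whose own product is the probability that enters the
    multinomial estimate. *)
Lemma type_weight_Phi (n m : nat) (f : 'I_(1 + d) -> nat)
    (x := count_density K n f) : (0 < n)%N -> (forall i, (0 < f i)%N) ->
  \prod_i r i 0 ^+ f i * qform R x ^+ m =
  \prod_i x i 0 ^+ f i * expR (- (n%:R * Phi R r (m%:R / n%:R) x)).
Proof.
move=> n0 f0; have nn0 : n%:R != 0 :> K by rewrite pnatr_eq0 -lt0n.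
have x0 i : 0 < x i 0 by rewrite mxE divr_gt0 // ltr0n.
have Q0 : 0 < qform R x by rewrite qform_gt0.
have -> : - (n%:R * Phi R r (m%:R / n%:R) x) =
    (\sum_i (f i)%:R * (ln (r i 0) - ln (x i 0))) + m%:R * ln (qform R x).
  rewrite /Phi mulrBr opprB mulrA mulrCA divff // mulr1 addrC; congr (_ + _).
  rewrite mulr_sumr -sumrN; apply: eq_bigr => i _.
  have -> : (f i)%:R = n%:R * x i 0 by rewrite mxE mulrC divfK.
  by ring.
rewrite expRD expR_sum expRM_natl lnK ?posrE // mulrA -big_split /=; congr (_ * _).
apply: eq_bigr => i _; rewrite expRM_natl expRB !lnK ?posrE // exprMn exprVn mulrCA.
by rewrite divff ?mulr1 // expf_neq0 // gt_eqF.
Qed.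

Lemma count_term (e : K) : 0 < e -> exists k0, forall n m (f : 'I_(1 + d) -> nat)
    (x := count_density K n f),
  (\sum_i f i)%N = n -> (forall i, (k0 < f i)%N) ->
  log_close e
    (#|@typings_with_counts (1 + d) n f|%:R * (\prod_i r i 0 ^+ f i * qform R x ^+ m))
    ((stirling_const K * Num.sqrt n%:R) ^- d / Num.sqrt (\prod_i x i 0) *
     expR (- (n%:R * Phi R r (m%:R / n%:R) x))).
Proof.
move=> e0; have [k0 H] := multinomial_estimate d e0.
exists k0 => n m f x fn fk.
have f0 i : (0 < f i)%N by apply: leq_ltn_trans (fk i).
have n0 : (0 < n)%N by rewrite -fn big_split_ord big_ord1 /= addn_gt0 f0.
rewrite (type_weight_Phi m n0 f0) mulrA ![_ * expR _]mulrC.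
apply: log_closeZ; first exact: expR_ge0.
have E : \prod_i x i 0 ^+ f i = \prod_i ((f i)%:R / n%:R) ^+ f i.
  by apply: eq_bigr => i _; rewrite mxE.
have E' : \prod_i x i 0 = \prod_i ((f i)%:R / n%:R).
  by apply: eq_bigr => i _; rewrite mxE.
by rewrite E E'; exact: H.
Qed.

End CountTerm.

Lemma sqrt_det_scale (K : realType) d (A : 'M[K]_d) (a : K) :
  Num.sqrt (\det (expR a *: A)) = expR (d%:R * (a / 2)) * Num.sqrt (\det A).
Proof.
rewrite detZ -[a in expR a](_ : 2 * (a / 2) = a); last by field.
rewrite !expRM_natl -exprM mulnC exprM sqrtrM ?sqr_ge0 // sqrtr_sqr.
by rewrite ger0_norm // exprn_ge0 // expR_ge0.
Qed.

Lemma bilin_scale (K : realType) d (A : 'M[K]_d) (a : K) u :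
  bilin (a *: A) u = a * bilin A u.
Proof.
rewrite !bilinE mulr_sumr; apply: eq_bigr => i _; rewrite mulr_sumr.
by apply: eq_bigr => j _; rewrite mxE; ring.
Qed.

(** The exponents B k need only be proportional to the quadratic form up to a
    factor close to 1: replacing A by expR e *: A and expR (- e) *: A changes
    the limit by such a factor as well. *)
Lemma gauss_lattice_sum (K : realType) (d : nat) (A : 'M[K]_d) (e : K) :
  A^T = A -> posdef A -> 0 < e ->
  exists L0 h0, [/\ 0 < L0, 0 < h0 & forall h (s : 'rV[K]_d) N (P : pred 'rV['I_N]_d)
      (B : 'rV['I_N]_d -> K), 0 < h -> h <= h0 ->
    (forall i, s 0 i <= - L0 /\ L0 <= h * N%:R + s 0 i) ->
    (forall k, P k -> log_close e (B k) (bilin A (lattice_point h s k))) ->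
    (forall k, (forall i, `|lattice_point h s k 0 i| <= L0) -> P k) ->
    log_close (d.+1%:R * e) (\sum_(k | P k) expR (- B k))
      (h ^- d * (gauss_mass K ^+ d / Num.sqrt (\det A)))].
Proof.
move=> A_sym A_pos e0; set X := gauss_mass K ^+ d / Num.sqrt (\det A).
have X0 : 0 < X.
  by rewrite divr_gt0 ?exprn_gt0 ?gauss_mass_gt0 // sqrtr_gt0 posdef_det_gt0.
have scaled a : [/\ (expR a *: A)^T = expR a *: A, posdef (expR a *: A) &
    gauss_mass K ^+ d / Num.sqrt (\det (expR a *: A)) = expR (- (d%:R * (a / 2))) * X].
  split; first by rewrite linearZ /= A_sym.
    by move=> u u0; rewrite bilin_scale mulr_gt0 ?expR_gt0 // A_pos.
  by rewrite sqrt_det_scale invfM mulrCA expRN.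
have [S1 P1 D1] := scaled (- e); have [S2 P2 D2] := scaled e.
set X1 := _ * X in D1; set X2 := _ * X in D2.
have X10 : 0 < X1 by rewrite mulr_gt0 // expR_gt0.
have X20 : 0 < X2 by rewrite mulr_gt0 // expR_gt0.
have ee1 : 1 < expR e by rewrite -[ltLHS]expR0 ltr_expR.
have ee2 : expR (- e) < 1 by rewrite -[ltRHS]expR0 ltr_expR; lra.
have e1 : 0 < (expR e - 1) * X1 by rewrite mulr_gt0 //; lra.
have e2 : 0 < (1 - expR (- e)) * X2 by rewrite mulr_gt0 //; lra.
have [h1 h10 Hup] := gauss_lattice_upper S1 P1 e1.
have [L0 [h2 [L00 h20 Hlo]]] := gauss_lattice_lower S2 P2 e2.
exists L0, (Num.min h1 h2); split=> //; first by rewrite lt_min h10.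
move=> h s N P B h0; rewrite le_min => /andP [hh1 hh2] Hs HB HP.
have hd0 : 0 < h ^+ d by rewrite exprn_gt0.
have cancel Y : Y = h ^- d * (h ^+ d * Y) by rewrite mulKf // gt_eqF.
have bl k : 0 <= bilin A (lattice_point h s k).
  have [->|/A_pos/ltW //] := eqVneq (lattice_point h s k) 0.
  by rewrite /bilin mul0mx mul0mx mxE.
rewrite [X in log_close _ X _]cancel; apply: log_closeZ; first by rewrite invr_ge0 ltW.
have dE : d.+1%:R * e = e + d%:R * e by rewrite -natr1; ring.
have de0 : 0 <= d%:R * e by rewrite mulr_ge0 // ltW.
split.
  apply: le_trans (_ : expR (- e) * X2 <= _).
    rewrite /X2 mulrA -expRD ler_wpM2r ?(ltW X0) // ler_expR dE; lra.
  have := Hlo h s N h0 hh2 Hs; rewrite D2.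
  have -> : X2 - (1 - expR (- e)) * X2 = expR (- e) * X2 by ring.
  move=> H; apply: le_trans H _; rewrite ler_wpM2l ?(ltW hd0) //.
  apply: le_trans (_ : \sum_(k | P k) expR (- bilin (expR e *: A) (lattice_point h s k)) <= _).
    rewrite big_mkcond [leRHS]big_mkcond; apply: ler_sum => k _.
    case: ifP => [/forallP Hk|_]; first by rewrite HP.
    by case: ifP => _; rewrite ?expR_ge0.
  by apply: ler_sum => k /HB [_ H2]; rewrite ler_expR lerN2 bilin_scale.
apply: le_trans (_ : expR e * X1 <= _); last first.
  rewrite /X1 mulrA -expRD ler_wpM2r ?(ltW X0) // ler_expR dE; lra.
have := Hup h s N h0 hh1; rewrite D1.
have -> : X1 + (expR e - 1) * X1 = expR e * X1 by ring.
apply: le_trans; rewrite ler_wpM2l ?(ltW hd0) //.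
apply: le_trans (_ : \sum_(k | P k) expR (- bilin (expR (- e) *: A) (lattice_point h s k)) <= _).
  by apply: ler_sum => k /HB [H1 _]; rewrite ler_expR lerN2 bilin_scale.
rewrite big_mkcond; apply: ler_sum => k _.
by case: ifP => _; rewrite ?expR_ge0.
Qed.

Section LocalSum.
Context (K : realType) (d : nat) (R : 'M[K]_(1 + d)) (r : 'cV[K]_(1 + d)).
Hypothesis R_sym : R^T = R.
Hypothesis R_ge0 : forall i j, 0 <= R i j.
Hypothesis R_neq0 : R != 0.
Hypothesis r_gt0 : forall i, 0 < r i 0.

Let S := std_directions K d.
Let hess c x : 'M[K]_d := @hess_Phi K (1 + d) R S c x.

(** The factor of a summand of the formula that does not depend on n and m. *)
Definition amplitude (c : K) (x : 'cV[K]_(1 + d)) : K :=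
  edge_const R c x / Num.sqrt (\det (hess c x) * \prod_i x i 0).

Lemma minimum_termE n m c (x : 'cV[K]_(1 + d)) :
  (forall i, 0 < x i 0) -> (0 < n)%N -> c = m%:R / n%:R ->
  @minimum_term K (1 + d) R r S n m c x =
  expR (- (n%:R * Phi R r c x)) * amplitude c x.
Proof.
move=> x0 n0 ->; have nn0 : n%:R != 0 :> K by rewrite pnatr_eq0 -lt0n.
rewrite /minimum_term vpow_entropy //; last by move=> i; exact: ltW.
congr (_ * _); have Q0 : 0 < qform R x by rewrite qform_gt0.
rewrite -[qform R x in LHS]lnK ?posrE // -!expRM_natl -expRD; congr expR.
by rewrite /Phi -/(entropy r x); field.
Qed.

Lemma amplitude_gt0 c (x : 'cV[K]_(1 + d)) :
  (forall i, 0 < x i 0) -> posdef (hess c x) -> 0 < amplitude c x.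
Proof.
move=> x0 Hp; rewrite divr_gt0 ?expR_gt0 // sqrtr_gt0 mulr_gt0 ?prodr_gt0 //.
by apply: posdef_det_gt0 => //; exact: hess_Phi_sym.
Qed.

Lemma edge_const_cvg (c0 : K) (phi : 'cV[K]_(1 + d)) : (forall i, 0 < phi i 0) ->
  edge_const R p.1 p.2 @[p --> nbhs (c0, phi)] --> edge_const R c0 phi.
Proof.
move=> phi0; set F := nbhs (c0, phi).
have FF : Filter F := nbhs_filter _.
have Hx := @mx_cvg_snd K _ c0 _ phi; rewrite -/F in Hx.
have HQ (A : 'M[K]_(1 + d)) : qform A p.2 @[p --> F] --> qform A phi.
  exact: (@qform_cvg K _ A _ F FF _ _ Hx).
have HD : diag_sum R p.2 @[p --> F] --> diag_sum R phi.
  by apply: cvg_sum_ord => i; apply: cvgM; [exact: Hx | exact: cvg_cst].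
have Hc : p.1 @[p --> F] --> c0 by exact: cvg_fst.
have Qn0 : qform R phi != 0 by rewrite gt_eqF // qform_gt0.
rewrite edge_constE //; under eq_cvg => p do rewrite edge_constE //.
apply: (@cvg_comp _ _ _ _ (@expR K) _ (nbhs (_ : K))); last exact: continuous_expR.
apply: cvgB; last first.
  by apply: cvgM => //; apply: cvgM => //; exact: cvgV.
apply: cvgN; apply: cvgM; last exact: cvg_cst.
apply: cvgM.
  by under eq_cvg => p do rewrite expr2; rewrite expr2; exact: cvgM.
apply: cvgM; first by apply: cvgM; [exact: cvg_cst | exact: HQ].
apply: cvgV; first by rewrite expf_neq0.
by under eq_cvg => p do rewrite expr2; rewrite expr2; exact: cvgM.
Qed.

Lemma sqrt_prod_cvg (c0 : K) (phi : 'cV[K]_(1 + d)) :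
  Num.sqrt (\prod_i (p.2 : 'cV[K]_(1 + d)) i 0) @[p --> nbhs (c0, phi)] -->
  Num.sqrt (\prod_i phi i 0).
Proof.
apply: (@cvg_comp _ _ _ _ (@Num.sqrt K) _ (nbhs (_ : K))); last exact: sqrt_continuous.
apply: (cvg_prod_ord (nbhs_filter (c0, phi))) => i.
exact: (@mx_cvg_snd K _ c0 _ phi).
Qed.

Lemma amplitude_cvg (c0 : K) (phi : 'cV[K]_(1 + d)) : (forall i, 0 < phi i 0) ->
  posdef (hess c0 phi) ->
  amplitude p.1 p.2 @[p --> nbhs (c0, phi)] --> amplitude c0 phi.
Proof.
move=> phi0 Hp; apply: cvgM; first exact: edge_const_cvg.
apply: cvgV.
  rewrite gt_eqF // sqrtr_gt0 mulr_gt0 ?prodr_gt0 //.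
  by apply: posdef_det_gt0 => //; exact: hess_Phi_sym.
apply: (@cvg_comp _ _ _ _ (@Num.sqrt K) _ (nbhs (_ : K))); last exact: sqrt_continuous.
apply: cvgM.
  apply: mx_cvg_det; exact: hess_continuous.
apply: (cvg_prod_ord (nbhs_filter (c0, phi))) => i.
exact: (@mx_cvg_snd K _ c0 _ phi).
Qed.

(** In the variable sqrt n (x - psi) the possible proportions form a lattice of
    mesh 1 / sqrt n. *)
Lemma tail_count_density n (k : 'rV['I_n.+1]_d) (psi : 'cV[K]_(1 + d)) : (0 < n)%N ->
  lattice_point (Num.sqrt n%:R)^-1 (- Num.sqrt n%:R *: tail psi) k =
  Num.sqrt n%:R *: (tail (count_density K n (complete_counts k)) - tail psi).
Proof.
move=> n0; have sn0 : Num.sqrt n%:R != 0 :> K by rewrite gt_eqF // sqrtr_gt0 ltr0n.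
apply/matrixP => i j; rewrite !mxE complete_counts_tail (ord1 i).
rewrite -[n%:R in X in _ * (X - _)]sqr_sqrtr ?ler0n //.
by field.
Qed.

Lemma sum_count_density n (k : 'rV['I_n.+1]_d) : (0 < n)%N ->
  (\sum_j k 0%R j <= n)%N -> \sum_i count_density K n (complete_counts k) i 0 = 1.
Proof.
move=> n0 kn; rewrite (eq_bigr (fun i => (complete_counts k i)%:R / n%:R)) => [|i _].
  by rewrite -mulr_suml -natr_sum sum_complete_counts // divff // pnatr_eq0 -lt0n.
by rewrite mxE.
Qed.

(** A bound on the coordinates other than the first controls the first one, as
    the coordinates add up to 1. In particular it remains positive, so the
    counts do not exceed n. *)
Lemma complete_counts_box n (k : 'rV['I_n.+1]_d) (phi psi : 'cV[K]_(1 + d)) (rho L : K)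
    (x := count_density K n (complete_counts k)) : (0 < n)%N ->
  box phi (rho / 2) psi -> \sum_i psi i 0 = 1 -> (forall i, rho <= phi i 0) ->
  (forall j, `|x (rshift 1 j) 0 - psi (rshift 1 j) 0| <= L) ->
  0 < L -> (d%:R + 1) * L < rho / 2 ->
  (\sum_j k 0%R j <= n)%N && box phi rho x.
Proof.
move=> n0 psib spsi rphi Hu L0 LR.
have n0' : 0 < n%:R :> K by rewrite ltr0n.
have nn0 : n%:R != 0 :> K by rewrite gt_eqF.
have dL : 0 <= d%:R * L by rewrite mulr_ge0 // ltW.
pose z : K := 1 - \sum_j x (rshift 1 j) 0.
have zE : `|z - psi (lshift d 0) 0| <= d%:R * L.
  have -> : z - psi (lshift d 0) 0 = \sum_j (psi (rshift 1 j) 0 - x (rshift 1 j) 0).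
    by have := spsi; rewrite big_split_ord big_ord1 /= /z sumrB => <-; ring.
  apply: le_trans (ler_norm_sum _ _ _) _.
  rewrite mulr_natl -[d in _ *+ d]card_ord -sumr_const; apply: ler_sum => j _.
  by rewrite distrC.
have boxed y i : `|y - psi i 0| < rho / 2 -> `|y - phi i 0| < rho.
  move=> H; have := (forallP psib) i => H'.
  have -> : y - phi i 0 = (y - psi i 0) + (psi i 0 - phi i 0) by ring.
  by apply: le_lt_trans (ler_normD _ _) _; lra.
have zb : `|z - psi (lshift d 0) 0| < rho / 2 by apply: le_lt_trans zE _; lra.
have z0 : 0 < z.
  have := boxed _ _ zb; rewrite ltr_norml => /andP [H _].
  by have := rphi (lshift d 0); lra.
have kn : (\sum_j k 0%R j <= n)%N.
  have E : z * n%:R = n%:R - (\sum_j k 0%R j)%:R.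
    rewrite /z mulrBl mul1r mulr_suml natr_sum; congr (_ - _).
    by apply: eq_bigr => j _; rewrite mxE complete_counts_tail divfK.
  by have := mulr_gt0 z0 n0'; rewrite E subr_gt0 ltr_nat; exact: ltnW.
rewrite kn /=; apply/forallP => i; case: (split_ordP i) => j ->.
  rewrite (ord1 j); apply: boxed.
  have -> : x (lshift d 0) 0 = z.
    have := sum_count_density n0 kn; rewrite -/x big_split_ord big_ord1 /=.
    by rewrite /z => <-; rewrite addrK.
  by [].
by apply: boxed; apply: le_lt_trans (Hu j) _; lra.
Qed.

(** Laplace's method. Up to factors close to 1, the typings with given counts
    contribute exp (- n Phi) times constants, and around psi the exponent is
    the quadratic form of the Hessian at c0; what remains is a Gaussian sum
    over a lattice. The box has to contain psi well inside, so that it covers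
    the window of radius L0 / sqrt n around psi. *)
Lemma local_sum (c0 : K) (phi : 'cV[K]_(1 + d)) (dl : K) :
  (forall i, 0 < phi i 0) -> posdef (hess c0 phi) -> 0 < dl ->
  exists2 rho1, 0 < rho1 & forall rho, 0 < rho -> rho <= rho1 ->
    \forall n \near \oo, forall m psi, `|m%:R / n%:R - c0| < rho ->
      @critical_minima K (1 + d) R r S (m%:R / n%:R) psi -> box phi (rho / 2) psi ->
      log_close dl
        (\sum_(t : {ffun 'I_n -> 'I_(1 + d)} | box phi rho (density K t))
           type_weight r t * (m`!%:R * elem_sym (edge_weights R t) m))
        ((n%:R ^+ 2 / 2) ^+ m *
         (gauss_mass K * Num.sqrt 2 / stirling_const K) ^+ d *
         @minimum_term K (1 + d) R r S n m (m%:R / n%:R) psi).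
Proof.
move=> phi0 Hp dl0.
have lin1 (x y u v : K) : u <= v -> - u < x - y -> 2 * v <= y -> v <= x.
  by move=> *; lra.
have lin2 (u v p w l : K) : u * (p + w) <= u * 1 -> 0 < v -> l <= w * u ->
    l <= u + v + - u * p.
  by move=> *; lra.
have lin3 (x y z : K) : (x < y / 2 * z) = (2 * x < z * y).
  by apply/idP/idP => ?; lra.
have lin4 (x y : K) : 0 < x -> 2 * x <= y -> x <= y by move=> *; lra.
(* the lattice sum costs d + 1 times the error e, and four other estimates are
   used once each *)
set e := dl / (d + 5)%:R; have e0 : 0 < e by rewrite divr_gt0 // ltr0n addnS.
have [rhoA rhoA0 HA] := edge_factor R_sym R_ge0 c0 R_neq0 phi0 e0.
have [k0 HC] := count_term R_ge0 R_neq0 r_gt0 e0.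
have [rhoB rhoB0 HB] := local_quadratic r R_sym R_ge0 R_neq0 phi0 Hp e0.
set A := (1 / 2) *: hess c0 phi.
have half0 : 0 < 1 / 2 :> K by rewrite divr_gt0.
have A_sym : A^T = A by rewrite linearZ /= hess_Phi_sym.
have A_pos : posdef A by move=> u u0; rewrite bilin_scale mulr_gt0 // Hp.
have [L0 [h0 [L00 h00 HL]]] := gauss_lattice_sum A_sym A_pos e0.
have Nsq := near_log_close (nbhs_filter (c0, phi)) (@sqrt_prod_cvg c0 phi) _ e0.
have {}Nsq := Nsq _; have sq0 : 0 < Num.sqrt (\prod_i phi i 0).
  by rewrite sqrtr_gt0 prodr_gt0.
have amp0 := amplitude_gt0 phi0 Hp.
have [rhoC rhoC0 HCC] := nbhs_pair_box (filterI (Nsq sq0)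
  (near_log_close (nbhs_filter (c0, phi)) (@amplitude_cvg c0 phi phi0 Hp) amp0 e0)).
(* all proportions stay above rhoD in a box of radius rhoD *)
have [rhoD rhoD0 HD] : exists2 rhoD, 0 < rhoD & forall i, 2 * rhoD <= phi i 0.
  exists (\big[Num.min/1]_i (phi i 0 / 2)).
    by elim/big_ind: _ => // [a b a0 b0|i _]; rewrite ?lt_min ?a0 // divr_gt0.
  move=> i; rewrite mulrC -ler_pdivlMr // (bigD1 i) //= ge_min lexx //.
exists (Num.min (Num.min rhoA rhoB) (Num.min rhoC rhoD)); first by rewrite !lt_min rhoA0 rhoB0 rhoC0.
move=> rho rho0; rewrite !le_min => /andP [/andP [rA rB] /andP [rC rD]].
set dm : K := rhoD; have rho_half : rho / 2 <= rho by lra.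
(* conditions on n: counts beyond k0, a mesh below h0, and a window of radius
   L0 / sqrt n that fits into the simplex and into the box *)
have Npos : \forall n \near \oo, (0 < n)%N by exists 1%N.
have Ninf (a : K) : \forall n \near \oo, a <= n%:R.
  near=> n; have : (a <= n%:R); last by [].
  apply: le_trans (ler_norm a) _; near: n; exact: nbhs_infty_ger.
have Nsqrt (a : K) : \forall n \near \oo, a <= Num.sqrt n%:R.
  apply: filterS (Ninf (a ^+ 2)) => n Hn.
  apply: le_trans (ler_norm a) _; rewrite -sqrtr_sqr ler_wsqrtr //.
have N1 := Ninf (k0.+1%:R / dm).
have N2 := Nsqrt h0^-1.
have N3 := Nsqrt (L0 / dm).
have N4 := Nsqrt (2 * (d%:R + 1) * L0 / rho + 1).
apply: filterS3 (filterI Npos (HA)) (filterI N1 N2) (filterI N3 N4).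
move=> n [n0 {}HA] [{}N1 {}N2] [{}N3 {}N4] m psi cc psic psib.
set c := m%:R / n%:R in cc psic *.
have [[psi0 spsi] gpsi _] := psic.
have n0' : 0 < n%:R :> K by rewrite ltr0n.
have nn0 : n%:R != 0 :> K by rewrite gt_eqF.
set sn := Num.sqrt (n%:R : K); have sn0 : 0 < sn by rewrite sqrtr_gt0.
have snn0 : sn != 0 by rewrite gt_eqF.
have snE : n%:R = sn ^+ 2 :> K by rewrite sqr_sqrtr // ltW.
have bw rho' x : rho <= rho' -> box phi rho x -> box phi rho' x by exact: box_widen.
have psib' : box phi rho psi := box_widen rho_half psib.
have lower x : box phi rho x -> forall i, dm <= x i 0.
  move=> /forallP bx i; have := bx i; rewrite ltr_norml => /andP [H1 _].
  exact: lin1 rD H1 (HD i).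
have cA : `|c - c0| < rhoA by apply: lt_le_trans cc _.
have cB : `|c - c0| < rhoB by apply: lt_le_trans cc _.
have cC : `|c - c0| < rhoC by apply: lt_le_trans cc _.
set M := (n%:R ^+ 2 / 2) ^+ m.
have M0 : 0 <= M by rewrite exprn_ge0 // divr_ge0 // sqr_ge0.
set A0 := edge_const R c0 phi; have A00 : 0 < A0 by exact: expR_gt0.
have tw0 t : 0 <= type_weight r (t : {ffun 'I_n -> 'I_(1 + d)}).
  by rewrite /type_weight prodr_ge0 // => u _; exact: ltW.
(* the elementary symmetric functions are replaced by their estimate *)
pose F f := M * A0 * (\prod_i r i 0 ^+ f i * qform R (count_density K n f) ^+ m).
have E1 : log_close e
    (\sum_(t : {ffun 'I_n -> 'I_(1 + d)} | box phi rho (density K t))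
           type_weight r t * (m`!%:R * elem_sym (edge_weights R t) m))
    (\sum_(t : {ffun 'I_n -> 'I_(1 + d)} | box phi rho (density K t)) F (type_count t)).
  apply: log_close_sum => t bt.
  have -> : F (type_count t) =
      type_weight r t * ((n%:R ^+ 2 / 2 * qform R (density K t)) ^+ m * edge_const R c0 phi).
    rewrite /F type_weightE -/(type_count t _) exprMn -/M -/A0.
    have -> : count_density K n (type_count t) = density K t by [].
    rewrite (eq_bigr (fun i => r i 0 ^+ type_count t i)) //; ring.
  by apply: log_closeZ => //; apply: HA => //; exact: bw bt.
pose P (k : 'rV['I_n.+1]_d) := (\sum_j k 0%R j <= n)%N &&
  box phi rho (count_density K n (complete_counts k)).
pose x k := count_density K n (@complete_counts d n k).
pose V := (stirling_const K * sn) ^- d / Num.sqrt (\prod_i phi i 0).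
have V0 : 0 < V.
  by rewrite divr_gt0 // invr_gt0 exprn_gt0 // mulr_gt0 // stirling_const_gt0.
pose B k := n%:R * (Phi R r c (x k) - Phi R r c psi).
have E2 : log_close (e + e)
    (\sum_(t : {ffun 'I_n -> 'I_(1 + d)} | box phi rho (density K t)) F (type_count t))
    (M * A0 * (V * expR (- (n%:R * Phi R r c psi))) * \sum_(k | P k) expR (- B k)).
  rewrite (sum_typings_by_counts n (fun f => box phi rho (count_density K n f))) mulr_sumr; apply: log_close_sum => k Pk.
  have /andP [kn kb] := Pk.
  rewrite /F mulrCA -mulrA; apply: log_closeZ; first by rewrite mulr_ge0 // ltW.
  rewrite -[V * _ * _]mulrA -expRD.
  have -> : - (n%:R * Phi R r c psi) - B k = - (n%:R * Phi R r c (x k)) by rewrite /B; ring.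
  apply: (@log_close_trans _ _ _ _ ((stirling_const K * Num.sqrt n%:R) ^- d /
    Num.sqrt (\prod_i x k i 0) * expR (- (n%:R * Phi R r c (x k))))).
    apply: HC; first exact: sum_complete_counts.
    move=> i; have := lower _ kb i; rewrite mxE => H.
    rewrite -(ltr_nat K) -[ltRHS](divfK nn0); apply: lt_le_trans (_ : dm * n%:R <= _).
      move: N1; rewrite ler_pdivrMr // mulrC => N1; apply: lt_le_trans N1.
      by rewrite ltr_nat.
    by rewrite ler_wpM2r // ltW.
  rewrite ![_ * expR _]mulrC; apply: log_closeZ; first exact: expR_ge0.
  rewrite /V -/sn; apply: log_closeZ.
    by rewrite invr_ge0 exprn_ge0 // mulr_ge0 ?(ltW sn0) // ltW // stirling_const_gt0.
  apply: log_closeV => //.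
  by have [] := HCC c _ cC (bw _ _ rC kb).
have hE : sn^-1 <= h0.
  by rewrite -[leRHS]invrK lef_pV2 ?posrE ?invr_gt0.
have E3 : log_close (d.+1%:R * e) (\sum_(k | P k) expR (- B k))
    (sn^-1 ^- d * (gauss_mass K ^+ d / Num.sqrt (\det A))).
  apply: (HL sn^-1 (- sn *: tail psi)) => //; first by rewrite invr_gt0.
  - move=> i; rewrite !mxE.
    have pi := lower psi psib' (rshift 1 i); have p0 := lower psi psib' (lshift d 0).
    have L0n : L0 <= dm * sn by move: N3; rewrite ler_pdivrMr // mulrC.
    split.
      rewrite mulNr lerN2; apply: le_trans L0n _.
      by rewrite mulrC ler_wpM2l // ltW.
    have le1 : psi (rshift 1 i) 0 + dm <= 1.
      rewrite -spsi big_split_ord big_ord1 /= addrC; apply: lerD => //.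
      by rewrite (bigD1 i) //= lerDl sumr_ge0 // => j _; exact: ltW.
    have -> : sn^-1 * n.+1%:R = sn + sn^-1.
      by rewrite -natr1 snE; field.
    have H : sn * (psi (rshift 1 i) 0 + dm) <= sn * 1 by rewrite ler_wpM2l // ltW.
    have sni : 0 < sn^-1 by rewrite invr_gt0.
    exact: lin2 H sni L0n.
  - move=> k Pk; have /andP [kn kb] := Pk.
    have [B' HB' EB] := HB c psi (x k) cB (bw _ _ rB psib') (bw _ _ rB kb) spsi (sum_count_density n0 kn).
    rewrite tail_count_density // -/(x k) -/sn bilin_scale bilinZ -snE.
    have -> : B k = n%:R / 2 * B'.
      by rewrite /B EB gpsi mul0mx mxE; field.
    have -> (z : K) : 1 / 2 * (n%:R * z) = n%:R / 2 * z by field.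
    by apply: log_closeZ => //; rewrite divr_ge0 // ltW.
  - move=> k Hk.
    have Hu j : `|x k (rshift 1 j) 0 - psi (rshift 1 j) 0| <= L0 / sn.
      have := Hk j; rewrite tail_count_density // -/(x k) -/sn.
      have -> : (sn *: (tail (x k) - tail psi)) 0 j =
          sn * (x k (rshift 1 j) 0 - psi (rshift 1 j) 0) by rewrite !mxE.
      by rewrite normrM (gtr0_norm sn0) ler_pdivlMr // mulrC.
    apply: (complete_counts_box n0 psib spsi _ Hu); last 1 first.
    - rewrite mulrA ltr_pdivrMr // lin3 -ltr_pdivrMr //.
      by apply: lt_le_trans N4; rewrite mulrA ltrDl.
    - by move=> i; apply: le_trans rD _; exact: lin4 rhoD0 (HD i).
    by rewrite divr_gt0.
have VE : M * A0 * (V * expR (- (n%:R * Phi R r c psi))) *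
      (sn^-1 ^- d * (gauss_mass K ^+ d / Num.sqrt (\det A))) =
    M * (gauss_mass K * Num.sqrt 2 / stirling_const K) ^+ d *
    expR (- (n%:R * Phi R r c psi)) * amplitude c0 phi.
  have s2 : 0 < Num.sqrt 2 :> K by rewrite sqrtr_gt0.
  have -> : Num.sqrt (\det A) = (Num.sqrt 2)^-1 ^+ d * Num.sqrt (\det (hess c0 phi)).
    rewrite /A detZ; have -> : 1 / 2 = (Num.sqrt 2)^-1 ^+ 2 :> K.
      by rewrite exprVn sqr_sqrtr // mul1r.
    rewrite -exprM mulnC exprM sqrtrM ?sqr_ge0 // sqrtr_sqr ger0_norm //.
  have dH0 : 0 < \det (hess c0 phi) by apply: posdef_det_gt0 => //; exact: hess_Phi_sym.
  rewrite /V /amplitude -/A0 sqrtrM ?(ltW dH0) // !exprMn !exprVn.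
  have := stirling_const_gt0 K; set C := stirling_const K => C0.
  have : 0 < Num.sqrt (\det (hess c0 phi)) by rewrite sqrtr_gt0.
  set D := Num.sqrt (\det _) => D0.
  have Cd : C ^+ d != 0 by rewrite expf_neq0 // gt_eqF.
  have snd : sn ^+ d != 0 by rewrite expf_neq0.
  have s2d : Num.sqrt 2 ^+ d != 0 :> K by rewrite expf_neq0 // gt_eqF.
  have Dn0 : D != 0 by rewrite gt_eqF.
  have Pn0 : Num.sqrt (\prod_i phi i 0) != 0 by rewrite gt_eqF.
  field.
  by rewrite Cd snd s2d Dn0 Pn0.
rewrite minimum_termE //.
have -> : dl = e + ((e + e) + (d.+1%:R * e + e)).
  have : (d + 5)%:R * e = dl by rewrite mulrC divfK // pnatr_eq0 addnS.
  move=> <-; rewrite natrD -natr1; ring.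
apply: log_close_trans E1 _; apply: log_close_trans E2 _.
apply: (@log_close_trans _ _ _ _ (M * A0 * (V * expR (- (n%:R * Phi R r c psi))) *
      (sn^-1 ^- d * (gauss_mass K ^+ d / Num.sqrt (\det A))))).
  apply: log_closeZ => //.
  by rewrite mulr_ge0 //; [rewrite mulr_ge0 // ltW | rewrite mulr_ge0 ?expR_ge0 // ltW].
rewrite VE [X in log_close _ _ X]mulrA; apply: log_closeZ; last first.
  apply: log_close_sym.
  by have [] := HCC c _ cC (bw _ _ rC psib').
rewrite mulr_ge0 ?expR_ge0 // mulr_ge0 // exprn_ge0 // mulr_ge0 // ?invr_ge0.
  by rewrite mulr_ge0 ?sqrtr_ge0 // ltW // gauss_mass_gt0.
by rewrite ltW // stirling_const_gt0.
Unshelve. all: by end_near.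
Qed.

End LocalSum.

(** * Contribution of the remaining types *)

Lemma elem_sym_le_power (K : realType) (s : seq K) m : (forall w, w \in s -> 0 <= w) ->
  m`!%:R * elem_sym s m <= power_sum s 1 ^+ m.
Proof.
move=> s0; elim: m => [|m IH]; first by rewrite elem_sym0 expr0 mulr1.
rewrite factS mulnC natrM -mulrA exprS.
apply: le_trans (_ : m`!%:R * (power_sum s 1 * elem_sym s m) <= _).
  by rewrite ler_wpM2l ?ler0n // newton_upper1.
by rewrite mulrCA ler_wpM2l // power_sum_ge0.
Qed.

(** The left-hand side is the probability that independent vertices with type
    distribution x realize the counts f. *)
Lemma typings_probability_le1 (K : realType) (q n : nat) (f : 'I_q -> nat) (x : 'cV[K]_q) :
  (forall i, 0 <= x i 0) -> \sum_i x i 0 = 1 ->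
  #|@typings_with_counts q n f|%:R * \prod_i x i 0 ^+ f i <= 1.
Proof.
move=> x0 sx.
have E : \sum_(t : {ffun 'I_n -> 'I_q}) type_weight x t = 1.
  rewrite /type_weight -(bigA_distr_bigA (fun _ i => x i 0)) /=.
  by rewrite sx prodr_const expr1n.
rewrite mulr_natl -sumr_const -[leRHS]E [leRHS](bigID (mem (@typings_with_counts q n f))) /=.
rewrite -[leLHS]addr0; apply: lerD; last first.
  by apply: sumr_ge0 => t _; rewrite /type_weight prodr_ge0.
rewrite le_eqVlt; apply/orP; left; apply/eqP; apply: eq_bigr => t /forallP H.
by rewrite type_weightE; apply: eq_bigr => i _; rewrite -(eqP (H i)).
Qed.

Section Remainder.
Context (K : realType) (d : nat) (R : 'M[K]_(1 + d)) (r : 'cV[K]_(1 + d)).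
Hypothesis R_sym : R^T = R.
Hypothesis R_ge0 : forall i j, 0 <= R i j.
Hypothesis r_gt0 : forall i, 0 < r i 0.

(** Unlike in type_weight_Phi some counts may vanish; a factor 0^0 then matches
    the convention 0 log 0 = 0. *)
Lemma type_weight_growth (n m : nat) (f : 'I_(1 + d) -> nat)
    (x := count_density K n f) : (0 < n)%N ->
  \prod_i r i 0 ^+ f i * qform R x ^+ m =
  \prod_i x i 0 ^+ f i * growth R r (m%:R / n%:R) x ^+ n.
Proof.
move=> n0; have nn0 : n%:R != 0 :> K by rewrite pnatr_eq0 -lt0n.
have x0 i : 0 <= x i 0 by rewrite mxE divr_ge0.
rewrite /growth exprMn mulrA; congr (_ * _); last first.
  rewrite -[RHS]powR_mulrn ?powR_ge0 // -powRrM divfK // powR_mulrn //.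
  exact: qform_ge0.
rewrite -expRM_natl mulrN /entropy mulr_sumr -sumrN expR_sum -big_split /=.
apply: eq_bigr => i _.
have -> : - (n%:R * (x i 0 * (ln (x i 0) - ln (r i 0)))) =
    (f i)%:R * (ln (r i 0) - ln (x i 0)).
  have -> : (f i)%:R = n%:R * x i 0 by rewrite mxE mulrC divfK.
  by ring.
have [->|fi] := posnP (f i); first by rewrite !expr0 mul0r expR0 mulr1.
have xi : 0 < x i 0 by rewrite mxE divr_gt0 // ltr0n.
rewrite expRM_natl expRB !lnK ?posrE // exprMn exprVn mulrCA.
by rewrite divff ?mulr1 // expf_neq0 // gt_eqF.
Qed.

(** There are at most (n + 1)^d possible counts. For each of them, the growth
    rate bounds the total weight of its typings, as the multinomial factor is a
    probability. *)
Lemma far_sum (n m : nat) (mu : K) (far : pred 'cV[K]_(1 + d)) : (0 < n)%N -> 0 <= mu ->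
  (forall x, simplex x -> far x -> growth R r (m%:R / n%:R) x <= mu) ->
  \sum_(t : {ffun 'I_n -> 'I_(1 + d)} | far (density K t))
     type_weight r t * (m`!%:R * elem_sym (edge_weights R t) m) <=
  (n%:R ^+ 2 / 2) ^+ m * (n.+1%:R ^+ d * mu ^+ n).
Proof.
move=> n0 mu0 Hmu; have nn0 : n%:R != 0 :> K by rewrite pnatr_eq0 -lt0n.
set M := (n%:R ^+ 2 / 2) ^+ m.
have M0 : 0 <= M by rewrite exprn_ge0 // divr_ge0 // sqr_ge0.
pose F (f : 'I_(1 + d) -> nat) :=
  M * (\prod_i r i 0 ^+ f i * qform R (count_density K n f) ^+ m).
apply: le_trans (_ : \sum_(t : {ffun 'I_n -> 'I_(1 + d)} |
   far (count_density K n (type_count t))) F (type_count t) <= _).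
  apply: ler_sum => t _; rewrite /F type_weightE [leRHS]mulrCA.
  rewrite ler_wpM2l ?prodr_ge0 // => [i _|]; first by rewrite exprn_ge0 // ltW.
  rewrite -exprMn; apply: le_trans (elem_sym_le_power _ (edge_weights_ge0 R_ge0)) _.
  have [x0 sx] := @density_simplex K _ n t n0.
  rewrite lerXn2r ?nnegrE ?power_sum_ge0 //; first exact: edge_weights_ge0.
    by rewrite mulr_ge0 ?divr_ge0 ?sqr_ge0 // qform_ge0.
  rewrite (power_sum_edge_weights 1 t R_sym n0) entry_pow1 gerBl.
  rewrite mulr_ge0 ?divr_ge0 // sumr_ge0 // => i _.
  by rewrite mulr_ge0.
rewrite (sum_typings_by_counts n (fun f => far (count_density K n f))).
apply: le_trans (_ : \sum_(k : 'rV['I_n.+1]_d) M * mu ^+ n <= _); last first.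
  by rewrite sumr_const card_mx card_ord mul1n -[leLHS]mulr_natl natrX mulrCA.
rewrite big_mkcond; apply: ler_sum => k _; case: ifP => [/andP [kn kfar]|_]; last first.
  by rewrite mulr_ge0 // exprn_ge0.
set f := complete_counts k in kfar *.
rewrite /F mulrCA ler_wpM2l // type_weight_growth // mulrA.
have xS : simplex (count_density K n f).
  by split=> [i|]; [rewrite mxE divr_ge0 | exact: sum_count_density].
rewrite -[leRHS]mul1r ler_pM ?exprn_ge0 ?growth_ge0 //.
- by rewrite mulr_ge0 // prodr_ge0 // => i _; rewrite exprn_ge0 //; case: xS.
- by case: xS => x0 sx; exact: typings_probability_le1.
by rewrite lerXn2r ?nnegrE ?growth_ge0 // Hmu.
Qed.

End Remainder.

Lemma near_seq (T : Type) (F : set_system T) (FF : Filter F) (J : eqType) (X : seq J)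
    (P : J -> T -> Prop) : (forall j, j \in X -> \forall t \near F, P j t) ->
  \forall t \near F, forall j, j \in X -> P j t.
Proof.
elim: X => [|j X IH] H; first exact: nearW.
have N1 := H j (mem_head _ _).
have N2 := IH (fun i Xi => H i (@mem_behead _ (j :: X) i Xi)).
by apply: filterS2 N1 N2 => t Pj PX i; rewrite in_cons => /predU1P [->|/PX].
Qed.

Lemma sum_split_cover (K : realType) (I : finType) (J : eqType) (X : seq J)
    (b : J -> pred I) (G : I -> K) : uniq X ->
  (forall i j j', j \in X -> j' \in X -> b j i -> b j' i -> j = j') ->
  \sum_i G i = \sum_(j <- X) \sum_(i | b j i) G i +
               \sum_(i | ~~ has (fun j => b j i) X) G i.
Proof.
elim: X => [|j X IH] /=; first by rewrite big_nil add0r.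
move=> /andP [jX uX] disj; rewrite big_cons IH // => [|i j1 j2 X1 X2]; last first.
  by apply: disj; rewrite in_cons ?X1 ?X2 orbT.
rewrite [X in _ + X = _](bigID (b j)) /= addrCA -!addrA; congr (_ + _); last first.
  by congr (_ + _); apply: eq_bigl => i; rewrite negb_or andbC.
apply: eq_bigl => i; rewrite andbC; case bji : (b j i) => //=.
apply/negP => /hasP [j' Xj' bj'].
move: jX; rewrite (disj i j j' _ _ bji bj') ?mem_head ?Xj' //.
by rewrite in_cons Xj' orbT.
Qed.

(** With s bounded by exp (- a), the factor (n + 1)^d costs at most half of the
    exponent. *)
Lemma near_polynomial_geometric (K : realType) (d : nat) (s e : K) : 0 <= s -> s < 1 -> 0 < e ->
  \forall n \near \oo, n.+1%:R ^+ d * s ^+ n <= e.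
Proof.
move=> s0 s1 e0; (* the maximum makes the logarithm meaningful when s = 0 *)
set s' := Num.max s (1 / 2).
have s'0 : 0 < s' by rewrite lt_max; apply/orP; right; lra.
have s'1 : s' < 1 by rewrite gt_max s1; lra.
set a := - ln s'; have a0 : 0 < a by rewrite oppr_gt0 ln_lt0 // s'0.
set b := Num.min 1 (a / (2 * d.+1%:R)).
have b0 : 0 < b by rewrite lt_min ltr01 divr_gt0 // mulr_gt0.
have poly n : n.+1%:R <= b^-1 * expR (n%:R * (a / (2 * d.+1%:R))).
  rewrite mulrC ler_pdivlMr //; apply: le_trans (expR_ge1Dx _).
  rewrite -natr1 mulrDl mul1r addrC; apply: lerD; first by rewrite ge_min lexx.
  by rewrite ler_wpM2l // ge_min lexx orbT.
have bound n : n.+1%:R ^+ d * s ^+ n <= b^-1 ^+ d * expR (- (n%:R * (a / 2))).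
  apply: le_trans (_ : (b^-1 * expR (n%:R * (a / (2 * d.+1%:R)))) ^+ d * s' ^+ n <= _).
    rewrite ler_pM ?exprn_ge0 //; first by rewrite lerXn2r ?nnegrE ?mulr_ge0 ?expR_ge0 ?invr_ge0 // ltW.
    by rewrite lerXn2r ?nnegrE // ?(ltW s'0) // le_max lexx.
  rewrite exprMn -mulrA ler_wpM2l ?exprn_ge0 ?invr_ge0 ?(ltW b0) //.
  have -> : s' = expR (- a) by rewrite opprK lnK.
  rewrite -!expRM_natl -expRD ler_expR.
  have : d%:R * (n%:R * (a / (2 * d.+1%:R))) <= n%:R * (a / 2).
    rewrite mulrCA ler_wpM2l // invfM mulrCA ler_wpM2l ?(ltW a0) //.
    by rewrite mulrA ler_pdivrMr // mulrC ler_wpM2l ?invr_ge0 // ler_nat.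
  have -> : n%:R * - a = - (n%:R * (a / 2)) - n%:R * (a / 2) by field.
  by move: (d%:R * _) (n%:R * (a / 2)) => X Y; lra.
have Nn : \forall n \near \oo, b^-1 ^+ d / e / (a / 2) <= n%:R.
  near=> n; apply: le_trans (ler_norm _) _; near: n; exact: nbhs_infty_ger.
apply: filterS Nn => n Hn; apply: le_trans (bound n) _.
rewrite expRN ler_pdivrMr ?expR_gt0 // -ler_pdivrMl //.
rewrite mulrC; apply: le_trans (_ : n%:R * (a / 2) <= _).
  by rewrite -ler_pdivrMr // divr_gt0.
by apply: le_trans (expR_ge1Dx _); rewrite lerDr.
Unshelve. all: by end_near.
Qed.

(** * Assembling the contributions *)

Lemma log_close_sum_seq (K : realType) (J : eqType) (X : seq J) (e : K) (F G : J -> K) :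
  (forall j, j \in X -> log_close e (F j) (G j)) ->
  log_close e (\sum_(j <- X) F j) (\sum_(j <- X) G j).
Proof.
move=> H; split; rewrite mulr_sumr ![\sum_(_ <- X) _]big_seq; apply: ler_sum => j Xj;
  by case: (H j Xj).
Qed.

Lemma near_prodI (T U : Type) (F : set_system T) (G : set_system U) (A : set T) (B : set U)
    (P : T -> U -> Prop) : F A -> G B -> (forall t u, A t -> B u -> P t u) ->
  \forall t \near F & u \near G, P t u.
Proof. by move=> FA GB H; exists (A, B) => // -[t u] [/= At Bu]; exact: H. Qed.

Section Assembly.
Context (K : realType) (d : nat) (R : 'M[K]_(1 + d)) (r : 'cV[K]_(1 + d)).
Hypothesis R_sym : R^T = R.
Hypothesis R_ge0 : forall i j, 0 <= R i j.
Hypothesis R_neq0 : R != 0.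
Hypothesis r_gt0 : forall i, 0 < r i 0.

Let S := std_directions K d.
Let hess c x : 'M[K]_d := @hess_Phi K (1 + d) R S c x.
Let crit c : set 'cV[K]_(1 + d) := @critical_minima K (1 + d) R r S c.
Let kappa : K := gauss_mass K * Num.sqrt 2 / stirling_const K.

Lemma kappa_gt0 : 0 < kappa.
Proof.
by rewrite divr_gt0 ?stirling_const_gt0 // mulr_gt0 ?gauss_mass_gt0 // sqrtr_gt0.
Qed.

(** Around c0, every critical minimum phi at c0 has one successor psi phi at c,
    and these are all the critical minima at c. Each box around some phi
    contributes the summand of psi phi by local_sum. The remaining typings are
    negligible in comparison with the summand of a global minimum: their growth
    rate is at most mu, while near the global minimum it is at least nu > mu.
    A local minimum that is not global has a negligible summand too, and
    the same estimate covers it. *)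
Lemma SG_asymptotics_at (c0 dl : K) : 0 <= c0 ->
  (forall x, simplex_interior x -> \det (hess c0 x) != 0) -> 0 < dl ->
  \forall c \near c0 & n \near \oo, forall m, c = m%:R / n%:R ->
    log_close dl (SG R r n m) (kappa ^+ d * @SG_estimate K (1 + d) R r S n m).
Proof.
move=> c00 nondeg dl0.
have fin := crit_finite R_sym R_ge0 R_neq0 r_gt0 c00 nondeg; rewrite -/(crit c0) in fin.
set X : seq 'cV[K]_(1 + d) := finmap.enum_fset (fset_set (crit c0)).
have XP phi : (phi \in X) = (phi \in crit c0) by rewrite in_fset_set.
have uX : uniq X by exact: finmap.fset_uniq.
have Xcrit phi : phi \in X -> crit c0 phi by rewrite XP inE.
have Xpos phi : phi \in X -> forall i, 0 < phi i 0 by move=> /Xcrit [[]].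
have Xpd phi : phi \in X -> posdef (hess c0 phi).
  by move=> /Xcrit Hphi; exact: (crit_posdef R_sym R_ge0 R_neq0 nondeg Hphi).
have [ps psS psmax] := growth_has_max r R_ge0 c00.
have psc : crit c0 ps := growth_max_crit R_sym R_ge0 R_neq0 c00 psS psmax.
have psX : ps \in X by rewrite XP inE.
(* half of the tolerance is for the boxes, the rest absorbs the other typings *)
have dl20 : 0 < dl / 2 by rewrite divr_gt0.
have dl_half : dl / 2 < dl by lra.
have dl_neg : - dl <= - (dl / 2) by lra.
pose Loc rho phi n : Prop := forall m psi, `|m%:R / n%:R - c0| < rho ->
      crit (m%:R / n%:R) psi -> box phi (rho / 2) psi ->
      log_close (dl / 2)
        (\sum_(t : {ffun 'I_n -> 'I_(1 + d)} | box phi rho (density K t))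
           type_weight r t * (m`!%:R * elem_sym (edge_weights R t) m))
        ((n%:R ^+ 2 / 2) ^+ m * kappa ^+ d *
         @minimum_term K (1 + d) R r S n m (m%:R / n%:R) psi).
(* a common radius of pairwise disjoint boxes *)
have N1 : \forall rho \near (0 : K)^'+, forall phi, phi \in X ->
    \forall n \near \oo, Loc rho phi n.
  apply: near_seq => phi phiX.
  have [rho1 rho10 H] := local_sum R_sym R_ge0 R_neq0 r_gt0 (Xpos _ phiX) (Xpd _ phiX) dl20.
  have M1 : \forall rho \near (0 : K)^'+, 0 < rho by exact: nbhs_right_gt.
  have M2 : \forall rho \near (0 : K)^'+, rho <= rho1 by exact: nbhs_right_le.
  by apply: filterS2 M1 M2 => rho; exact: H.
have N2 : \forall rho \near (0 : K)^'+, forall phi, phi \in X ->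
    forall c x y, `|c - c0| < rho -> box phi (2 * rho) x -> box phi (2 * rho) y ->
      crit c x -> crit c y -> x = y.
  apply: near_seq => phi phiX.
  have [rho1 rho10 H] := crit_unique R_sym R_ge0 R_neq0 nondeg (Xcrit _ phiX).
  have rho12 : 0 < rho1 / 2 by rewrite divr_gt0.
  have M1 : \forall rho \near (0 : K)^'+, 0 < rho by exact: nbhs_right_gt.
  have M2 : \forall rho \near (0 : K)^'+, rho <= rho1 / 2 by exact: nbhs_right_le.
  apply: filterS2 M1 M2 => rho rho0 rho_le c x y cc bx by_.
  have rr : rho <= rho1 by lra.
  have rr2 : 2 * rho <= rho1 by lra.
  by apply: (H c); [exact: lt_le_trans rr | exact: box_widen bx | exact: box_widen by_].
have N3 : \forall rho \near (0 : K)^'+, 0 < rho by exact: nbhs_right_gt.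
have [rho [H1 [H2 rho0]]] := filter_ex (filterI N1 (filterI N2 N3)).
have rho_half : rho / 2 < rho by lra.
have rho20 : 0 < rho / 2 by rewrite divr_gt0.
have wide (phi y : 'cV[K]_(1 + d)) : box phi (rho / 2) y -> box phi (2 * rho) y.
  by apply: box_widen; lra.
have cc00 : `|c0 - c0| < rho by rewrite subrr normr0.
have disj (x : 'cV[K]_(1 + d)) phi phi' : phi \in X -> phi' \in X ->
    box phi rho x -> box phi' rho x -> phi = phi'.
  move=> pX pX' /forallP b /forallP b'.
  apply: (H2 phi pX c0) => //; [apply: box_refl; lra | | exact: Xcrit | exact: Xcrit].
  apply/forallP => i; have := b i; have := b' i; rewrite distrC => h1 h2.
  have -> : phi' i 0 - phi i 0 = (phi' i 0 - x i 0) + (x i 0 - phi i 0) by ring.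
  by apply: le_lt_trans (ler_normD _ _) _; lra.
(* mu bounds the growth rate outside of the boxes, nu separates it from the
   maximum *)
have [mu0 mu0_lt Hmu0] := growth_gap R_sym R_ge0 R_neq0 c00 rho0 psc psmax.
set g := growth R r c0 ps in mu0_lt.
have g0 : 0 < g.
  by rewrite /g growth_Phi ?expR_gt0 // qform_gt0 //; exact: Xpos.
set mu := Num.max mu0 0.
have mu_ge0 : 0 <= mu by rewrite le_max lexx orbT.
have mu_lt : mu < g by rewrite gt_max mu0_lt.
set nu := (mu + g) / 2; have [mu_nu nu_g] : mu < nu /\ nu < g by rewrite /nu; lra.
have nu0 : 0 < nu by apply: le_lt_trans mu_nu.
have ps0 := Xpos _ psX.
have amp0 := amplitude_gt0 R_sym ps0 (Xpd _ psX).
have ps_ge0 i : 0 <= ps i 0 by exact: ltW.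
have Ngr : \forall p \near (c0, ps), nu <= growth R r p.1 p.2.
  have Hg := @growth_cvg K _ R r c0 ps ps_ge0 (qform_gt0 R_ge0 R_neq0 ps0).
  exact: (cvgr_ge _ Hg _ nu_g).
have [rho' rho'0 Hrho'] := nbhs_pair_box (filterI Ngr
  (near_log_close (nbhs_filter (c0, ps))
    (amplitude_cvg R_sym R_ge0 R_neq0 ps0 (Xpd _ psX)) amp0 (@ltr01 K))).
set rho'' := Num.min (rho / 2) rho'.
have rho''0 : 0 < rho'' by rewrite lt_min rho20.
have Nex : \forall c \near c0, forall phi, phi \in X -> 0 <= c ->
    exists2 psi, crit c psi & box phi (rho / 2) psi.
  apply: (@near_seq _ (nbhs c0) _ _ X (fun phi c => 0 <= c ->
    exists2 psi, crit c psi & box phi (rho / 2) psi)) => phi phiX.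
  exact: (crit_exists R_sym R_ge0 R_neq0 nondeg (Xcrit _ phiX) rho20).
have Nps := crit_exists R_sym R_ge0 R_neq0 nondeg psc rho''0.
have Nall := crit_near_crit R_sym R_ge0 R_neq0 r_gt0 nondeg rho20.
have Nc (a : K) : 0 < a -> \forall c \near c0, `|c - c0| < a.
  by move=> a0; apply/nbhs_ballP; exists a => // c; rewrite /ball /= distrC.
set amin := expR (- 1) * amplitude R c0 ps.
have amin0 : 0 < amin by rewrite mulr_gt0 // expR_gt0.
set e1 := (expR dl - expR (dl / 2)) * (kappa ^+ d * amin).
have e10 : 0 < e1.
  apply: mulr_gt0; first by rewrite subr_gt0 ltr_expR.
  by apply: mulr_gt0 => //; rewrite exprn_gt0 // kappa_gt0.
have s1 : mu / nu < 1 by rewrite ltr_pdivrMr // mul1r.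
have s0 : 0 <= mu / nu by rewrite divr_ge0 // ltW.
have Ngeo := near_polynomial_geometric d s0 s1 e10.
have Nloc : \forall n \near \oo, forall phi, phi \in X -> Loc rho phi n.
  exact: near_seq.
have Npos : \forall n \near \oo, (0 < n)%N by exists 1%N.
have NC := filterI (Nc _ rho0) (filterI (Nc _ rho'0) (filterI Nex (filterI Nps (filterI Nall Hmu0)))).
have NN := filterI Npos (filterI Ngeo Nloc).
have FN : Filter (nbhs \oo) by exact: eventually_filter.
have FC : Filter (nbhs c0) by exact: nbhs_filter.
apply: (near_prodI (P := fun c n => forall m, c = m%:R / n%:R -> log_close dl (SG R r n m)
  (kappa ^+ d * @SG_estimate K (1 + d) R r S n m)) (NC FC FC FC FC FC) (NN FN FN)) => c n.
move=> [crho [crho' [{}Nex [{}Nps [{}Nall {}Hmu0]]]]] [n0 [{}Ngeo {}Nloc]] m cE.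
have nn0 : n%:R != 0 :> K by rewrite pnatr_eq0 -lt0n.
have c_ge0 : 0 <= c by rewrite cE divr_ge0.
set f := fun y => @minimum_term K (1 + d) R r S n m c y.
have fE y : crit c y -> f y = expR (- (n%:R * Phi R r c y)) * amplitude R c y.
  by move=> [[y0 _] _ _]; rewrite /f minimum_termE.
have f_ge0 y : crit c y -> 0 <= f y.
  move=> yc; rewrite fE // mulr_ge0 ?expR_ge0 // mulr_ge0 ?expR_ge0 //.
have [phi|psi Hpsi] := @choice 'cV[K]_(1 + d) 'cV[K]_(1 + d)
    (fun phi y => phi \in X -> crit c y /\ box phi (rho / 2) y).
  have [pX|_] := boolP (phi \in X); last by exists phi.
  by have [y yc yb] := Nex phi pX c_ge0; exists y.
have bij : set_bij (crit c0) (crit c) psi.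
  split=> [phi phic|phi phi'|y yc].
  - by have [] := Hpsi phi _ => //; rewrite XP inE.
  - rewrite -!XP => pX pX' E; have [_ b1] := Hpsi phi pX; have [_ b2] := Hpsi phi' pX'.
    apply: (disj (psi phi)) => //; first exact: box_widen (ltW rho_half) b1.
    by rewrite E; exact: box_widen (ltW rho_half) b2.
  have [phi phic pb] := Nall c_ge0 y yc.
  have pX : phi \in X by rewrite XP inE.
  exists phi => //; have [pc pb'] := Hpsi phi pX.
  by apply: (H2 phi pX c) => //; exact: wide.
have sumE : \sum_(y \in crit c) f y = \sum_(phi <- X) f (psi phi).
  by rewrite (reindex_fsbig psi _ _ _ bij) fsbig_finite.
pose M : K := (n%:R ^+ 2 / 2) ^+ m.
have M0 : 0 <= M by rewrite exprn_ge0 // divr_ge0 // sqr_ge0.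
have mf0 : 0 < m`!%:R :> K by rewrite ltr0n fact_gt0.
pose G (t : {ffun 'I_n -> 'I_(1 + d)}) := type_weight r t * (m`!%:R * elem_sym (edge_weights R t) m).
set T := M * kappa ^+ d * \sum_(phi <- X) f (psi phi).
have SGE : SG R r n m = (m`!%:R)^-1 * \sum_t G t.
  rewrite SG_elem_sym mulr_sumr; apply: eq_bigr => t _; rewrite /G.
  by rewrite [in RHS]mulrCA mulKf // gt_eqF.
have estE : kappa ^+ d * @SG_estimate K (1 + d) R r S n m = (m`!%:R)^-1 * T.
  have ME : M = n%:R ^+ (2 * m) / 2 ^+ m by rewrite /M expr_div_n -exprM.
  rewrite /SG_estimate -cE sumE /T ME.
  have mfn : m`!%:R != 0 :> K by rewrite gt_eqF.
  have p2n : 2 ^+ m != 0 :> K by rewrite expf_neq0.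
  by field; rewrite mfn p2n.
rewrite SGE estE; apply: log_closeZ; first by rewrite invr_ge0 ltW.
have disj' t phi phi' : phi \in X -> phi' \in X -> box phi rho (density K (t : {ffun 'I_n -> 'I_(1 + d)})) ->
    box phi' rho (density K t) -> phi = phi' by exact: disj.
rewrite (@sum_split_cover _ _ _ X (fun phi t => box phi rho (density K t)) G uX disj').
set main := \sum_(phi <- X) _; set rest := \sum_(t | _) _.
have Hmain : log_close (dl / 2) main T.
  rewrite /T mulr_sumr; apply: log_close_sum_seq => phi pX.
  have [pc pb] := Hpsi phi pX.
  by have := Nloc phi pX m (psi phi); rewrite -cE; apply.
have rest_ge0 : 0 <= rest.
  apply: sumr_ge0 => t _; apply: mulr_ge0.
    by rewrite /type_weight prodr_ge0 // => u _; exact: ltW.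
  by rewrite mulr_ge0 ?(ltW mf0) // elem_sym_ge0 //; exact: edge_weights_ge0.
have f_ps : nu ^+ n * amin <= \sum_(phi <- X) f (psi phi).
  have [y yc yb] := Nps c_ge0; have [pc pb] := Hpsi ps psX.
  have yb1 : box ps (rho / 2) y by apply: box_widen yb; rewrite ge_min lexx.
  have yb2 : box ps rho' y by apply: box_widen yb; rewrite ge_min lexx orbT.
  have psiE : psi ps = y by apply: (H2 ps psX c) => //; exact: wide.
  have [/= h1 [h2 _]] := Hrho' c y crho' yb2.
  rewrite (bigD1_seq ps) //= psiE -[leLHS]addr0; apply: lerD; last first.
    rewrite big_seq_cond; apply: sumr_ge0 => phi /andP [pX _].
    by apply: f_ge0; have [] := Hpsi phi pX.
  rewrite fE //; apply: ler_pM => //; [by rewrite exprn_ge0 // ltW | exact: ltW |].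
  have [[y0 _] _ _] := yc.
  rewrite -mulrN expRM_natl -growth_Phi ?qform_gt0 //.
  by rewrite lerXn2r ?nnegrE ?(ltW nu0) ?growth_ge0.
have rest_le : rest <= (expR dl - expR (dl / 2)) * T.
  have Hfar x : simplex x -> ~~ has (fun phi => box phi rho x) X -> growth R r (m%:R / n%:R) x <= mu.
    move=> xS /hasPn xfar; rewrite -cE; apply: le_trans (_ : mu0 <= _).
      by apply: Hmu0 => // z zc; apply: xfar; rewrite XP inE.
    by rewrite le_max lexx.
  have Hr := @far_sum K d R r R_sym R_ge0 r_gt0 n m mu
    (fun x => ~~ has (fun phi => box phi rho x) X) n0 mu_ge0 Hfar.
  apply: le_trans Hr _.
  rewrite -/M /T -[M * _ * _]mulrA [leRHS]mulrCA; apply: ler_wpM2l => //.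
  have Ee : e1 * nu ^+ n = (expR dl - expR (dl / 2)) * (kappa ^+ d * (nu ^+ n * amin)).
    by rewrite /e1; ring.
  apply: le_trans (_ : e1 * nu ^+ n <= _).
    rewrite -ler_pdivrMr ?exprn_gt0 // -mulrA -expr_div_n //.
  rewrite Ee; apply: ler_wpM2l.
    by rewrite subr_ge0 ler_expR ltW.
  by rewrite ler_wpM2l // exprn_ge0 // ltW // kappa_gt0.
have T0 : 0 <= T.
  apply: mulr_ge0; first by rewrite mulr_ge0 // exprn_ge0 // ltW // kappa_gt0.
  apply: le_trans f_ps; apply: mulr_ge0; last exact: ltW.
  by rewrite exprn_ge0 // ltW.
case: Hmain => [Hlo Hup]; split.
  apply: le_trans (_ : main <= _); last by rewrite lerDl.
  by apply: le_trans Hlo; rewrite ler_wpM2r // ler_expR.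
apply: le_trans (lerD Hup rest_le) _.
by rewrite -mulrDl addrC subrK.
Qed.

End Assembly.

(** * The value of the constant *)

Lemma log_close_dist (K : realType) (e X Y : K) : 0 < e ->
  log_close (ln (1 + e)) X Y -> `|X - Y| <= e * `|Y|.
Proof.
move=> e0; have e1 : 0 < 1 + e by lra.
rewrite /log_close expRN lnK ?posrE // => -[H1 H2].
have E : (1 + e)^-1 * (1 + e) = 1 by rewrite mulVf // gt_eqF.
have i0 : 0 < (1 + e)^-1 by rewrite invr_gt0.
have i1 : 1 - e <= (1 + e)^-1 by nra.
have Y0 : 0 <= Y by nra.
rewrite (ger0_norm Y0) ler_norml; apply/andP; split; nra.
Qed.

Lemma log_close_eq (K : realType) (X Y : K) : 0 < Y ->
  (forall e, 0 < e -> log_close e X Y) -> X = Y.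
Proof.
move=> Y0 H; apply/eqP; rewrite -subr_eq0 -normr_le0; apply/ler_addgt0Pl => e e0.
have e1 : 0 < e / Y by rewrite divr_gt0.
have l0 : 0 < ln (1 + e / Y) by rewrite ln_gt0 // ltrDl.
have := log_close_dist e1 (H _ l0).
by rewrite (gtr0_norm Y0) divfK ?gt_eqF // addr0.
Qed.

Section Uniform.
Context (K : realType) (d : nat) (R : 'M[K]_(1 + d)) (r : 'cV[K]_(1 + d)).
Hypothesis R_sym : R^T = R.
Hypothesis R_ge0 : forall i j, 0 <= R i j.
Hypothesis R_neq0 : R != 0.
Hypothesis r_gt0 : forall i, 0 < r i 0.

Let S := std_directions K d.
Let kappa : K := gauss_mass K * Num.sqrt 2 / stirling_const K.

(** By compactness; a negative c near the interval is not of the form m / n. *)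
Lemma SG_asymptotics_uniform (a b dl : K) :
  (forall c x, a <= c <= b -> simplex_interior x ->
     \det (@hess_Phi K (1 + d) R S c x) != 0) -> 0 < dl ->
  \forall n \near \oo, forall m, a <= m%:R / n%:R <= b ->
    log_close dl (SG R r n m) (kappa ^+ d * @SG_estimate K (1 + d) R r S n m).
Proof.
move=> nondeg dl0.
have /compact_near_coveringP/near_covering_withinP cov := @segment_compact K a b.
pose P (n : nat) (c : K) := forall m, c = m%:R / n%:R ->
  log_close dl (SG R r n m) (kappa ^+ d * @SG_estimate K (1 + d) R r S n m).
have covP c : `[a, b]%classic c -> \forall c' \near c & n \near \oo, `[a, b]%classic c' -> P n c'.
  rewrite /= in_itv /= => abc; have [c0|c0] := leP 0 c.
    have [[A B] /= [Ac Bn] AB] :=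
      SG_asymptotics_at R_sym R_ge0 R_neq0 r_gt0 c0 (fun x => nondeg c x abc) dl0.
    by exists (A, B) => // -[c' n] /= ABcn _; exact: (AB (c', n)).
  have N : \forall c' \near c, c' < 0 by exact: lt_nbhsl.
  exists ([set c' | c' < 0], setT); first by split=> //; exact: filterT.
  move=> [c' n] /= [c'0 _] _ m cE; exfalso.
  by move: c'0; rewrite cE ltNge divr_ge0.
have FN : Filter \oo by exact: eventually_filter.
have N : \forall n \near \oo, `[a, b]%classic `<=` P n := cov _ \oo P FN covP.
apply: filterS N => n Hn m mab.
by apply: (Hn (m%:R / n%:R)) => //; rewrite /= in_itv.
Qed.

End Uniform.

Lemma SG0 (K : realType) (q n : nat) (R : 'M[K]_q) (r : 'cV[K]_q) :
  SG R r n 0 = (\sum_i r i 0) ^+ n.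
Proof.
rewrite SG_elem_sym (eq_bigr (fun t => type_weight r t)) => [|t _]; last first.
  by rewrite elem_sym0 mulr1.
rewrite /type_weight -(bigA_distr_bigA (fun _ i => r i 0)) /=.
by rewrite prodr_const card_ord.
Qed.

(** At c = 0 only the entropy is left. *)
Lemma bilin_hess0 (K : realType) d (R : 'M[K]_(1 + d)) x (u : 'rV[K]_d) : R^T = R ->
  bilin (@hess_Phi K (1 + d) R (std_directions K d) 0 x) u =
  \sum_i (std_directions K d *m u^T) i 0 ^+ 2 / x i 0.
Proof. by move=> R_sym; rewrite bilin_hess_Phi full_hess_formE // mul0r subr0. Qed.

Lemma bilin_mx11 (K : realType) (A : 'M[K]_1) : bilin A (const_mx 1) = A 0 0.
Proof.
rewrite /bilin [A]mx11_scalar mul_mx_scalar -scalemxAl !mxE big_ord1 !mxE.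
by rewrite eqxx !mulr1.
Qed.

Section TwoTypes.
Context (K : realType).
Let R : 'M[K]_(1 + 1) := const_mx 1.
Let r : 'cV[K]_(1 + 1) := const_mx 1.
Let S := std_directions K 1.
Let phi : 'cV[K]_(1 + 1) := const_mx (1 / 2).
Let hess x : 'M[K]_1 := @hess_Phi K (1 + 1) R S 0 x.

Let R_sym : R^T = R.
Proof. by apply/matrixP => i j; rewrite !mxE. Qed.

Let R_ge0 i j : 0 <= R i j.
Proof. by rewrite mxE. Qed.

Let R_neq0 : R != 0.
Proof. by apply/eqP => /matrixP /(_ 0 0); rewrite !mxE => /eqP; rewrite oner_eq0. Qed.

Let sum2 (F : 'I_(1 + 1) -> K) : \sum_i F i = F (lshift 1 0) + F (rshift 1 0).
Proof. by rewrite big_split_ord !big_ord1. Qed.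

Let dirE (u : 'rV[K]_1) :
  (S *m u^T) (lshift 1 0) 0 = - u 0 0 /\ (S *m u^T) (rshift 1 0) 0 = u 0 0.
Proof.
rewrite /S /std_directions mul_col_mx mul1mx (@col_mxEu K 1 1 1) (@col_mxEd K 1 1 1).
by split; rewrite mxE // big_ord1 !mxE mulN1r.
Qed.

Let hessE x : bilin (hess x) (const_mx 1) = (x (lshift 1 0) 0)^-1 + (x (rshift 1 0) 0)^-1.
Proof.
rewrite bilin_hess0 // sum2; have [-> ->] := dirE (const_mx 1).
by rewrite !mxE sqrrN expr1n !mul1r.
Qed.

Let det_hessE x : \det (hess x) = (x (lshift 1 0) 0)^-1 + (x (rshift 1 0) 0)^-1.
Proof. by rewrite -hessE bilin_mx11 det_mx11. Qed.

Let hess_posdef (x : 'cV[K]_(1 + 1)) : (forall i, 0 < x i 0) -> posdef (hess x).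
Proof.
move=> x0 u u0; rewrite bilin_hess0 // sum2; have [-> ->] := dirE u.
have un : u 0 0 != 0.
  apply: contraNneq u0 => u00; apply/eqP/matrixP => i j.
  by rewrite (ord1 i) (ord1 j) u00 mxE.
by rewrite sqrrN addr_gt0 // divr_gt0 // exprn_even_gt0.
Qed.

Let phi0 i : 0 < phi i 0.
Proof. by rewrite mxE divr_gt0. Qed.

Let phi_interior : simplex_interior phi.
Proof. by split=> [|]; [exact: phi0 | rewrite sum2 !mxE; lra]. Qed.

Let grad_eq0 x : @grad_Phi K (1 + 1) R r S 0 x = 0 <->
  ln (x (lshift 1 0) 0) = ln (x (rshift 1 0) 0).
Proof.
have E : (@grad_Phi K (1 + 1) R r S 0 x *m (const_mx 1 : 'rV[K]_1)^T) 0 0 =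
    ln (x (rshift 1 0) 0) - ln (x (lshift 1 0) 0).
  rewrite grad_PhiE full_grad_formE sum2; have [-> ->] := dirE (const_mx 1).
  rewrite mulr0 !mul0r subr0 !mxE ln1; lra.
split=> [g0|lx].
  by move: E; rewrite g0 mul0mx mxE => E; apply/eqP; rewrite eq_sym -subr_eq0 -E.
apply/matrixP => i j; rewrite (ord1 i) (ord1 j) [RHS]mxE.
by move: E; rewrite lx subrr mxE big_ord1 !mxE mulr1.
Qed.

Let crit0 : @critical_minima K (1 + 1) R r S 0 = [set phi].
Proof.
apply/seteqP; split=> [x [[x0 sx] /grad_eq0 lx _]|_ ->] /=.
  have xx : x (lshift 1 0) 0 = x (rshift 1 0) 0.
    by rewrite -[LHS]lnK ?posrE // lx lnK ?posrE.
  have := sx; rewrite sum2 => sx2.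
  apply/matrixP => i j; rewrite (ord1 j) mxE.
  by case: (split_ordP i) => k ->; rewrite (ord1 k); lra.
have g0 : @grad_Phi K (1 + 1) R r S 0 phi = 0 by apply/grad_eq0; rewrite !mxE.
split=> //; apply: (posdef_local_minimum R_sym R_ge0 R_neq0 phi_interior) => //.
exact: hess_posdef.
Qed.

Lemma two_types_estimate n : @SG_estimate K (1 + 1) R r S n 0 = 2 ^+ n.
Proof.
rewrite /SG_estimate /= !mul0r crit0 fsbig_set1 /minimum_term !mul0r oppr0 !mul0r.
rewrite expr2 !mul0r subr0 expR0 !expr0 fact0 !mulr1 !mul1r -/(hess phi) det_hessE.
have -> : \prod_i phi i 0 = 1 / 4.
  by rewrite big_split_ord !big_ord1 /= !mxE; field.
rewrite !mxE; have -> : ((1 / 2)^-1 + (1 / 2)^-1) * (1 / 4) = 1 :> K by field.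
rewrite sqrtr1 invr1 mulr1 mul1r; congr (_ ^+ _).
have -> : vpow r phi = 1.
  by rewrite /vpow big1 // => i _; rewrite mxE powR1.
have -> : vpow phi phi = 1 / 2.
  rewrite /vpow big_split_ord !big_ord1 /= !mxE -powRD; last by apply/implyP => /eqP; lra.
  have -> : 1 / 2 + 1 / 2 = 1 :> K by field.
  by rewrite powRr1 // divr_ge0.
by field.
Qed.

(** With two types, R and r constant 1 and m = 0, both the number of graphs and
    the estimate are 2^n, while the asymptotic equivalence holds up to the
    factor to be determined. *)
Lemma kappa1 : gauss_mass K * Num.sqrt 2 / stirling_const K = 1.
Proof.
have r_gt0 i : 0 < r i 0 by rewrite mxE.
have nondeg c x : 0 <= c <= 0 -> simplex_interior x ->
    \det (@hess_Phi K (1 + 1) R S c x) != 0.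
  move=> c0 [x0 _]; have -> : c = 0 by apply/eqP; rewrite eq_le andbC.
  by rewrite -/(hess x) det_hessE gt_eqF // addr_gt0 // invr_gt0.
have k0 := kappa_gt0 K; set k := _ / _ in k0 *.
apply: esym; apply: log_close_eq => // e e0.
have /filter_ex [n /(_ 0%N)] := SG_asymptotics_uniform R_sym R_ge0 R_neq0 r_gt0 nondeg e0.
rewrite mul0r lexx SG0 two_types_estimate expr1 -/k => /(_ isT).
have -> : \sum_i r i 0 = 2 by rewrite sum2 !mxE.
have p2 : 0 < 2 ^+ n :> K by rewrite exprn_gt0.
move=> H; have := log_closeZ (ltW _ : 0 <= (2 ^+ n)^-1) H.
rewrite invr_gt0 => /(_ p2); rewrite mulVf ?gt_eqF // mulrCA mulVf ?gt_eqF //.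
by rewrite mulr1.
Qed.

End TwoTypes.

(** * The asymptotic formula *)

Lemma SG_eq0 (K : realType) (q n m : nat) (r : 'cV[K]_q) :
  (0 < m)%N -> SG (0 : 'M[K]_q) r n m = 0.
Proof.
move=> m0; rewrite /SG big1 // => G; rewrite inE => /andP [_ /eqP Gm].
have [e Ge] : exists e, e \in G.2 by apply/card_gt0P; rewrite Gm.
by rewrite /graph_weight [X in _ * X](bigD1 e) //= mxE mul0r mulr0.
Qed.

Lemma qform0 (K : realType) (q : nat) (x : 'cV[K]_q) : qform 0 x = 0.
Proof. by rewrite /qform mulmx0 mul0mx mxE. Qed.

Lemma SG_estimate_eq0 (K : realType) (q n m : nat) (r : 'cV[K]_q) (E : 'M[K]_(q, q.-1)) :
  (0 < m)%N -> SG_estimate 0 r E n m = 0.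
Proof.
move=> m0; rewrite /SG_estimate fsbig1 ?mulr0 // => x _.
by rewrite /minimum_term qform0 expr0n gtn_eqF // mulr0 mul0r.
Qed.

(** Every occurrence of R comes with a factor c or an exponent m. *)
Lemma SG_estimate0 (K : realType) (q n : nat) (R R' : 'M[K]_q) (r : 'cV[K]_q)
    (E : 'M[K]_(q, q.-1)) : SG_estimate R r E n 0 = SG_estimate R' r E n 0.
Proof.
have PhiE : Phi R r 0 = Phi R' r 0 by apply: funext => x; rewrite /Phi !mul0r.
have gradE x : grad_Phi R r E 0 x = grad_Phi R' r E 0 x.
  by rewrite /grad_Phi !mulr0 !mul0r !scale0r.
have crit0 : critical_minima R r E 0 = critical_minima R' r E 0.
  by apply/seteqP; split=> x [xI gx xmin]; split=> //; move: gx xmin;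
    rewrite /local_minimum_Phi ?PhiE ?gradE.
rewrite /SG_estimate mul0r crit0.
apply: congr1.
apply: eq_fsbigr => x _.
by rewrite /minimum_term /hess_Phi !(mulr0, mul0r, scale0r, oppr0, expr0, expr0n).
Qed.

Lemma irreducible_neq0 (K : realType) (d : nat) (R : 'M[K]_(1 + d)) :
  (0 < d)%N -> irreducible_matrix R -> R != 0.
Proof.
case: d R => // d R _ /(_ [set 0]%SET) [||i [j [_ _ Rij]]].
- by apply/finset.set0Pn; exists 0; rewrite inE.
- apply/eqP => /setP /(_ ord_max); rewrite !inE.
  by move/eqP/(congr1 val).
by apply: contraNneq Rij => ->; rewrite mxE.
Qed.

Theorem theorem14 (K : realType) (q : nat) (R : 'M[K]_q) (r : 'cV[K]_q)
    (E : 'M[K]_(q, q.-1)) (a b : K)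
    (q_gt0 : (0 < q)%N)
    (R_sym : R^T = R)
    (R_ge0 : forall i j, 0 <= R i j)
    (R_irr : irreducible_matrix R)
    (r_gt0 : forall i, 0 < r i 0)
    (E_dir : simplex_directions E)
    (le_ab : a <= b)
    (hess_neq0 : forall c x, a <= c <= b -> simplex_interior x ->
       \det (hess_Phi R E c x) != 0) :
  forall eps : K, 0 < eps ->
    \forall n \near \oo, forall m : nat, a <= m%:R / n%:R <= b ->
      `|SG R r n m - SG_estimate R r E n m| <= eps * `|SG_estimate R r E n m|.
Proof.
case: q R r E q_gt0 R_sym R_ge0 R_irr r_gt0 E_dir hess_neq0 => // d R r E _.
rewrite -[d.+1]/(1 + d)%N in R r E * => R_sym R_ge0 R_irr r_gt0 E_dir hess_neq0 eps eps0.
have [detE estE] := SG_estimate_std R r E_dir.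
have l0 : 0 < ln (1 + eps) by rewrite ln_gt0 // ltrDl.
have near_close (R' : 'M[K]_(1 + d)) (a' b' : K) : R'^T = R' -> (forall i j, 0 <= R' i j) ->
    R' != 0 -> (forall c x, a' <= c <= b' -> simplex_interior x ->
      \det (@hess_Phi K (1 + d) R' (std_directions K d) c x) != 0) ->
    \forall n \near \oo, forall m, a' <= m%:R / n%:R <= b' ->
      `|SG R' r n m - @SG_estimate K (1 + d) R' r (std_directions K d) n m| <=
      eps * `|@SG_estimate K (1 + d) R' r (std_directions K d) n m|.
  move=> R'_sym R'_ge0 R'_neq0 nondeg.
  have := SG_asymptotics_uniform R'_sym R'_ge0 R'_neq0 r_gt0 nondeg l0.
  apply: filterS => n Hn m mab; have := Hn m mab; rewrite kappa1 expr1n mul1r.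
  exact: log_close_dist.
have [R0|R_neq0] := eqVneq R 0; last first.
  have nondeg c x : a <= c <= b -> simplex_interior x ->
      \det (@hess_Phi K (1 + d) R (std_directions K d) c x) != 0.
    by move=> abc xI; rewrite -detE; exact: hess_neq0.
  have := near_close R a b R_sym R_ge0 R_neq0 nondeg.
  by apply: filterS => n Hn m mab; rewrite estE; exact: Hn.
(* R = 0 is possible with a single type: both sides vanish for m > 0, and for
   m = 0 the matrix may be replaced by a nonzero one *)
have d0 : d = 0%N.
  by case: (posnP d) => // d0; have := irreducible_neq0 d0 R_irr; rewrite R0 eqxx.
have R'_neq0 : const_mx 1 != 0 :> 'M[K]_(1 + d).
  by apply/eqP => /matrixP /(_ (lshift d 0) (lshift d 0)); rewrite !mxE => /eqP; rewrite oner_eq0.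
have := near_close (const_mx 1) 0 0 _ _ R'_neq0 _.
move=> /(_ _ _ _)/wrap[] //; first by apply/matrixP => i j; rewrite !mxE.
- by move=> i j; rewrite mxE.
- move=> c x _ _; move: (@hess_Phi _ _ _ _ _ _); rewrite /= d0 => A.
  by rewrite det_mx00 oner_eq0.
apply: filterS => n Hn m _; rewrite estE; have [->|m0] := posnP m; last first.
  by rewrite R0 SG_eq0 // SG_estimate_eq0 // subrr normr0 mulr0.
have := Hn 0%N; rewrite mul0r lexx !SG0 => /(_ isT).
by rewrite (SG_estimate0 _ _ R).
Qed.
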